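(* Let $n\ge2$. Given a horizontal horosphere $\mathscr H$ of $\mathbb H^{n+1}$, at height $h>0$, there exists a one-parameter family $\mathscr C:=\{\Sigma_r\mid r>0\}$ of (pairwise) noncongruent, properly embedded rotational annular translators to mean curvature flow in $\mathbb H^{n+1}$ such that, for each $r>0$, the following hold: (i) $\Sigma_r$ is contained in a slab determined by two horospheres $\mathscr H_{r^-}$ and $\mathscr H_{r^+}$. In particular, the asymptotic boundary of $\Sigma_r$ is the point at infinity of the horosphere $\mathscr H$. (ii) $\Sigma_r$ is the union of two vertical graphs $\Sigma_r^-$ and $\Sigma_r^+$ over the complement of the Euclidean $r$-ball $\mathcal B_r$ centered at the rotation axis in the horosphere $\mathscr H$. (iii) The graphs $\Sigma_r^-$ and $\Sigma_r^+$ lie in distinct connected components of $\mathbb H^{n+1}-\mathscr H$, with common boundary the $r$-sphere that bounds $\mathcal B_r$ in $\mathscr H$, with $\Sigma_r^-$ asymptotic to $\mathscr H_{r^-}$ and $\Sigma_r^+$ asymptotic to $\mathscr H_{r^+}$. In addition, when $r\to0$ or when $r\to\infty$, both $r^+$ and $r^-$ converge to $h$, and the limiting behavior of $\Sigma_r$ is as follows: (iv) As $r\to0$, $\Sigma_r$ converges (in the $C^{2,\alpha}$-norm, on compact sets away from the rotation axis $\{x_1=\cdots=x_n=0\}$) to a double copy of $\mathscr H$. (v) As $r\to+\infty$, $\Sigma_r$ escapes to infinity.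
   Context: $\mathbb H^{n+1}$, $n+1\ge 3$, is the upper half-space $\mathbb R^{n+1}_+=\{(x_1,\dots,x_{n+1}) : x_{n+1}>0\}$ with the metric $\langle\,,\rangle=d\bar s^2/x_{n+1}^2$, where $d\bar s^2$ is the Euclidean metric. For an oriented hypersurface with unit normal $N$, the shape operator is $Av=-\overline\nabla_vN$ ($\overline\nabla$ the Levi-Civita connection of $\mathbb H^{n+1}$), and the mean curvature is the normalized one, $H=(k_1+\cdots+k_n)/n$, where the $k_i$ are the eigenvalues of $A$. A translator to mean curvature flow is an oriented hypersurface $\Sigma\subset\mathbb H^{n+1}$ with $H(p)=\langle p,N(p)\rangle$ for all $p\in\Sigma$, where the point $p=(x_1,\dots,x_{n+1})$ is identified with the tangent vector $x_1\partial_{x_1}+\cdots+x_{n+1}\partial_{x_{n+1}}\in T_p\mathbb H^{n+1}$ (the Killing field of the hyperbolic translations $\Gamma_t(p)=e^tp$). For $a>0$, $\mathscr H_a=\{x_{n+1}=a\}$ denotes the horizontal horosphere at height $a$; so $\mathscr H=\mathscr H_h$, and $r^-,r^+>0$ are the heights of $\mathscr H_{r^-},\mathscr H_{r^+}$ and depend on $r$. The point at infinity of a horizontal horosphere is the point $\infty$ of the asymptotic boundary $\{x_{n+1}=0\}\cup\{\infty\}$ of $\mathbb H^{n+1}$. ''Rotational'' means invariant under the Euclidean rotations of $\mathbb R^{n+1}_+$ fixing the $x_{n+1}$-axis (the rotation axis); ''annular'' means homeomorphic to $\mathbb S^{n-1}\times\mathbb R$. ''Noncongruent'' means not related by an isometry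 of $\mathbb H^{n+1}$. A vertical graph over a subset of $\mathscr H$ is a graph $x_{n+1}=\phi(x_1,\dots,x_n)$ over that subset (identified with a subset of $\mathbb R^n$). Here $\mathcal B_r$ corresponds to $\{x_1^2+\cdots+x_n^2<r^2\}$. A graph $\phi$ being asymptotic to $\mathscr H_a$ means that $\phi(x_1,\dots,x_n)\to a$ as $x_1^2+\cdots+x_n^2\to\infty$. ''Escapes to infinity'' means that $\Sigma_r$ eventually leaves every compact subset of $\mathbb H^{n+1}$. The hypersurfaces $\Sigma_r$ are called translating catenoids, and $r$ is the neck size of $\Sigma_r$. *)

(* Defs.v *)
From mathcomp Require Import all_boot all_order all_algebra.
From mathcomp Require Import all_classical all_reals all_analysis.

Set Implicit Arguments.
Unset Strict Implicit.
Unset Printing Implicit Defensive.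
Import Order.TTheory GRing.Theory Num.Theory.
Import numFieldNormedType.Exports.
Local Open Scope classical_set_scope.
Local Open Scope ring_scope.

Section Calculus.
Variable R : realType.

(* C^(k+1) on an open set: differentiable, with C^k directional derivatives. *)
Fixpoint Ck_on (k : nat) (d : nat) (W : normedModType R) (U : set 'rV[R]_d)
    (f : 'rV[R]_d -> W) : Prop :=
  if k is k'.+1 then
    (forall p, U p -> differentiable f p) /\
    (forall v : 'rV[R]_d, Ck_on k' U (fun p => 'D_v f p))
  else forall p, U p -> {for p, continuous f}.

Definition smooth_on (d : nat) (W : normedModType R) (U : set 'rV[R]_d)
    (f : 'rV[R]_d -> W) : Prop := forall k, Ck_on k U f.

Definition basis_vec (d : nat) (i : 'I_d) : 'rV[R]_d := delta_mx 0 i.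

Definition partial (d : nat) (i : 'I_d) (f : 'rV[R]_d -> R) : 'rV[R]_d -> R :=
  fun x => 'D_(basis_vec i) f x.

(* The norm carried by 'rV[R]_d in the library is the sup norm. *)
Definition enorm (d : nat) (x : 'rV[R]_d) : R :=
  Num.sqrt (\sum_i x 0 i ^+ 2).

(* 0 is adjoined so that the supremum over the empty set is 0, not -oo. *)
Definition sup_norm (d : nat) (K : set 'rV[R]_d) (f : 'rV[R]_d -> R) : \bar R :=
  ereal_sup (0%E |` [set (`|f x|)%:E | x in K]).

Definition holder_seminorm (d : nat) (alpha : R) (K : set 'rV[R]_d)
    (f : 'rV[R]_d -> R) : \bar R :=
  ereal_sup (0%E |` [set z | exists x y, [/\ K x, K y, x != y &
    z = (`|f x - f y| / enorm (x - y) `^ alpha)%:E]]).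

Definition C2alpha_norm (d : nat) (alpha : R) (K : set 'rV[R]_d)
    (f : 'rV[R]_d -> R) : \bar R :=
  (sup_norm K f + \sum_(i < d) sup_norm K (partial i f)
   + \sum_(i < d) \sum_(j < d)
      (sup_norm K (partial i (partial j f))
       + holder_seminorm alpha K (partial i (partial j f))))%E.

Definition homeomorphic (S T : topologicalType) (A : set S) (B : set T) : Prop :=
  exists (f : S -> T) (g : T -> S),
    [/\ {within A, continuous f}, {within B, continuous g},
        (forall x, A x -> B (f x) /\ g (f x) = x) &
        (forall y, B y -> A (g y) /\ f (g y) = y)].

End Calculus.

Section Hyperbolic.
Variables (R : realType) (n : nat).

(* Points of R^(n+1) and tangent vectors; x_(n+1) is the last coordinate. *)
Notation pt := 'rV[R]_(n + 1).

Definition height (p : pt) : R := p 0 (rshift n ord0).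
Definition base (p : pt) : 'rV[R]_n := lsubmx p.

Definition upper_half_space : set pt := [set p | 0 < height p].

Definition hyp_metric (p : pt) : 'M[R]_(n + 1) := ((height p ^+ 2)^-1)%:M.

Definition hyp_inner (p v w : pt) : R := (v *m hyp_metric p *m w^T) 0 0.

(* Gamma^k_ij = (1/2) g^kl (d_i g_jl + d_j g_il - d_l g_ij). *)
Definition christoffel (g : pt -> 'M[R]_(n + 1)) (p : pt)
    (k i j : 'I_(n + 1)) : R :=
  2^-1 * \sum_l invmx (g p) k l *
    (partial i (fun q => g q j l) p + partial j (fun q => g q i l) p
     - partial l (fun q => g q i j) p).

(* Levi-Civita covariant derivative of the vector field X at p along v. *)
Definition hyp_nabla (X : pt -> pt) (p v : pt) : pt :=
  'D_v X p +
  \row_k \sum_i \sum_j christoffel hyp_metric p k i j * v 0 i * X p 0 j.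

Definition hyp_isometry (Phi : pt -> pt) : Prop :=
  exists Psi : pt -> pt,
    [/\ smooth_on upper_half_space Phi, smooth_on upper_half_space Psi,
        (forall p, upper_half_space p ->
           [/\ upper_half_space (Phi p), Psi (Phi p) = p,
               upper_half_space (Psi p) & Phi (Psi p) = p]) &
        (forall p v w, upper_half_space p ->
           hyp_inner (Phi p) ('D_v Phi p) ('D_w Phi p) = hyp_inner p v w)].

Definition congruent (S T : set pt) : Prop :=
  exists2 Phi, hyp_isometry Phi & Phi @` S = T.

(* Embedded smooth hypersurface: locally a regular level set. *)
Definition embedded_hypersurface (S : set pt) : Prop :=
  S `<=` upper_half_space /\
  forall p, S p -> exists (U : set pt) (F : pt -> R),
    [/\ open U, U p, smooth_on U F,
        (forall q, U q -> (S q <-> F q = 0)) &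
        (forall q, U q -> S q -> exists v, 'D_v F q != 0)].

(* The inclusion of S in the upper half-space is a proper map. *)
Definition properly_embedded (S : set pt) : Prop :=
  embedded_hypersurface S /\
  forall K, compact K -> K `<=` upper_half_space -> compact (S `&` K).

Definition tangent (S : set pt) (p v : pt) : Prop :=
  exists c : R -> pt,
    [/\ c 0 = p, \forall t \near (0 : R), S (c t) & is_derive (0 : R) 1 c v].

(* N is given on a neighborhood of S, as hyp_nabla requires; only its values on
   S matter, since it is differentiated in directions tangent to S only. *)
Definition unit_normal (S : set pt) (N : pt -> pt) : Prop :=
  [/\ (exists U, [/\ open U, S `<=` U & smooth_on U N]),
      (forall p, S p -> hyp_inner p (N p) (N p) = 1) &
      (forall p v, S p -> tangent S p v -> hyp_inner p v (N p) = 0)].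

Definition shape_operator (N : pt -> pt) (p v : pt) : pt := - hyp_nabla N p v.

(* k lists the n eigenvalues of the (self-adjoint) shape operator of S at p,
   with multiplicity: the rows of E are a basis of eigenvectors of T_p S. *)
Definition principal_curvatures (S : set pt) (N : pt -> pt) (p : pt)
    (k : 'rV[R]_n) : Prop :=
  exists E : 'M[R]_(n, n + 1), row_free E /\
    forall i, tangent S p (row i E) /\
              shape_operator N p (row i E) = k 0 i *: row i E.

Definition has_mean_curvature (S : set pt) (N : pt -> pt) (p : pt) (H : R) :
    Prop :=
  exists2 k, principal_curvatures S N p k & H = (\sum_i k 0 i) / n%:R.

(* In hyp_inner p p (N p), the second p is the position vector field at p. *)
Definition translator (S : set pt) : Prop :=
  embedded_hypersurface S /\
  exists2 N, unit_normal S N &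
    forall p, S p -> has_mean_curvature S N p (hyp_inner p p (N p)).

Definition rotational (S : set pt) : Prop :=
  forall Q : 'M[R]_n, Q *m Q^T = 1%:M -> \det Q = 1 ->
  forall p, S p -> S (row_mx (base p *m Q) (rsubmx p)).

Definition unit_sphere : set 'rV[R]_n := [set x | enorm x = 1].

Definition annular (S : set pt) : Prop :=
  homeomorphic S (unit_sphere `*` [set: R]).

Definition horosphere (a : R) : set pt := [set p | height p = a].

(* Ideal points live in the one-point compactification of R^(n+1); None is the
   point at infinity. *)
Definition ideal_boundary : set (one_point_compactification pt) :=
  [set None] `|` (Some @` horosphere 0).

Definition asymptotic_boundary (S : set pt) :
    set (one_point_compactification pt) :=
  closure (Some @` S : set (one_point_compactification pt)) `&` ideal_boundary.

Definition vgraph (phi : 'rV[R]_n -> R) (D : set 'rV[R]_n) : set pt :=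
  [set p | D (base p) /\ height p = phi (base p)].

(* Boundary, as a manifold, of the graph of phi over a closed region D. *)
Definition vgraph_boundary (phi : 'rV[R]_n -> R) (D : set 'rV[R]_n) : set pt :=
  vgraph phi (D `\` interior D).

Definition eball (r : R) : set 'rV[R]_n := [set x | enorm x < r].

Definition asymptotic_to (phi : 'rV[R]_n -> R) (a : R) : Prop :=
  forall e : R, 0 < e -> \forall M \near +oo, forall x,
    M <= enorm x -> `|phi x - a| < e.

Definition in_distinct_components (A S T : set pt) : Prop :=
  exists p q, [/\ A p, A q,
    connected_component A p <> connected_component A q,
    S `<=` connected_component A p & T `<=` connected_component A q].

(* C^(2,alpha) convergence to the horosphere at height h, as r -> 0+, of the
   graphs of phi r over the compact sets of H^(n+1) disjoint from the axis. *)
Definition C2alpha_cvg_to_horosphere (alpha : R) (phi : R -> 'rV[R]_n -> R)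
    (h : R) : Prop :=
  forall K : set pt, compact K -> K `<=` upper_half_space ->
    (forall p, K p -> base p != 0) ->
    C2alpha_norm alpha (base @` K) (fun x => phi r x - h) @[r --> 0^'+]
      --> 0%E.

End Hyperbolic.

Arguments upper_half_space {R n}.
Arguments eball {R n}.
Arguments horosphere {R n}.

(* Main.v *)
(* Rotating a curve z |-> (rho, z) gives a translator iff
   rho'' = (1 + rho'^2) ((n - 1) / rho + n rho / z^2). This is convex, so the slope
   t = rho' is a global parameter, and in terms of t the equation is homogeneous of
   degree one in (rho, z): the ratio q = rho / z solves a scalar ODE that is Lipschitz
   on the whole line, and log z is then a primitive. Hence the curve exists for all
   slopes t; it starts at the neck t = 0, and |log (z / h)| <= 1 with bounds tending
   to 0 as the neck size r tends to 0 or to infinity, which gives the slab, the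
   asymptotes and the limits of the heights. Away from the axis the slopes of the two
   graphs are O(r), and the equation turns this into C^{2,alpha} convergence.
   An isometry preserves the hyperbolic distance; comparing the distances from two
   fixed points to points of the hypersurface running off to infinity at bounded
   height shows that an isometry between two catenoids multiplies all heights by a
   constant and is then a Euclidean similarity, and matching necks forces equal neck sizes. *)

(* All height bounds come from one comparison: the derivative of [log z] in [t] is $K / (z (1 +
   t^2))$, with [K] the value of [profile_speed], and it is dominated by $c / (1 + a t)^2$, whose
   integral over $t \ge 0$ is $c / a$. Inequalities of means bound $K / z$ by $1/2$, by $z / (2
   \rho)$ and by $\rho / z$. The first gives $c / a = 1$, the second a multiple of $1/r$, the third
   combined with the first a multiple of $\sqrt r$. At the neck the graphs over the horosphere have
   infinite slope. So the hypersurface itself is described by its radius as a function of height,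
   which is smooth across the neck; graphs over the exterior of the ball serve only for the two
   sheets and their limits. An isometry is given infinitesimally, by its differential. The passage
   to distances avoids infima of lengths: an explicit geodesic is carried over by the isometry, and
   the length of its image bounds the explicit function [hdelta] at the end points; the inverse
   isometry gives the other inequality. No classification of isometries is used: those moving the
   point at infinity are excluded by the positive lower bound on the heights of the image. *)
Require Import Defs.
From mathcomp Require Import all_boot all_order all_algebra.
From mathcomp Require Import all_classical all_reals all_analysis.
From mathcomp Require Import ring lra.
Import Order.TTheory GRing.Theory Num.Theory.
Import numFieldNormedType.Exports.
Set Implicit Arguments.
Unset Strict Implicit.
Unset Printing Implicit Defensive.
Local Open Scope classical_set_scope.
Local Open Scope ring_scope.

(** * Calculus on the line *)

Section RealCalculus.
Variable R : realType.
Implicit Types (f g df dg : R -> R) (a b c x y t : R).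

Lemma is_derive_continuous f x l : is_derive x 1 f l -> {for x, continuous f}.
Proof.
by move=> [df _]; apply/differentiable_continuous/derivable1_diffP.
Qed.

Lemma mean_value f df a b : a <= b ->
  (forall x, a <= x <= b -> is_derive x 1 f (df x)) ->
  exists2 c, a <= c <= b & f b - f a = df c * (b - a).
Proof.
move=> ab fD.
have [x xab||c cab ->] := @MVT_segment R f df a b ab.
- by apply: fD; move: xab; rewrite in_itv/= => /andP[/ltW -> /ltW ->].
- by apply: derivable_within_continuous => x; rewrite in_itv/= => /fD [].
- by exists c.
Qed.

(** Comparing increments stands in for integral estimates: in every use one of the two functions is
    an explicit primitive. *)
Lemma increment_le f g df dg a b : a <= b ->
  (forall x, a <= x <= b -> is_derive x 1 f (df x)) ->
  (forall x, a <= x <= b -> is_derive x 1 g (dg x)) ->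
  (forall x, a <= x <= b -> df x <= dg x) ->
  f b - f a <= g b - g a.
Proof.
move=> ab fD gD le.
have [|c cab] := @mean_value (g \- f) (fun x => dg x - df x) a b ab.
  by move=> x xab; apply: is_deriveB; [exact: gD|exact: fD].
have := mulr_ge0 (_ : 0 <= dg c - df c) (_ : 0 <= b - a).
rewrite !subr_ge0 => /(_ (le c cab) ab) + /= e; rewrite -e.
lra.
Qed.

Lemma increment_norm_le f g df dg a b : a <= b ->
  (forall x, a <= x <= b -> is_derive x 1 f (df x)) ->
  (forall x, a <= x <= b -> is_derive x 1 g (dg x)) ->
  (forall x, a <= x <= b -> `|df x| <= dg x) ->
  `|f b - f a| <= g b - g a.
Proof.
move=> ab fD gD le; rewrite ler_norml; apply/andP; split.
  rewrite lerNl -[_ - f a]opprK opprK.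
  have -> : - (f b - f a) = (\- f) b - (\- f) a by rewrite /=; lra.
  apply: (increment_le ab (df := fun x => - df x) (dg := dg)) => // x xab.
    by apply: is_deriveN; exact: fD.
  by rewrite lerNl; have := le x xab; rewrite ler_norml => /andP[].
apply: (increment_le ab fD gD) => x xab.
exact: le_trans (ler_norm _) (le x xab).
Qed.

Lemma derive_eq0_cst f a b : a <= b ->
  (forall x, a <= x <= b -> is_derive x 1 f 0) -> f a = f b.
Proof.
move=> ab /(mean_value ab)[c _]; rewrite mul0r => /eqP.
by rewrite subr_eq0 => /eqP.
Qed.

Lemma primitive_from f a : continuous f ->
  exists F : R -> R, forall x, a < x -> is_derive x 1 F (f x).
Proof.
move=> cf; exists (fun x => \int[lebesgue_measure]_(t in [set` `[a, x]]) f t).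
move=> x ax.
have xx1 : x < x + 1 by rewrite ltrDl.
have fi : lebesgue_measure.-integrable `[a, x + 1] (EFin \o f).
  apply: continuous_compact_integrable; first exact: segment_compact.
  exact: continuous_subspaceT.
have [dF F'] := continuous_FTC1_closed xx1 fi ax (cf x).
by split; [exact: dF|rewrite -derive1E; exact: F'].
Qed.

(** [primitive_from] gives a derivative only to the right of its base point. Primitives with
    different base points, normalised at 0, agree where both are available and so glue to the whole
    line. *)
Lemma primitive f : continuous f ->
  exists2 F : R -> R, F 0 = 0 & forall x, is_derive x 1 F (f x).
Proof.
move=> cf.
have /choice[F FD] a := primitive_from a cf.
pose G a x := F a x - F a 0.
have GD a x : a < x -> is_derive x 1 (G a) (f x).
  move=> ax; rewrite -[f x]subr0.
  by apply: is_deriveB; exact: FD.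
have Geq a b x : a < 0 -> b < 0 -> a < x -> b < x -> G a x = G b x.
  move=> a0 b0 ax bx.
  have D y : a < y -> b < y -> is_derive y 1 (G a \- G b) 0.
    by move=> ay yb; rewrite -(subrr (f y)); apply: is_deriveB; exact: GD.
  have G0 : (G a \- G b) 0 = 0 by rewrite /= /G !subrr.
  apply/eqP; rewrite -subr_eq0 -[X in X == _]/((G a \- G b) x); apply/eqP.
  rewrite -G0; case: (leP 0 x) => x0.
    by apply/esym/derive_eq0_cst => // y /andP[y0 _]; apply: D; lra.
  apply/derive_eq0_cst => //; first exact: ltW.
  by move=> y /andP[y0 _]; apply: D; lra.
(* This base point lies to the left of both 0 and [x]. It moves with [x], so near [x] it is
   exchanged for the fixed base point [- |x| - 2]. *)
exists (fun x => G (- `|x| - 1) x); first by rewrite /G subrr.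
move=> x; have nx := normr_ge0 x.
have lx y : - `|y| - 1 < y.
  by have := ler_norm (- y); rewrite normrN; lra.
apply: (near_eq_is_derive (f := G (- `|x| - 2))).
- near=> y; apply: Geq.
  + by lra.
  + by have := normr_ge0 y; lra.
  + have : `|x - y| < 1 by near: y; exact: cvgr_dist_lt.
    by have := lx x; rewrite ltr_norml; lra.
  + exact: lx.
- by apply: GD; have := lx x; lra.
Unshelve. all: by end_near. Qed.

End RealCalculus.

(** * The Picard-Lindelof theorem *)

Section Picard.
Variable R : realType.
Implicit Types (u v w dw : R -> R) (s t x y : R).

Lemma ltr_geometric x c : 0 < x -> exists k, c * 2^-1 ^+ k < x.
Proof.
move=> x0; have [c0|c0] := leP c 0.
  by exists 0%N; rewrite expr0 mulr1 (le_lt_trans c0).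
have h1 : `|2^-1 : R| < 1 by rewrite ger0_norm ?invr_ge0// invf_lt1 ?ltr1n// ltr0n.
have /cvgrPdist_lt H := cvg_expr h1.
have [N _ /(_ N (leqnn N))] := H (x / c) (divr_gt0 x0 c0).
rewrite /= sub0r normrN ger0_norm ?exprn_ge0//.
by exists N; rewrite mulrC -ltr_pdivlMr.
Qed.

Lemma le0_geometric x c : (forall k, x <= c * 2^-1 ^+ k) -> x <= 0.
Proof.
move=> xc; have [//|/ltr_geometric-/(_ c)[k]] := leP x 0.
by rewrite ltNge xc.
Qed.

(** Integration gains a factor [1 / a] in the sup norm weighted by [expR (a * |t|)]. *)
Lemma exp_growth w dw a M : 0 < a -> w 0 = 0 ->
  (forall t, is_derive t 1 w (dw t)) ->
  (forall t, `|dw t| <= a * M * expR (a * `|t|)) ->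
  forall t, `|w t| <= M * expR (a * `|t|).
Proof.
move=> a0; wlog suff H : w dw / w 0 = 0 ->
    (forall t, is_derive t 1 w (dw t)) ->
    (forall t, `|dw t| <= a * M * expR (a * `|t|)) ->
    forall t, 0 <= t -> `|w t| <= M * expR (a * `|t|).
  move=> w0 wD dwM t; case: (leP 0 t) => t0; first exact: (H w dw).
  have := H (w \o -%R) (fun t => - dw (- t)) _ _ _ (- t).
  rewrite /= opprK normrN; apply.
  - by rewrite oppr0.
  - move=> s; rewrite -mulrN1; apply: is_derive1_comp.
  - by move=> s; rewrite normrN -[`|s|]normrN; exact: dwM.
  - by rewrite oppr_ge0 ltW.
move=> w0 wD dwM t t0.
have M0 : 0 <= M.
  have := dwM 0; rewrite normr0 mulr0 expR0 mulr1 => /(le_trans (normr_ge0 _)).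
  by rewrite pmulr_rge0.
have := @increment_norm_le R w (fun s => M * expR (a * s)) dw
  (fun s => a * M * expR (a * s)) 0 t t0.
rewrite w0 subr0 mulr0 expR0 mulr1 => H.
rewrite (ger0_norm t0); apply: le_trans (H _ _ _) _.
- move=> s _; apply: is_derive_eq.
  rewrite /GRing.scale/=; ring.
- by move=> s /andP[s0 _]; rewrite -{2}(ger0_norm s0).
- by rewrite lerBlDr lerDl.
Qed.

(** The Lipschitz constant is uniform in [t], so in the norm weighted by [expR (2 * L * |t|)] the
    Picard map halves distances on the whole line at once, and a global solution appears without
    continuing local ones. The bound [C] makes the first step finite in this norm. *)
Theorem Picard_Lindelof (f : R -> R -> R) (L C x0 : R) : 0 < L ->
  (forall t x y, `|f t x - f t y| <= L * `|x - y|) ->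
  (forall t, `|f t x0| <= C) ->
  (forall u, continuous u -> continuous (fun t => f t (u t))) ->
  exists2 u : R -> R, u 0 = x0 & forall t, is_derive t 1 u (f t (u t)).
Proof.
move=> L0 fL fC fcont.
have /choice[S SP] u : exists v, continuous u ->
    v 0 = x0 /\ forall t, is_derive t 1 v (f t (u t)).
  have [uc|nc] := pselect (continuous u); last by exists u.
  have [F F0 FD] := primitive (fcont _ uc).
  exists (fun t => F t + x0) => _; rewrite F0 add0r; split => // t.
  by rewrite -[f t _]addr0; apply: is_deriveD; exact: FD.
have Sc u : continuous u -> continuous (S u).
  by move=> uc t; apply: (is_derive_continuous ((SP u uc).2 t)).
pose U k := iter k S (cst x0).
have Uc k : continuous (U k).
  by elim: k => [|k IH]; [move=> t; exact: cvg_cst|exact: Sc].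
pose a := 2 * L; pose M := C / a; pose E t := expR (a * `|t|).
have a0 : 0 < a by rewrite mulr_gt0.
have E0 t : 0 < E t by exact: expR_gt0.
have M0 : 0 <= M.
  by rewrite divr_ge0 ?(ltW a0)// (le_trans (normr_ge0 _) (fC 0)).
have Sdist u v c : continuous u -> continuous v ->
    (forall t, `|u t - v t| <= c * E t) ->
    forall t, `|S u t - S v t| <= c / 2 * E t.
  move=> uc vc uv; apply: (exp_growth (dw := fun t => f t (u t) - f t (v t))) => //.
  - by rewrite /= (SP u uc).1 (SP v vc).1 subrr.
  - by move=> t; apply: is_deriveB; [exact: (SP u uc).2|exact: (SP v vc).2].
  - move=> t; apply: le_trans (fL _ _ _) _.
    have -> : a * (c / 2) * expR (a * `|t|) = L * (c * E t).
      by rewrite /a /E; field.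
    by rewrite ler_pM2l.
have Ustep k t : `|U k.+1 t - U k t| <= M * 2^-1 ^+ k * E t.
  elim: k t => [|k IH] t; last by rewrite exprSr mulrA; exact: (Sdist (U k.+1) (U k)).
  rewrite expr0 mulr1.
  apply: (exp_growth (dw := fun t => f t x0 - 0) (w := fun t => S (cst x0) t - x0)) => //.
  - by rewrite (SP _ (Uc 0%N)).1 subrr.
  - move=> s; apply: is_deriveB; exact: (SP _ (Uc 0%N)).2.
  - move=> s; rewrite subr0; apply: le_trans (fC s) _.
    have -> : a * M = C by rewrite /M mulrC divfK// gt_eqF.
    rewrite ler_peMr ?(le_trans (normr_ge0 _) (fC 0))//.
    by rewrite -expR0 ler_expR mulr_ge0// ltW.
(* The sum of the geometric bounds on all steps from [k] on. Hence [U k - D k] increases with [k]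
   and [U k + D k] decreases, and the limit can be taken as the supremum of the lower brackets. *)
pose D k t := 2 * M * 2^-1 ^+ k * E t.
have DS k t : D k.+1 t = D k t - M * 2^-1 ^+ k * E t.
  by rewrite /D exprS; field.
have D0 k t : 0 <= D k t.
  apply: mulr_ge0; last exact: ltW.
  by apply: mulr_ge0; [exact: mulr_ge0|rewrite exprn_ge0// invr_ge0].
have lowS k t : U k t - D k t <= U k.+1 t - D k.+1 t.
  by have := Ustep k t; rewrite DS ler_norml; lra.
have uppS k t : U k.+1 t + D k.+1 t <= U k t + D k t.
  by have := Ustep k t; rewrite DS ler_norml; lra.
have low k l t : U k t - D k t <= U (k + l)%N t - D (k + l)%N t.
  by elim: l => [|l IH]; rewrite ?addn0// addnS (le_trans IH).
have upp k l t : U (k + l)%N t + D (k + l)%N t <= U k t + D k t.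
  by elim: l => [|l IH]; rewrite ?addn0// addnS (le_trans (uppS _ _)).
have lowupp k l t : U k t - D k t <= U l t + D l t.
  apply: le_trans (low k l t) _; rewrite addnC.
  by apply: le_trans (upp l k t); rewrite lerD2l; have := D0 (l + k)%N t; lra.
pose A t := [set U k t - D k t | k in setT].
have supA t : has_sup (A t).
  split; first by exists (U 0%N t - D 0%N t), 0%N.
  by exists (U 0%N t + D 0%N t) => _ [k _ <-].
pose u t := sup (A t).
have uU k t : `|u t - U k t| <= D k t.
  have lo : U k t - D k t <= u t by apply: ub_le_sup; [exact: (supA t).2|exists k].
  have up : u t <= U k t + D k t.
    by apply: ge_sup; [exact: (supA t).1|move=> _ [l _ <-]].
  by rewrite ler_norml; lra.
have uc : continuous u.
  move=> t; apply/cvgrPdist_lt => e e0.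
  (* [B] bounds [E t + E s] for all [s] within 1 of [t], so the convergence is uniform near [t]. *)
  pose B := E t + expR (a * (`|t| + 1)).
  have [k kB] := ltr_geometric (2 * M * B) (divr_gt0 e0 (ltr0n R 2)).
  near=> s.
  have tUs : `|U k t - U k s| < e / 2.
    by near: s; apply: cvgr_dist_lt; [exact: Uc|rewrite divr_gt0].
  have Es : E s <= expR (a * (`|t| + 1)).
    rewrite ler_expR ler_pM2l//.
    have : `|t - s| < 1 by near: s; exact: cvgr_dist_lt.
    have := ler_normD (s - t) t; rewrite subrK distrC; lra.
  have H : `|u t - u s| <=
      `|U k t - U k s| + 2 * M * (E t + E s) * 2^-1 ^+ k.
    have := uU k t; have := uU k s; rewrite /D.
    have := ler_normD (u t - U k t) (U k t - u s).
    have := ler_normD (U k t - U k s) (U k s - u s).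
    rewrite !subrKA (distrC (U k s) (u s)); lra.
  apply: le_lt_trans H _.
  suff : 2 * M * (E t + E s) * 2^-1 ^+ k <= 2 * M * B * 2^-1 ^+ k by lra.
  apply: ler_wpM2r; first by rewrite exprn_ge0// invr_ge0.
  by apply: ler_wpM2l; [exact: mulr_ge0|rewrite lerD2l].
exists u.
  apply/eqP; rewrite -subr_eq0 -normr_le0; apply: (@le0_geometric _ (2 * M * E 0)).
  move=> k; have := uU k 0; rewrite /D.
  have -> : U k 0 = x0 by case: k => //= k; rewrite (SP _ (Uc k)).1.
  by rewrite mulrAC.
have Su : S u =1 u.
  move=> t; apply/eqP; rewrite -subr_eq0 -normr_le0.
  apply: (@le0_geometric _ (2 * M * E t)) => k.
  have := uU k.+1 t.
  have := @Sdist u (U k) (2 * M * 2^-1 ^+ k) uc (Uc k) (uU k) t.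
  have := ler_normD (S u t - U k.+1 t) (U k.+1 t - u t).
  rewrite subrKA (distrC (U k.+1 t)) DS /D /=; lra.
move=> t; have := (SP u uc).2 t.
by have -> : S u = u by apply/funext.
Unshelve. all: by end_near. Qed.
End Picard.

(** * The generating curve *)

Section Profile.
Variable R : realType.
Implicit Types (m h r rho z t x y q : R).

(** The reciprocal of [(m - 1) / rho + m * rho / z^2]. Since [rho''] is the derivative of the slope
    [t] with respect to [z], the equation of the curve says that [z] moves with speed
    [profile_speed / (1 + t^2)] in [t]. *)
Definition profile_speed m rho z : R :=
  rho * z ^+ 2 / ((m - 1) * z ^+ 2 + m * rho ^+ 2).

(* The generating curve [(rho, z)], parametrized by its slope [t = d rho / d z] to
   keep the neck [t = 0] regular; [m] is the dimension of the hypersurface. *)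
Definition profile m h r (rho z : R -> R) : Prop :=
  [/\ rho 0 = r, z 0 = h, (forall t, 0 < rho t /\ 0 < z t),
      (forall t, is_derive t 1 rho
        (t * profile_speed m (rho t) (z t) / (1 + t ^+ 2))) &
      (forall t, is_derive t 1 z
        (profile_speed m (rho t) (z t) / (1 + t ^+ 2)))].

(** The right-hand side of the equation for [q = rho / z]. It is free of [z] because [profile_speed]
    is homogeneous of degree one in [(rho, z)]. *)
Definition ratio_field m t q : R :=
  q * (t - q) / ((m - 1 + m * q ^+ 2) * (1 + t ^+ 2)).

(** The difference quotient is an explicit fraction. Inequalities of means bound both
    [m - 1 - m x y] and [(m - 1) (x + y)] by [D x * D y], and [|t|] is at most [1 + t^2]; the two
    terms account for the constant 2. *)
Lemma ratio_field_lipschitz m t x y : 2 <= m ->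
  `|ratio_field m t x - ratio_field m t y| <= 2 * `|x - y|.
Proof.
move=> m2; pose D q := m - 1 + m * q ^+ 2.
have D1 q : 1 <= D q.
  by have := sqr_ge0 q; rewrite /D; nra.
have t0 : 0 < 1 + t ^+ 2 by have := sqr_ge0 t; lra.
have Dp : 0 < D x * D y * (1 + t ^+ 2).
  by rewrite !mulr_gt0// (lt_le_trans ltr01).
have -> : ratio_field m t x - ratio_field m t y =
  (x - y) * ((t * (m - 1 - m * (x * y)) - (m - 1) * (x + y))
     / (D x * D y * (1 + t ^+ 2))).
  rewrite /ratio_field /D; field; rewrite -!/(D _).
  by rewrite !gt_eqF// (lt_le_trans ltr01).
rewrite normrM mulrC; apply: ler_wpM2r => //.
rewrite normrM normfV (gtr0_norm Dp) ler_pdivrMr//.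
have m0 : 0 <= m by lra.
have m2' : 0 <= m - 2 by lra.
have m1' : 0 <= m - 1 by lra.
have sq u v c : 0 <= u -> 0 <= v -> 0 <= u * v * c ^+ 2 :> R.
  by move=> u0 v0; rewrite mulr_ge0 ?sqr_ge0// mulr_ge0.
have mm2 : 0 <= (m - 1) * (m - 2) by rewrite mulr_ge0.
have mxy := sq _ _ (x * y) m0 m0.
have mx := sq _ _ x m0 m2'; have my := sq _ _ y m0 m2'.
have m1x := sq _ _ x m1' m1'; have m1y := sq _ _ y m1' m1'.
have a : `|m - 1 - m * (x * y)| <= D x * D y.
  rewrite ler_norml; apply/andP; split.
    have := sq _ _ (x - y) m0 ler01; have := sq _ _ x m0 ler01.
    have := sq _ _ y m0 ler01; rewrite /D; lra.
  have := sq _ _ (x + y) m0 ler01; have := sq _ _ x m0 ler01.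
  have := sq _ _ y m0 ler01; rewrite /D; lra.
have b : `|(m - 1) * (x + y)| <= D x * D y.
  have mx1 := sq _ _ x m1' ler01; have my1 := sq _ _ y m1' ler01.
  rewrite ler_norml; apply/andP; split.
    have := sq _ _ (x + 2^-1) m1' ler01.
    have := sq _ _ (y + 2^-1) m1' ler01; rewrite /D; lra.
  have := sq _ _ (x - 2^-1) m1' ler01.
  have := sq _ _ (y - 2^-1) m1' ler01; rewrite /D; lra.
have nt : `|t| <= 1 + t ^+ 2.
  by rewrite ler_norml; have := sqr_ge0 (t - 2^-1); have := sqr_ge0 (t + 2^-1); nra.
apply: le_trans (ler_normB _ _) _; rewrite normrM.
have := ler_pM (normr_ge0 _) (normr_ge0 _) nt a.
have D0 : 0 <= D x * D y by apply: le_trans a.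
have := sqr_ge0 t; nra.
Qed.

Lemma profile_exists m h r : 2 <= m -> 0 < h -> 0 < r ->
  exists rho z : R -> R, profile m h r rho z.
Proof.
move=> m2 h0 r0.
have t1 t : 0 < 1 + t ^+ 2 :> R by have := sqr_ge0 t; lra.
have D0 q : 0 < m - 1 + m * q ^+ 2 by have := sqr_ge0 q; nra.
have cdiv (f g : R -> R) : continuous f -> continuous g ->
    continuous (fun t => f t / ((m - 1 + m * g t ^+ 2) * (1 + t ^+ 2))).
  move=> cf cg t; apply: cvgM; first exact: cf.
  apply: cvgV; first by rewrite mulf_neq0// gt_eqF.
  apply: cvgM; (apply: cvgD; first exact: cvg_cst).
    apply: cvgM; first exact: cvg_cst.
    by apply: cvgM; exact: cg.
  by apply: cvgM; exact: cvg_id.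
have fcont u : continuous u -> continuous (fun t => ratio_field m t (u t)).
  move=> cu; apply: cdiv => // t.
  apply: cvgM; first exact: cu.
  by apply: cvgB; [exact: cvg_id|exact: cu].
have [||||q q0 qD] := @Picard_Lindelof R (ratio_field m) 2 (2 * `|r / h|) (r / h).
- by [].
- by move=> *; exact: ratio_field_lipschitz.
(* The field vanishes at [q = 0], so the Lipschitz bound also bounds its value at the initial
   point. *)
- move=> t; have := ratio_field_lipschitz t (r / h) 0 m2.
  by rewrite {2}/ratio_field mul0r mul0r !subr0.
- exact: fcont.
have qc : continuous q by move=> t; apply: (is_derive_continuous (qD t)).
(* The field has [q] as a factor; with [G] a primitive of the cofactor, [q] is [r / h] times
   [expR G] and therefore stays positive. *)
have [G G0 GD] : exists2 G : R -> R, G 0 = 0 & forall t, is_derive t 1 G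
    ((t - q t) / ((m - 1 + m * q t ^+ 2) * (1 + t ^+ 2))).
  apply: primitive; apply: cdiv => // t.
  by apply: cvgB; [exact: cvg_id|exact: qc].
have qE t : q t = r / h * expR (G t).
  have D (s : R) : is_derive s 1 (fun t => q t * expR (- G t)) 0.
    apply: is_derive_eq; rewrite /GRing.scale/= /ratio_field; field.
    by rewrite !gt_eqF.
  have := is_derive_0_is_cst t 0 D.
  rewrite G0 q0 oppr0 expR0 mulr1 => <-.
  by rewrite -mulrA -expRD addNr expR0 mulr1.
have qp t : 0 < q t by rewrite qE mulr_gt0 ?expR_gt0 ?divr_gt0.
(* [y] is [log (z / h)]: for [rho = q * z] the speed is [z * q / (m - 1 + m * q^2)], so the
   logarithm of [z] has a known derivative. *)
have [y y0 yD] : exists2 y : R -> R, y 0 = 0 & forall t, is_derive t 1 y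
    (q t / ((m - 1 + m * q t ^+ 2) * (1 + t ^+ 2))).
  by apply: primitive; exact: cdiv.
pose z t := h * expR (y t).
have zp t : 0 < z t by rewrite mulr_gt0 ?expR_gt0.
have zD t : is_derive t 1 z
    (z t * (q t / ((m - 1 + m * q t ^+ 2) * (1 + t ^+ 2)))).
  apply: is_derive_eq; rewrite -![_ *: _]/(_ * _) /z; ring.
have den a b : 0 < a -> 0 < b -> 0 < (m - 1) * b ^+ 2 + m * (a * b) ^+ 2 :> R.
  move=> a0 b0; have -> : (m - 1) * b ^+ 2 + m * (a * b) ^+ 2 =
    (m - 1 + m * a ^+ 2) * b ^+ 2 by ring.
  by rewrite mulr_gt0// exprn_gt0.
exists (fun t => q t * z t), z; split.
- by rewrite q0 /z y0 expR0 mulr1 divfK// gt_eqF.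
- by rewrite /z y0 expR0 mulr1.
- by move=> t; rewrite mulr_gt0.
- move=> t; apply: (is_derive_eq (is_deriveM (qD t) (zD t))).
  rewrite -![_ *: _]/(_ * _) /ratio_field /profile_speed; field.
  by rewrite !gt_eqF ?t1 ?D0 ?zp ?qp ?den.
- move=> t; apply: (is_derive_eq (zD t)).
  rewrite /profile_speed; field.
  by rewrite !gt_eqF ?t1 ?D0 ?zp ?qp ?den.
Qed.
End Profile.

Lemma is_derive1_ln_sqrD1 (R : realType) (x : R) :
  is_derive x 1 (fun t : R => ln (1 + t ^+ 2)) (2 * x / (1 + x ^+ 2)).
Proof.
have Dx : is_derive x 1 (fun t : R => 1 + t ^+ 2) (2 * x).
  by apply: is_derive_eq; rewrite -![_ *: _]/(_ * _) /=; ring.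
have x0 : 0 < 1 + x ^+ 2 by have := sqr_ge0 x; lra.
have := @is_derive1_comp R (@ln R) (fun t : R => 1 + t ^+ 2) x _ _ (is_derive1_ln x0) Dx.
by rewrite mulrC.
Qed.

(** * Monotonicity and growth of the generating curve *)

Section ProfileProperties.
Variable R : realType.
Implicit Types (s t x y c a b e : R).

Lemma profile_speed_gt0 (m rho z : R) : 2 <= m -> 0 < rho -> 0 < z ->
  0 < profile_speed m rho z.
Proof.
move=> m2 p0 z0; have z2 : 0 < z ^+ 2 by rewrite exprn_gt0.
have p2 : 0 < rho ^+ 2 by rewrite exprn_gt0.
rewrite /profile_speed divr_gt0 ?mulr_gt0//; nra.
Qed.

(** The denominator of [profile_speed] is at least [2 * rho * z], [2 * rho^2] and [z^2]
    respectively. *)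
Lemma profile_speed_le (m rho z : R) : 2 <= m -> 0 < rho -> 0 < z ->
  [/\ profile_speed m rho z <= z / 2,
      profile_speed m rho z <= z * (z / (2 * rho)) &
      profile_speed m rho z <= z * (rho / z)].
Proof.
move=> m2 p0 z0; have z2 : 0 < z ^+ 2 by rewrite exprn_gt0.
have p2 : 0 < rho ^+ 2 by rewrite exprn_gt0.
have pz : 0 < rho * z by rewrite mulr_gt0.
have D0 : 0 < (m - 1) * z ^+ 2 + m * rho ^+ 2 by nra.
have mz : 0 <= (m - 2) * z ^+ 2 by rewrite mulr_ge0 ?subr_ge0// ltW.
have mp : 0 <= (m - 2) * rho ^+ 2 by rewrite mulr_ge0 ?subr_ge0// ltW.
have zp2 := sqr_ge0 (z - rho).
rewrite /profile_speed; split; rewrite ler_pdivrMr//.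
- have := mulr_ge0 (ltW z0) (_ : 0 <= (m - 1) * z ^+ 2 + m * rho ^+ 2 - 2 * rho * z).
  have h2 : 0 <= (m - 1) * z ^+ 2 + m * rho ^+ 2 - 2 * rho * z by lra.
  by move=> /(_ h2); lra.
- rewrite mulrA -expr2 mulrAC ler_pdivlMr ?mulr_gt0//.
  rewrite [leLHS](_ : _ = z ^+ 2 * (2 * rho ^+ 2)); last by ring.
  by apply: ler_wpM2l; [exact: ltW|lra].
- rewrite (mulrC z) divfK ?gt_eqF//.
  by apply: ler_wpM2l; [exact: ltW|lra].
Qed.

Variables (m h r : R) (rho z : R -> R).
Hypotheses (m2 : 2 <= m) (h0 : 0 < h) (r0 : 0 < r).
Hypothesis pf : profile m h r rho z.

Let K t := profile_speed m (rho t) (z t).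

Let rho_gt0 t : 0 < rho t. Proof. by case: pf => _ _ /(_ t) []. Qed.
Let z_gt0 t : 0 < z t. Proof. by case: pf => _ _ /(_ t) []. Qed.

Let K_gt0 t : 0 < K t.
Proof. exact: profile_speed_gt0. Qed.

Lemma sqrD1_gt0 t : 0 < 1 + t ^+ 2.
Proof. by have := sqr_ge0 t; lra. Qed.

Lemma is_derive_scale_arg (f : R -> R) (df s t : R) :
  is_derive (s * t) 1 f df -> is_derive t 1 (fun t => f (s * t)) (s * df).
Proof.
move=> fD; have gD : is_derive t 1 (fun t => s * t) s.
  by apply: is_derive_eq; rewrite -![_ *: _]/(_ * _); ring.
by rewrite mulrC; exact: (is_derive1_comp fD gD).
Qed.

(** The sign [s] selects the half of the curve above the neck ([s = 1]) or below it ([s = -1]); with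
    [t >= 0] as absolute slope, both halves are treated at once. *)
Lemma branch_rho_derive s t : s ^+ 2 = 1 ->
  is_derive t 1 (fun t => rho (s * t)) (t * K (s * t) / (1 + t ^+ 2)).
Proof.
move=> s1; case: pf => _ _ _ /(_ (s * t)) /is_derive_scale_arg + _.
move=> /is_derive_eq; apply; rewrite exprMn s1 mul1r -/(K _).
by rewrite 3!mulrA -expr2 s1 mul1r.
Qed.

Lemma branch_z_derive s t : s ^+ 2 = 1 ->
  is_derive t 1 (fun t => z (s * t)) (s * K (s * t) / (1 + t ^+ 2)).
Proof.
move=> s1; case: pf => _ _ _ _ /(_ (s * t)) /is_derive_scale_arg.
by move=> /is_derive_eq; apply; rewrite exprMn s1 mul1r -/(K _) mulrA.
Qed.

Lemma branch_rho_lt s t u : s ^+ 2 = 1 -> 0 <= t -> t < u ->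
  rho (s * t) < rho (s * u).
Proof.
move=> s1 t0 tu.
have D x := branch_rho_derive x s1.
have M a b : 0 <= a -> a < b -> exists2 c, a <= c <= b &
    rho (s * b) - rho (s * a) = c * K (s * c) / (1 + c ^+ 2) * (b - a).
  move=> a0 ab.
  exact: (mean_value (f := fun t => rho (s * t))
    (df := fun t => t * K (s * t) / (1 + t ^+ 2)) (ltW ab)).
(* The derivative vanishes at slope 0, so strict growth is read off on the right half of the
   interval, where the slope is positive. *)
pose v := (t + u) / 2.
have [c cv e1] := M t v t0 ltac:(rewrite /v; lra).
have [d dv e2] := M v u ltac:(rewrite /v; lra) ltac:(rewrite /v; lra).
have : 0 <= rho (s * v) - rho (s * t).
  rewrite e1; apply: mulr_ge0; last by rewrite /v; lra.
  by apply: divr_ge0; [apply: mulr_ge0; [lra|exact: ltW]|exact/ltW/sqrD1_gt0].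
have : 0 < rho (s * u) - rho (s * v).
  rewrite e2; apply: mulr_gt0; last by rewrite /v; lra.
  apply: divr_gt0; last exact: sqrD1_gt0.
  by apply: mulr_gt0 => //; rewrite /v in dv; lra.
lra.
Qed.

Lemma branch_rho_le s t u : s ^+ 2 = 1 -> 0 <= t -> t <= u ->
  rho (s * t) <= rho (s * u).
Proof.
move=> s1 t0; rewrite le_eqVlt => /predU1P[-> //|tu].
exact/ltW/branch_rho_lt.
Qed.

Lemma branch_rho_ge s t : s ^+ 2 = 1 -> 0 <= t -> r <= rho (s * t).
Proof.
move=> s1 t0; case: pf => <- _ _ _ _.
by have := branch_rho_le s1 (lexx 0) t0; rewrite mulr0.
Qed.

Lemma z_lt t u : t < u -> z t < z u.
Proof.
move=> tu; have [c _ e] := @mean_value R z (fun t => K t / (1 + t ^+ 2)) t u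
  (ltW tu) (fun x _ => (let: And5 _ _ _ _ d := pf in d) x).
rewrite -subr_gt0 e mulr_gt0 ?subr_gt0// divr_gt0//; exact: sqrD1_gt0.
Qed.

Lemma rho_ge t : r <= rho t.
Proof.
have [t0|t0] := leP 0 t; first by have := branch_rho_ge (expr1n _ 2) t0; rewrite mul1r.
have := @branch_rho_ge (-1) (- t); rewrite mulrNN mul1r sqrrN expr1n; apply=> //.
by rewrite oppr_ge0 ltW.
Qed.

(** The quotient [rho^2 / (1 + t^2)] does not increase for [t >= 0], because [K <= rho]. As the
    sheets have slope [s / t] over the horosphere, this is the source of their slope bound [O(r)]
    away from the axis. *)
Lemma branch_rho_upper s t : s ^+ 2 = 1 -> 0 <= t ->
  rho (s * t) ^+ 2 <= r ^+ 2 * (1 + t ^+ 2).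
Proof.
move=> s1 t0.
pose f x := rho (s * x) ^+ 2 / (1 + x ^+ 2).
have nz x : 1 + x ^+ 2 != 0 by rewrite gt_eqF// sqrD1_gt0.
have fD x : is_derive x 1 f (2 * x * rho (s * x) *
    (K (s * x) - rho (s * x)) / (1 + x ^+ 2) ^+ 2).
  have D := branch_rho_derive x s1.
  apply: is_derive_eq; rewrite -![_ *: _]/(_ * _) /= /f; field; exact: nz.
have [c /andP[c0 _] e] := mean_value t0 (fun x _ => fD x).
have : f t <= f 0.
  rewrite -subr_le0 e subr0; apply: mulr_le0_ge0 => //.
  rewrite pmulr_lle0 ?invr_gt0 ?exprn_gt0 ?sqrD1_gt0//.
  apply: mulr_ge0_le0; first by rewrite !mulr_ge0// ltW.
  have [_ _] := profile_speed_le m2 (rho_gt0 (s * c)) (z_gt0 (s * c)).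
  rewrite -/(K _) mulrCA divff ?mulr1 ?subr_le0//; exact: lt0r_neq0.
case: pf => rr _ _ _ _.
rewrite /f mulr0 expr0n/= addr0 divr1 rr ler_pdivrMr//; exact: sqrD1_gt0.
Qed.

(** [ln z] is compared with [c * t / (1 + a * t)], which increases from 0 and stays below
    [c / a]. *)
Lemma branch_z_bound s a c : s ^+ 2 = 1 -> 0 < a -> 0 <= c ->
  (forall t, 0 <= t -> K (s * t) / (1 + t ^+ 2) <= z (s * t) * (c / (1 + a * t) ^+ 2)) ->
  forall t, 0 <= t -> h * expR (- (c / a)) <= z (s * t) <= h * expR (c / a).
Proof.
move=> s1 a0 c0 Kc t t0.
have z0h : z 0 = h by case: pf.
have at0 x : 0 <= x -> 0 < 1 + a * x.
  by move=> x0; have := mulr_ge0 (ltW a0) x0; lra.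
have : `|ln (z (s * t)) - ln (z (s * 0))| <= c / a.
  have := @increment_norm_le R (fun t => ln (z (s * t))) (fun t => c * t / (1 + a * t))
    (fun t => (z (s * t))^-1 * (s * K (s * t) / (1 + t ^+ 2)))
    (fun t => c / (1 + a * t) ^+ 2) 0 t t0.
  rewrite [c * 0]mulr0 mul0r subr0 => H; apply: le_trans (H _ _ _) _.
  - move=> x _.
    exact: (is_derive1_comp (is_derive1_ln (z_gt0 (s * x))) (branch_z_derive x s1)).
  - move=> x /andP[x0 _]; have ne : 1 + a * x != 0 by rewrite gt_eqF ?at0.
    apply: is_derive_eq; rewrite -![_ *: _]/(_ * _) /=; field; exact: ne.
  - move=> x /andP[x0 _]; rewrite normrM normfV (gtr0_norm (z_gt0 _)) ler_pdivrMl//.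
    rewrite -[s * K _ / _]mulrA normrM.
    have -> : `|s| = 1.
      by apply/eqP; rewrite -(eqrXn2 (n:=2))// ?expr1n -?normrX ?s1 ?normr1.
    rewrite mul1r gtr0_norm; first exact: Kc.
    by apply: divr_gt0; [exact: K_gt0|exact: sqrD1_gt0].
  rewrite ler_pdivrMr ?at0// mulrAC ler_pdivlMr// mulrDr mulr1.
  by rewrite -subr_ge0 (_ : _ - _ = c); [|ring].
rewrite mulr0 z0h ler_distl => /andP[l1 l2].
have hE e : h * expR e = expR (ln h + e) by rewrite expRD lnK ?posrE.
rewrite !hE -[z (s * t)](lnK (z_gt0 _)) !ler_expR; lra.
Qed.

Lemma branch_z_bound1 s t : s ^+ 2 = 1 -> 0 <= t ->
  h * expR (-1) <= z (s * t) <= h * expR 1.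
Proof.
move=> s1 t0.
have := @branch_z_bound s 1 1 s1 ltr01 ler01 _ t t0; rewrite divr1; apply.
move=> x x0; rewrite !mul1r.
have [Kz _ _] := profile_speed_le m2 (rho_gt0 (s * x)) (z_gt0 (s * x)).
rewrite ler_pdivrMr ?sqrD1_gt0// -mulrA; apply: le_trans Kz _.
rewrite ler_pM2l// mulrC ler_pdivlMr ?exprn_gt0//; last by lra.
by have := sqr_ge0 (x - 1); lra.
Qed.

(** A bootstrap: in [K <= z^2 / (2 * rho)], one factor [z] is bounded by [h * e] from the previous
    lemma, and [rho] from below by [r]. *)
Lemma branch_z_bound_wide s t : s ^+ 2 = 1 -> 0 <= t ->
  h * expR (- (h * expR 1 / r)) <= z (s * t) <= h * expR (h * expR 1 / r).
Proof.
move=> s1 t0; set c := h * expR 1 / r.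
have c0 : 0 <= c by rewrite divr_ge0 ?mulr_ge0 ?expR_ge0// ltW.
have := @branch_z_bound s 1 c s1 ltr01 c0 _ t t0; rewrite divr1; apply.
move=> x x0; rewrite mul1r.
have [_ Kz _] := profile_speed_le m2 (rho_gt0 (s * x)) (z_gt0 (s * x)).
rewrite ler_pdivrMr ?sqrD1_gt0// -mulrA; apply: le_trans Kz _.
rewrite ler_pM2l//; apply: (@le_trans _ _ (c / 2)).
  rewrite /c invfM mulrA (mulrAC _ (2^-1)) ler_pM2r//.
  have /andP[_ zu] := branch_z_bound1 s1 x0.
  apply: ler_pM => //; [exact: ltW|by rewrite invr_ge0 ltW|].
  by rewrite lef_pV2 ?posrE//; exact: branch_rho_ge.
rewrite -[leRHS]mulrA ler_wpM2l// mulrC ler_pdivlMr ?exprn_gt0//; last by lra.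
by have := sqr_ge0 (x - 1); lra.
Qed.

(** Up to slope [1 / a] the bound [K <= rho] is used, which gives [K / (z * (1 + t^2)) <= X] with
    [X = e * r / h]; beyond it [K <= z / 2] is used, with an integral of order [a]. The choice
    [a = sqrt X] balances [X / a] against [a]. *)
Lemma branch_z_bound_narrow s t : s ^+ 2 = 1 -> 0 <= t ->
  h * expR (- (4 * Num.sqrt (expR 1 / h * r))) <= z (s * t)
    <= h * expR (4 * Num.sqrt (expR 1 / h * r)).
Proof.
move=> s1 t0; set X := expR 1 / h * r; set a := Num.sqrt X.
have X0 : 0 < X by rewrite mulr_gt0// divr_gt0 ?expR_gt0.
have a0 : 0 < a by rewrite sqrtr_gt0.
have aX : a ^+ 2 = X by rewrite sqr_sqrtr// ltW.
have aX4 : 4 * X / a = 4 * a by rewrite -aX; field; rewrite gt_eqF.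
have := @branch_z_bound s a (4 * X) s1 a0 _ _ t t0; rewrite aX4; apply.
  by rewrite mulr_ge0// ltW.
move=> x x0; set p := rho (s * x); set y := z (s * x).
have [Kz1 _ Kz2] := profile_speed_le m2 (rho_gt0 (s * x)) (z_gt0 (s * x)).
have ax0 : 0 <= a * x by rewrite mulr_ge0// ltW.
have ax1 : 0 < (1 + a * x) ^+ 2 by rewrite exprn_gt0//; lra.
rewrite ler_pdivrMr ?sqrD1_gt0// -[leRHS]mulrA.
have y0 : 0 < y by exact: z_gt0.
have [xs|xb] := leP (a * x) 1.
  apply: le_trans Kz2 _; rewrite -/p -/y ler_pM2l//.
  apply: (@le_trans _ _ (X * (1 + x ^+ 2))); last first.
    rewrite (mulrAC (4 * X)) ler_pdivlMr// -[4 * X * _]mulrA (mulrCA 4) -mulrA.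
    rewrite ler_pM2l// mulrC ler_pM2r ?sqrD1_gt0//.
    have : (1 + a * x) ^+ 2 <= 2 ^+ 2 by rewrite lerXn2r ?nnegrE//; lra.
    lra.
  have /andP[yl _] := branch_z_bound1 s1 x0.
  have pu := branch_rho_upper s1 x0.
  have px : p <= r * (1 + x ^+ 2).
    rewrite -(@ler_pXn2r _ 2)// ?nnegrE; [|exact/ltW/rho_gt0|].
      apply: le_trans pu _; rewrite exprMn ler_wpM2l ?sqr_ge0//.
      by have := sqr_ge0 x; have := sqr_ge0 (x ^+ 2); lra.
    by rewrite mulr_ge0// ltW// sqrD1_gt0.
  rewrite ler_pdivrMr// mulrAC; apply: le_trans px _.
  rewrite ler_wpM2r//; first exact/ltW/sqrD1_gt0.
  rewrite /X mulrAC ler_peMl//; first exact: ltW.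
  rewrite mulrAC ler_pdivlMr// mul1r mulrC -ler_pdivrMr ?expR_gt0//.
  by rewrite -expRN.
apply: le_trans Kz1 _; rewrite -/y ler_pM2l//.
rewrite (mulrAC (4 * X)) ler_pdivlMr//.
have : (1 + a * x) ^+ 2 <= (2 * (a * x)) ^+ 2 by rewrite lerXn2r ?nnegrE//; lra.
rewrite !exprMn aX; have := mulr_ge0 (ltW X0) (sqr_ge0 x); lra.
Qed.

(** Since [rho >= r] and [z >= h / e], the product [rho * K] is at least a constant [c > 0]. Hence
    [rho^2] grows at least like [c * ln (1 + t^2)]. *)
Lemma branch_rho_unbounded s b : s ^+ 2 = 1 -> exists2 t, 0 < t & b < rho (s * t).
Proof.
have m1 : 0 < m - 1 by rewrite subr_gt0 (lt_le_trans _ m2)// ltr1n.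
have mp : 0 < m by rewrite (lt_le_trans _ m2).
move=> s1; pose k := h * expR (-1).
have k0 : 0 < k by rewrite mulr_gt0 ?expR_gt0.
pose c := ((m - 1) / r ^+ 2 + m / k ^+ 2)^-1.
have c0 : 0 < c.
  by rewrite invr_gt0 addr_gt0// divr_gt0// exprn_gt0.
(* Chosen so that [c * ln (1 + t^2) >= c * (C + 1) > b^2]. *)
pose C := b ^+ 2 / c; pose t := expR (C + 1).
have tp : 0 < t by exact: expR_gt0.
exists t => //.
have := @increment_le R (fun t => c * ln (1 + t ^+ 2)) (fun t => rho (s * t) ^+ 2)
  (fun x => c * (2 * x / (1 + x ^+ 2)))
  (fun x => 2 * rho (s * x) * (x * K (s * x) / (1 + x ^+ 2))) 0 t (ltW tp).
rewrite expr0n/= addr0 ln1 !mulr0 subr0 => H.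
have b2 : b ^+ 2 < rho (s * t) ^+ 2.
  have {}H : c * ln (1 + t ^+ 2) <= rho (s * t) ^+ 2 - rho 0 ^+ 2.
    apply: H.
    - by move=> x _; apply: is_deriveZ; exact: is_derive1_ln_sqrD1.
    - move=> x _; have Dx := branch_rho_derive x s1.
      by apply: is_derive_eq; rewrite -![_ *: _]/(_ * _) /=; ring.
    - move=> x /andP[x0 _].
      have px := rho_gt0 (s * x); have zx := z_gt0 (s * x).
      rewrite [leRHS](_ : _ = rho (s * x) * K (s * x) * (2 * x / (1 + x ^+ 2))); last by ring.
      apply: ler_wpM2r; first by rewrite divr_ge0 ?mulr_ge0// ltW// sqrD1_gt0.
      have -> : rho (s * x) * K (s * x) = ((m - 1) / rho (s * x) ^+ 2 + m / z (s * x) ^+ 2)^-1.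
        rewrite /K /profile_speed; field.
        have : 0 < (m - 1) * z (s * x) ^+ 2 + m * rho (s * x) ^+ 2.
          by have := exprn_gt0 2 px; have := exprn_gt0 2 zx; nra.
        by move=> D; rewrite !gt_eqF.
      have pr : r <= rho (s * x) by exact: branch_rho_ge.
      have /andP[zk _] := branch_z_bound1 s1 x0.
      rewrite /c lef_pV2 ?posrE ?addr_gt0 ?divr_gt0 ?exprn_gt0//.
      by apply: lerD; rewrite ler_pM2l// lef_pV2 ?posrE ?exprn_gt0// lerXn2r ?nnegrE// ltW.
  have : C + 1 <= ln (1 + t ^+ 2).
    rewrite -[C + 1]expRK ler_ln ?posrE ?expR_gt0 ?sqrD1_gt0// -/t.
    by have := sqr_ge0 (t - 2^-1); lra.
  rewrite -(ler_pM2l c0) mulrDr mulrC divfK ?gt_eqF//.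
  have := sqr_ge0 (rho 0); lra.
have := rho_gt0 (s * t); have [b0|b0] := leP 0 b; last by lra.
by move=> p0; rewrite -(@ltr_pXn2r _ 2)// nnegrE ltW.
Qed.

Lemma z_bound1 t : h * expR (-1) <= z t <= h * expR 1.
Proof.
have [t0|t0] := leP 0 t; first by have := branch_z_bound1 (expr1n _ 2) t0; rewrite mul1r.
have := @branch_z_bound1 (-1) (- t); rewrite mulrNN mul1r sqrrN expr1n; apply=> //.
by rewrite oppr_ge0 ltW.
Qed.

End ProfileProperties.

(** * Smooth functions *)

Section SmoothFunctions.
Variable R : realType.
Implicit Types (I : set R) (f g df : R -> R) (k : nat) (x y t : R).

(** The derivative is a witness, constrained on [I] only, so that a differential equation can supply
    it directly in a bootstrap. *)
Fixpoint Ck1 k I f : Prop :=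
  if k is k'.+1 then
    exists2 df, (forall x, I x -> is_derive x 1 f (df x)) & Ck1 k' I df
  else forall x, I x -> {for x, continuous f}.

Lemma Ck1S k I f : Ck1 k.+1 I f -> Ck1 k I f.
Proof.
elim: k f => [|k IH] f [df fD].
  by move=> _ x Ix; exact: is_derive_continuous (fD x Ix).
by move=> /IH dfk; exists df.
Qed.

Lemma Ck1_cst k I (c : R) : Ck1 k I (fun=> c).
Proof.
elim: k c => [|k IH] c; first by move=> x _; exact: cst_continuous.
by exists (fun=> 0) => [x _|]; [exact: is_derive_cst|exact: IH].
Qed.

Lemma Ck1_id k I : Ck1 k I (fun x => x).
Proof.
case: k => [|k]; first by move=> x _; exact: cvg_id.
by exists (fun=> 1) => [x _|]; [exact: is_derive_id|exact: Ck1_cst].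
Qed.

Lemma Ck1D k I f g : Ck1 k I f -> Ck1 k I g -> Ck1 k I (fun x => f x + g x).
Proof.
elim: k f g => [|k IH] f g.
  by move=> fc gc x Ix; apply: cvgD; [exact: fc|exact: gc].
move=> [df fD dfk] [dg gD dgk]; exists (fun x => df x + dg x); last exact: IH.
by move=> x Ix; apply: is_deriveD; [exact: fD|exact: gD].
Qed.

Lemma Ck1M k I f g : Ck1 k I f -> Ck1 k I g -> Ck1 k I (fun x => f x * g x).
Proof.
elim: k f g => [|k IH] f g.
  by move=> fc gc x Ix; apply: cvgM; [exact: fc|exact: gc].
move=> fk gk; case: (fk) (gk) => [df fD dfk] [dg gD dgk].
exists (fun x => f x * dg x + g x * df x); last first.
  by apply: Ck1D; apply: IH => //; exact: Ck1S.
by move=> x Ix; apply: is_deriveM; [exact: fD|exact: gD].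
Qed.

Lemma Ck1N k I f : Ck1 k I f -> Ck1 k I (fun x => - f x).
Proof.
elim: k f => [|k IH] f; first by move=> fc x Ix; apply: cvgN; exact: fc.
move=> [df fD dfk]; exists (fun x => - df x); last exact: IH.
by move=> x Ix; apply: is_deriveN; exact: fD.
Qed.

Lemma Ck1X k I f (e : nat) : Ck1 k I f -> Ck1 k I (fun x => f x ^+ e).
Proof.
move=> fk; elim: e => [|e IH]; first exact: Ck1_cst.
rewrite (_ : (fun x => _) = (fun x => f x * f x ^+ e)); first exact: Ck1M.
by apply/funext => x; rewrite exprS.
Qed.

Lemma Ck1V k I f : (forall x, I x -> f x != 0) -> Ck1 k I f ->
  Ck1 k I (fun x => (f x)^-1).
Proof.
move=> f0; elim: k => [|k IH] fk.
  by move=> x Ix; apply: cvgV; [exact: f0|exact: fk].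
case: (fk) => df fD dfk.
exists (fun x => - ((f x)^-1 ^+ 2 * df x)).
  move=> x Ix; have := is_deriveV (f0 x Ix) (fD x Ix).
  by move=> /is_derive_eq; apply; rewrite -exprVn scaleNr.
by apply/Ck1N/Ck1M => //; apply/Ck1X/IH; exact: Ck1S.
Qed.

Lemma Ck1_sqrt k : Ck1 k [set x | 0 < x] (@Num.sqrt R).
Proof.
elim: k => [|k IH]; first by move=> x _; exact: sqrt_continuous.
exists (fun x => (2 * Num.sqrt x)^-1); first by move=> x; exact: is_derive1_sqrt.
apply: Ck1V; first by move=> x x0; rewrite mulf_neq0// sqrtr_eq0 -ltNge.
by apply: Ck1M => //; exact: Ck1_cst.
Qed.

(** Off the range of [g] nothing is asked of [tau]. The range is an interval by the intermediate
    value theorem, whence the last clause. *)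
Lemma increasing_inverse g : {homo g : x y / x < y} -> continuous g ->
  exists tau : R -> R, [/\ cancel g tau,
    (forall t, {for g t, continuous tau}),
    (forall t l, is_derive t 1 g l -> l != 0 -> is_derive (g t) 1 tau l^-1) &
    (forall a b y, g a <= y <= g b -> g (tau y) = y)].
Proof.
move=> gi gc.
have gm : {mono g : x y / x <= y} := le_mono gi.
have ginj : injective g := inc_inj gm.
have /choice[tau tauP] y : exists t, (exists u, g u = y) -> g t = y.
  by have [[u gu]|nu] := pselect (exists u, g u = y); [exists u|exists 0].
have gK : cancel g tau by move=> t; apply: ginj; apply: tauP; exists t.
exists tau; split => //.
- move=> t; have : \forall y \near g t, {for y, continuous tau}.
    by apply: near_can_continuous; [apply: filterE => x; exact: gK|apply: filterE => x; exact: gc].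
  exact: nbhs_singleton.
- move=> t l gD l0; apply: is_derive_inverse => //; apply: filterE => x.
    exact: gK.
  exact: gc.
- move=> a b y /andP[ay yb]; apply: tauP.
  have ab : a <= b by rewrite -gm (le_trans ay).
  have [||c _ e] := @IVT R g a b y ab; last by exists c.
    exact: continuous_subspaceT.
  by rewrite minEle maxEle gm ab ay.
Qed.

End SmoothFunctions.

(** * Functions of class [C^k] in several variables *)

Section CkOn.
Variable R : realType.
Implicit Types (k d : nat).

Lemma near_eq_differentiable (V W : normedModType R) (f g : V -> W) p :
  (\near p, f p = g p) -> differentiable f p -> differentiable g p.
Proof.
move=> fg df.
have [dfc /eqaddoP dfE] := (diff_locallyP p f).1 df.
have dgE : g \o shift p = cst (g p) + 'd f p +o_ 0 id.
  apply/eqaddoP => e e0; have := dfE e e0.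
  have fgp := nbhs_singleton fg.
  move: fg; rewrite (near_shift 0) /= => fg.
  apply: filterS2 fg => h; rewrite /= subr0 /cst /= fgp => fgh.
  by rewrite /GRing.add/= /GRing.opp/= /GRing.add/= fgh.
have dgf := diff_unique dfc dgE.
by apply/diff_locallyP; rewrite dgf.
Qed.

Lemma is_derive_comp_scalar (V : normedModType R) (f : R -> R) (u : V -> R) p v l :
  differentiable u p -> is_derive (u p) 1 f l ->
  is_derive p v (fun q => f (u q)) (l * 'D_v u p).
Proof.
move=> ud [fd fl]; have {}fd : differentiable f (u p) by exact/derivable1_diffP.
have cd := differentiable_comp ud fd.
split; first exact: (diff_derivable cd).
by rewrite (deriveE _ cd) (deriveE _ ud) diff_comp//= diff1E// derive1E fl mulrC.
Qed.

Lemma Ck_on_eq k d (W : normedModType R) (U : set 'rV[R]_d)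
    (f g : 'rV[R]_d -> W) : open U -> (forall p, U p -> f p = g p) ->
  Ck_on k U f -> Ck_on k U g.
Proof.
move=> oU; have nU p : U p -> (\near p, U p) by move=> Up; exact: open_nbhs_nbhs.
have nE f1 g1 p : (forall p, U p -> f1 p = g1 p) -> U p -> (\near p, f1 p = g1 p) :> Prop.
  by move=> fg /nU; apply: filterS => q /fg.
elim: k f g => [|k IH] f g fg /=.
  move=> fc p Up; have : g q @[q --> p] --> f p.
    exact: cvg_trans (near_eq_cvg (F := nbhs p) (nE _ _ _ p fg Up)) (fc p Up).
  by rewrite (fg p Up).
move=> [fd fk]; split.
  by move=> p Up; apply: near_eq_differentiable (nE _ _ _ p fg Up) _; exact: fd.
move=> v; apply: IH (fk v) => p Up.
by apply: near_eq_derive; exact: nE.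
Qed.

Lemma Ck_onS k d (W : normedModType R) (U : set 'rV[R]_d) (f : 'rV[R]_d -> W) :
  Ck_on k.+1 U f -> Ck_on k U f.
Proof.
elim: k f => [|k IH] f [fd fk]; last by split => // v; exact: IH.
by move=> p Up; apply: differentiable_continuous; exact: fd.
Qed.

Lemma Ck_on_cst k d (W : normedModType R) (U : set 'rV[R]_d) (c : W) :
  Ck_on k U (fun=> c).
Proof.
elim: k c => [|k IH] c; first by move=> p _; exact: cst_continuous.
split => [p _|v]; first exact: differentiable_cst.
have -> : 'D_v (fun=> c) = (fun=> 0) :> ('rV[R]_d -> W).
  by apply/funext => p; exact: derive_cst.
exact: IH.
Qed.

Lemma Ck_onD k d (W : normedModType R) (U : set 'rV[R]_d)
    (f g : 'rV[R]_d -> W) : open U ->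
  Ck_on k U f -> Ck_on k U g -> Ck_on k U (fun p => f p + g p).
Proof.
move=> oU; elim: k f g => [|k IH] f g.
  by move=> fc gc p Up; exact: (continuousD (fc p Up) (gc p Up)).
move=> [fd fk] [gd gk]; split.
  by move=> p Up; apply: differentiableD; [exact: fd|exact: gd].
move=> v; apply: Ck_on_eq (IH _ _ (fk v) (gk v)) => // p Up.
by rewrite deriveD//; apply: diff_derivable; [exact: fd|exact: gd].
Qed.

Lemma Ck_on_sum k d (W : normedModType R) (U : set 'rV[R]_d) (m : nat)
    (f : 'I_m -> 'rV[R]_d -> W) : open U ->
  (forall i, Ck_on k U (f i)) -> Ck_on k U (fun p => \sum_i f i p).
Proof.
move=> oU; elim: m f => [|m IH] f fk.
  rewrite (_ : (fun p => _) = fun=> 0); first exact: Ck_on_cst.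
  by apply/funext => p; rewrite big_ord0.
rewrite (_ : (fun p => _) = fun p => f ord0 p + \sum_(i < m) f (lift ord0 i) p).
  by apply: Ck_onD => //; exact: IH.
by apply/funext => p; rewrite big_ord_recl.
Qed.

Lemma Ck_onM k d (U : set 'rV[R]_d) (f g : 'rV[R]_d -> R) : open U ->
  Ck_on k U f -> Ck_on k U g -> Ck_on k U (fun p => f p * g p).
Proof.
move=> oU; elim: k f g => [|k IH] f g.
  by move=> fc gc p Up; exact: (continuousM (fc p Up) (gc p Up)).
move=> fk gk; case: (fk) (gk) => [fd fk'] [gd gk']; split.
  by move=> p Up; apply: differentiableM; [exact: fd|exact: gd].
move=> v; apply: (@Ck_on_eq _ _ _ _ (fun p => f p * 'D_v g p + g p * 'D_v f p)) => //.
  move=> p Up; rewrite deriveM//; apply: diff_derivable; [exact: fd|exact: gd].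
by apply: Ck_onD => //; apply: IH; [exact: Ck_onS|exact: gk'|exact: Ck_onS|exact: fk'].
Qed.

Lemma Ck_on_scalel k d (W : normedModType R) (U : set 'rV[R]_d)
    (f : 'rV[R]_d -> R) (w : W) : open U ->
  Ck_on k U f -> Ck_on k U (fun p => f p *: w).
Proof.
move=> oU; elim: k f => [|k IH] f.
  by move=> fc p Up; apply: (@continuousZr_tmp _ _ _ f w p); exact: (fc p Up).
move=> [fd fk]; split; first by move=> p Up; exact/differentiableZl/fd.
move=> v; apply: Ck_on_eq (IH _ (fk v)) => // p Up.
rewrite !deriveE ?diffZl//; [exact: fd|exact/differentiableZl/fd|exact: fd].
Qed.

Lemma Ck_on_coord k d (U : set 'rV[R]_d) i : Ck_on k U (fun p => p 0 i).
Proof.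
case: k => [|k]; first by move=> p _; exact: coord_continuous.
split; first by move=> p _; exact: differentiable_coord.
move=> v.
have -> : 'D_v (fun p : 'rV[R]_d => p 0 i) = (fun=> v 0 i) :> ('rV[R]_d -> R).
  apply/funext => p.
  have D : derivable (@id 'rV[R]_d) p v by exact: derivable_id.
  have := derive_mx D; rewrite derive_id.
  by move=> /(congr1 (fun M : 'rV_d => M 0 i)); rewrite mxE.
exact: Ck_on_cst.
Qed.

Lemma Ck_on_rV k d e (U : set 'rV[R]_d) (F : 'rV[R]_d -> 'rV[R]_e) : open U ->
  (forall i, Ck_on k U (fun p => F p 0 i)) -> Ck_on k U F.
Proof.
move=> oU Fk; apply: (@Ck_on_eq _ _ _ _ (fun p => \sum_i F p 0 i *: 'e_i)) => //.
  by move=> p _; rewrite -row_sum_delta.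
by apply: Ck_on_sum => // i; exact: Ck_on_scalel.
Qed.

Lemma Ck_on_comp k d (U : set 'rV[R]_d) (I : set R) (f : R -> R)
    (u : 'rV[R]_d -> R) : open U -> (forall p, U p -> I (u p)) ->
  Ck1 k I f -> Ck_on k U u -> Ck_on k U (fun p => f (u p)).
Proof.
move=> oU uI; elim: k f => [|k IH] f.
  by move=> fc uc p Up; apply: continuous_comp; [exact: (uc p Up)|exact: (fc _ (uI _ Up))].
move=> [df fD dfk] uk; case: (uk) => [ud uk'].
have fd p : U p -> differentiable f (u p).
  by move=> /uI /fD [fd _]; exact/derivable1_diffP.
split; first by move=> p Up; apply: differentiable_comp; [exact: ud|exact: fd].
move=> v; apply: (@Ck_on_eq _ _ _ _ (fun p => df (u p) * 'D_v u p)) => //.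
  by move=> p Up; have [_ ->] := is_derive_comp_scalar v (ud p Up) (fD _ (uI p Up)).
by apply: Ck_onM; [|apply: IH => //; exact: Ck_onS|exact: uk'].
Qed.

End CkOn.

(** * Inverting the generating curve *)

Section ProfileGraphs.
Variable R : realType.
Implicit Types (s t x y : R) (k : nat).

(* A graph [z = f rho] over the distance to the axis is a translator when
   [f'' = - f' * (1 + f'^2) * balance m rho f]. *)
Definition balance (m rho z : R) : R := (m - 1) / rho + m * rho / z ^+ 2.

Lemma balanceV (m rho z : R) : 2 <= m -> 0 < rho -> 0 < z ->
  (profile_speed m rho z)^-1 = balance m rho z.
Proof.
move=> m2 p0 z0; have z2 : 0 < z ^+ 2 by rewrite exprn_gt0.
have p2 : 0 < rho ^+ 2 by rewrite exprn_gt0.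
have D0 : 0 < (m - 1) * z ^+ 2 + m * rho ^+ 2 by nra.
by rewrite /profile_speed /balance; field; rewrite !gt_eqF.
Qed.

Lemma Ck1_balance k (m : R) (I : set R) (p z : R -> R) :
  (forall x, I x -> 0 < p x /\ 0 < z x) -> Ck1 k I p -> Ck1 k I z ->
  Ck1 k I (fun x => balance m (p x) (z x)).
Proof.
move=> pz pk zk; apply: Ck1D.
  apply: Ck1M; first exact: Ck1_cst.
  by apply: Ck1V => // x /pz[p0 _]; rewrite gt_eqF.
apply: Ck1M; first by apply: Ck1M => //; exact: Ck1_cst.
apply: Ck1V; last exact: Ck1X.
by move=> x /pz[_ z0]; rewrite expf_neq0// gt_eqF.
Qed.

Variables (m h r : R) (rho z : R -> R).
Hypotheses (m2 : 2 <= m) (h0 : 0 < h) (r0 : 0 < r).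
Hypothesis pf : profile m h r rho z.

Let rho_gt0 t : 0 < rho t. Proof. by case: pf => _ _ /(_ t) []. Qed.
Let z_gt0 t : 0 < z t. Proof. by case: pf => _ _ /(_ t) []. Qed.

Let rhoD t := (let: And5 _ _ _ d _ := pf in d) t.
Let zD t := (let: And5 _ _ _ _ d := pf in d) t.

(** Height as parameter: the slope [T] and the radius [rho \o T] are smooth functions of the height,
    across the neck as well. The ends [rm] and [rp] are the infimum and the supremum of [z], which
    is what the last clause records. *)
Lemma height_inverse : exists (rm rp : R) (T : R -> R),
  [/\ [/\ 0 < rm, forall t, rm < z t < rp & forall t, T (z t) = t],
      (forall y, rm < y < rp -> z (T y) = y),
      (forall y, rm < y < rp ->
         is_derive y 1 T ((1 + T y ^+ 2) * balance m (rho (T y)) y) /\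
         is_derive y 1 (rho \o T) (T y)),
      (forall k, Ck1 k [set y | rm < y < rp] T /\
                 Ck1 k [set y | rm < y < rp] (rho \o T)) &
      (forall e, 0 < e -> (exists t, z t < rm + e) /\ (exists t, rp - e < z t)) /\
      (forall a b, (forall t, a <= z t <= b) -> a <= rm /\ rp <= b)].
Proof.
pose A := [set z t | t in [set: R]].
have zlt := z_lt m2 pf.
have Anz : A !=set0 by exists (z 0), 0.
have zb := z_bound1 m2 h0 pf.
have supA : has_sup A.
  by split=> //; exists (h * expR 1) => _ [t _ <-]; have /andP[] := zb t.
have infA : has_inf A.
  by split=> //; exists (h * expR (-1)) => _ [t _ <-]; have /andP[] := zb t.
have zc : continuous z by move=> t; exact: (is_derive_continuous (zD t)).
have [T [zK Tc TD Ts]] := increasing_inverse zlt zc.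
(* Strict growth on the whole line keeps both bounds from being attained. *)
have lo t : inf A < z t.
  apply: (@le_lt_trans _ _ (z (t - 1))); last by apply: zlt; lra.
  by apply: ge_inf; [case: infA|exists (t - 1)].
have up t : z t < sup A.
  apply: (@lt_le_trans _ _ (z (t + 1))); first by apply: zlt; lra.
  by apply: ub_le_sup; [case: supA|exists (t + 1)].
have zT y : inf A < y < sup A -> z (T y) = y.
  move=> /andP[iy ys].
  have [_ [t _ <-] ty] := inf_lt Anz iy.
  have [_ [u _ <-] yu] := sup_gt Anz ys.
  by apply: (Ts t u); rewrite !ltW.
have T' y : inf A < y < sup A ->
    is_derive y 1 T ((1 + T y ^+ 2) * balance m (rho (T y)) y).
  move=> yA; have zTy := zT _ yA.
  have K0 := profile_speed_gt0 m2 (rho_gt0 (T y)) (z_gt0 (T y)).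
  have l0 : profile_speed m (rho (T y)) (z (T y)) / (1 + T y ^+ 2) != 0.
    by rewrite gt_eqF// divr_gt0// sqrD1_gt0.
  have := TD _ _ (zD (T y)) l0.
  by rewrite invfM invrK (balanceV m2 (rho_gt0 _) (z_gt0 _)) zTy mulrC.
have R' y : inf A < y < sup A -> is_derive y 1 (rho \o T) (T y).
  move=> yA; have := is_derive1_comp (rhoD (T y)) (T' y yA).
  move=> /is_derive_eq; apply.
  have zTy := zT _ yA; rewrite -[in X in balance _ _ X]zTy -balanceV//.
  have K0 := profile_speed_gt0 m2 (rho_gt0 (T y)) (z_gt0 (T y)).
  by field; rewrite !gt_eqF// sqrD1_gt0.
(* The derivatives of [T] and [rho \o T] are smooth expressions in these two functions and the
   height, so both gain derivatives together. *)
have smooth k : Ck1 k [set y | inf A < y < sup A] T /\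
                Ck1 k [set y | inf A < y < sup A] (rho \o T).
  elim: k => [|k [Tk Rk]].
    by split=> y yA; [exact: (is_derive_continuous (T' y yA))|
                      exact: (is_derive_continuous (R' y yA))].
  split; last by exists T.
  exists (fun y => (1 + T y ^+ 2) * balance m (rho (T y)) y) => //.
  apply: Ck1M; first by apply: Ck1D; [exact: Ck1_cst|exact: Ck1X].
  apply: (@Ck1_balance k m _ (rho \o T) (fun y => y)) => //; last exact: Ck1_id.
  by move=> y yA; split; [exact: rho_gt0|rewrite -(zT _ yA)].
exists (inf A), (sup A), T; split=> //.
- split=> //; last by move=> t; rewrite lo up.
  apply: (@lt_le_trans _ _ (h * expR (-1))); first by rewrite mulr_gt0 ?expR_gt0.
  by apply: lb_le_inf => // _ [t _ <-]; have /andP[] := zb t.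
- by move=> y yA; split; [exact: T'|exact: R'].
- split.
    move=> e e0; split.
      have [_ [t _ <-] te] : exists2 x, A x & x < inf A + e.
        by apply: inf_lt => //; rewrite ltrDl.
      by exists t.
    have [_ [t _ <-] te] : exists2 x, A x & sup A - e < x.
      by apply: sup_gt => //; rewrite gtrBl.
    by exists t.
  move=> a b ab; split.
    by apply: lb_le_inf => // _ [t _ <-]; have /andP[] := ab t.
  by apply: ge_sup => // _ [t _ <-]; have /andP[] := ab t.
Qed.

(** Distance to the axis as parameter, on one half of the curve: [tau] recovers the absolute slope
    from the distance. The derivative of [f] is the reciprocal of the slope, so smoothness holds
    only outside the neck radius. *)
Lemma radial_graph s : s ^+ 2 = 1 -> exists tau f : R -> R,
  [/\ [/\ forall x, 0 <= tau x, forall x, x <= r -> tau x = 0,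
          forall x, f x = z (s * tau x) & continuous f],
      (forall t, 0 <= t -> tau (rho (s * t)) = t),
      (forall x, r <= x -> rho (s * tau x) = x),
      (forall x, r < x -> [/\ 0 < tau x, is_derive x 1 f (s / tau x) &
         is_derive x 1 tau ((1 + tau x ^+ 2) / tau x * balance m x (f x))]) &
      (forall k, Ck1 k [set x | r < x] tau /\ Ck1 k [set x | r < x] f)].
Proof.
move=> s1.
(* Continuing the radius below [t = 0] by a line of slope 1 gives a strictly increasing function on
   all of the line, as [increasing_inverse] requires. *)
pose g t := rho (s * Num.max t 0) + Num.min t 0.
have rhoc : continuous (fun t => rho (s * t)).
  by move=> t; exact: (is_derive_continuous (branch_rho_derive pf t s1)).
have rho0 : rho (s * 0) = r by rewrite mulr0; case: pf.
have gpos t : 0 <= t -> g t = rho (s * t).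
  by move=> t0; rewrite /g max_l// min_r// addr0.
have gneg t : t <= 0 -> g t = r + t.
  by move=> t0; rewrite /g max_r// min_l// rho0.
have gi : {homo g : x y / x < y}.
  move=> x y xy; have [x0|x0] := leP 0 x.
    by rewrite !gpos// ?(le_trans x0 (ltW xy))//; exact: (branch_rho_lt m2 pf).
  rewrite (gneg x); last exact: ltW.
  have [y0|y0] := leP 0 y; last by rewrite gneg; [lra|exact: ltW].
  by rewrite gpos//; have := branch_rho_ge m2 pf s1 y0; lra.
have gc : continuous g.
  move=> t; apply: cvgD.
    apply: (@continuous_comp _ _ _ (fun t => Num.max t 0) (fun t => rho (s * t))); last exact: rhoc.
    by apply: continuous_max; [exact: cvg_id|exact: cst_continuous].
  by apply: continuous_min; [exact: cvg_id|exact: cst_continuous].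
have [tau0 [gK tc tD ts]] := increasing_inverse gi gc.
have gt0K x : r <= x -> g (tau0 x) = x.
  move=> rx; have [t tp xt] := branch_rho_unbounded m2 h0 r0 pf x s1.
  by apply: (ts 0 t); rewrite !gpos//; [rewrite rho0 rx ltW|exact: ltW].
have tau0_ge0 x : r <= x -> 0 <= tau0 x.
  move=> rx; rewrite leNgt; apply/negP => t0.
  by have := gt0K x rx; rewrite gneg; [lra|exact: ltW].
have tau0_cont x : r <= x -> {for x, continuous tau0}.
  by move=> rx; rewrite -(gt0K x rx); exact: tc.
(* Freezing the argument at [r] inside the ball makes [f] continuous everywhere, with the constant
   value [h] there. *)
pose tau x := tau0 (Num.max x r).
have rmax x : r <= Num.max x r by rewrite le_max lexx orbT.
have tauE x : r <= x -> tau x = tau0 x by move=> rx; rewrite /tau max_l.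
have tau_c : continuous tau.
  move=> x; apply: (@continuous_comp _ _ _ (fun x => Num.max x r) tau0); last exact: tau0_cont.
  by apply: continuous_max; [exact: cvg_id|exact: cst_continuous].
have tau_ge0 x : 0 <= tau x by exact: tau0_ge0.
have zc : continuous (fun t => z (s * t)).
  by move=> t; exact: (is_derive_continuous (branch_z_derive pf t s1)).
pose f x := z (s * tau x).
have fc : continuous f.
  by move=> x; apply: (@continuous_comp _ _ _ tau (fun t => z (s * t))); [exact: tau_c|exact: zc].
have rhotau x : r <= x -> rho (s * tau x) = x.
  by move=> rx; rewrite -gpos// tauE// gt0K.
have taurho t : 0 <= t -> tau (rho (s * t)) = t.
  move=> t0; rewrite tauE; last exact: (branch_rho_ge m2 pf).
  by rewrite -gpos// gK.
have taur : tau r = 0 by rewrite -[in LHS]rho0 taurho.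
have tau_gt0 x : r < x -> 0 < tau x.
  move=> rx; rewrite lt_neqAle tau_ge0 andbT eq_sym; apply/eqP => e.
  by have := rhotau x (ltW rx); rewrite e rho0; lra.
have tau' x : r < x ->
    is_derive x 1 tau ((1 + tau x ^+ 2) / tau x * balance m x (f x)).
  move=> rx; have tx := tau_gt0 x rx.
  have K0 := profile_speed_gt0 m2 (rho_gt0 (s * tau x)) (z_gt0 (s * tau x)).
  have gD : is_derive (tau x) 1 g (tau x *
      profile_speed m (rho (s * tau x)) (z (s * tau x)) / (1 + tau x ^+ 2)).
    apply: (near_eq_is_derive (f := fun t => rho (s * t))); last exact: branch_rho_derive.
    near=> t; rewrite gpos// ltW//.
    by near: t; exact: lt_nbhsr.
  have l0 : tau x * profile_speed m (rho (s * tau x)) (z (s * tau x)) / (1 + tau x ^+ 2) != 0.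
    by apply/lt0r_neq0/divr_gt0; [exact: mulr_gt0|exact: sqrD1_gt0].
  have := tD _ _ gD l0; rewrite gpos// rhotau; last exact: ltW.
  move=> D; apply: (near_eq_is_derive (f := tau0)).
    near=> y; rewrite tauE// ltW//.
    by near: y; exact: lt_nbhsr.
  move: D => /is_derive_eq; apply.
  rewrite -[in RHS](balanceV m2 (lt_trans r0 rx) (z_gt0 (s * tau x) : 0 < f x)).
  move: K0 l0; rewrite rhotau; last exact: ltW.
  rewrite -/(f x) => K0 l0; field.
  by rewrite !gt_eqF// sqrD1_gt0.
have f' x : r < x -> is_derive x 1 f (s / tau x).
  move=> rx; have tx := tau_gt0 x rx.
  have K0 := profile_speed_gt0 m2 (rho_gt0 (s * tau x)) (z_gt0 (s * tau x)).
  have := is_derive1_comp (branch_z_derive pf (tau x) s1) (tau' x rx).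
  move=> /is_derive_eq; apply.
  rewrite -[in LHS](balanceV m2 (lt_trans r0 rx) (z_gt0 (s * tau x) : 0 < f x)).
  move: K0; rewrite rhotau; last exact: ltW.
  rewrite -/(f x) => K0; field.
  by rewrite !gt_eqF// sqrD1_gt0.
exists tau, f; split=> //.
- split=> // x xr; by rewrite /tau max_r// -[X in tau0 X]/r -tauE.
- by move=> x rx; split; [exact: tau_gt0|exact: f'|exact: tau'].
- elim=> [|k [tk fk]].
    by split=> x rx; [exact: tau_c|exact: fc].
  have tV : Ck1 k [set x | r < x] (fun x => (tau x)^-1).
    by apply: Ck1V => // x rx; rewrite gt_eqF// tau_gt0.
  split.
    exists (fun x => (1 + tau x ^+ 2) / tau x * balance m x (f x)) => //.
    apply: Ck1M; first apply: Ck1M => //.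
      by apply: Ck1D; [exact: Ck1_cst|exact: Ck1X].
    apply: (@Ck1_balance k m _ (fun x => x) f) => //; last exact: Ck1_id.
    by move=> x rx; split; [exact: lt_trans r0 rx|exact: z_gt0].
  exists (fun x => s / tau x) => //.
  by apply: Ck1M => //; exact: Ck1_cst.
Unshelve. all: by end_near. Qed.

End ProfileGraphs.

(** * Hypersurfaces of revolution *)

Section EuclideanNorm.
Variable R : realType.

Section Fixed.
Variable d : nat.
Implicit Types (v w x y : 'rV[R]_d) (a : R).

Definition edot v w : R := \sum_i v 0 i * w 0 i.

Lemma enorm_ge0 x : 0 <= enorm x.
Proof. exact: sqrtr_ge0. Qed.

Lemma sqr_enorm x : enorm x ^+ 2 = \sum_i x 0 i ^+ 2.
Proof. by rewrite sqr_sqrtr// sumr_ge0// => i _; exact: sqr_ge0. Qed.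

Lemma enorm_sqr v : enorm v ^+ 2 = edot v v.
Proof. by rewrite sqr_enorm; apply: eq_bigr => i _; rewrite expr2. Qed.

Lemma edot_ge0 v : 0 <= edot v v.
Proof. by rewrite -enorm_sqr sqr_ge0. Qed.

Lemma edotC v w : edot v w = edot w v.
Proof. by apply: eq_bigr => i _; rewrite mulrC. Qed.

Lemma edotDl v w x : edot (v + w) x = edot v x + edot w x.
Proof. by rewrite -big_split; apply: eq_bigr => i _; rewrite mxE mulrDl. Qed.

Lemma edotZl a v x : edot (a *: v) x = a * edot v x.
Proof. by rewrite mulr_sumr; apply: eq_bigr => i _; rewrite mxE mulrA. Qed.

Lemma edotNl v x : edot (- v) x = - edot v x.
Proof. by rewrite -scaleN1r edotZl mulN1r. Qed.

Lemma edotDr v w x : edot x (v + w) = edot x v + edot x w.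
Proof. by rewrite edotC edotDl !(edotC x). Qed.

Lemma edotZr a v x : edot x (a *: v) = a * edot x v.
Proof. by rewrite edotC edotZl edotC. Qed.

Lemma edotNr v x : edot x (- v) = - edot x v.
Proof. by rewrite edotC edotNl edotC. Qed.

Lemma enorm_eq0 v : enorm v = 0 -> v = 0.
Proof.
move=> v0; have /eqP : \sum_i v 0 i ^+ 2 = 0 by rewrite -sqr_enorm v0 expr0n.
rewrite psumr_eq0; last by move=> i _; exact: sqr_ge0.
move=> /allP H; apply/rowP => i; rewrite mxE; apply/eqP.
by rewrite -sqrf_eq0; have := H i; rewrite mem_index_enum; apply.
Qed.

Lemma edot_CS v w : edot v w ^+ 2 <= edot v v * edot w w.
Proof.
have [w0|w0] := eqVneq (edot w w) 0.
  have -> : w = 0.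
    by apply: enorm_eq0; apply/eqP; rewrite -sqrf_eq0 enorm_sqr w0.
  have -> : edot v 0 = 0 by rewrite /edot big1// => i _; rewrite mxE mulr0.
  by rewrite expr0n mulr_ge0// edot_ge0.
have wp : 0 < edot w w by rewrite lt_neqAle eq_sym w0 edot_ge0.
have := edot_ge0 (edot w w *: v - edot v w *: w).
rewrite !(edotDl, edotDr, edotNl, edotNr, edotZl, edotZr) (edotC w v).
rewrite [X in 0 <= X](_ : _ = edot w w * (edot v v * edot w w - edot v w ^+ 2)); last by ring.
by rewrite pmulr_rge0// subr_ge0.
Qed.

Lemma edot_le v w : edot v w <= enorm v * enorm w.
Proof.
apply: le_trans (ler_norm _) _.
rewrite -(@ler_pXn2r _ 2)// ?nnegrE ?mulr_ge0 ?enorm_ge0//.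
by rewrite -normrX ger0_norm ?sqr_ge0// exprMn !enorm_sqr edot_CS.
Qed.

Lemma enormD v w : enorm (v + w) <= enorm v + enorm w.
Proof.
rewrite -(@ler_pXn2r _ 2)// ?nnegrE ?addr_ge0 ?enorm_ge0//.
rewrite enorm_sqr edotDl !edotDr sqrrD !enorm_sqr (edotC w v).
have := edot_le v w; lra.
Qed.

Lemma enormZ a v : enorm (a *: v) = `|a| * enorm v.
Proof.
apply/eqP; rewrite -(@eqrXn2 _ 2)// ?mulr_ge0 ?enorm_ge0//.
by rewrite exprMn !enorm_sqr edotZl edotZr mulrA -expr2 real_normK ?num_real.
Qed.

Lemma enormN v : enorm (- v) = enorm v.
Proof. by rewrite -scaleN1r enormZ normrN1 mul1r. Qed.

Lemma enorm_dist v w : `|enorm v - enorm w| <= enorm (v - w).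
Proof.
rewrite ler_norml; have := enormD (v - w) w; rewrite subrK.
have := enormD (w - v) v; rewrite subrK -(enormN (w - v)) opprB; lra.
Qed.

Lemma enorm_gt0 v : v != 0 -> 0 < enorm v.
Proof.
move=> v0; rewrite lt_neqAle enorm_ge0 andbT eq_sym.
by apply: contra v0 => /eqP/enorm_eq0 ->.
Qed.

Lemma enorm0 : enorm (0 : 'rV[R]_d) = 0.
Proof.
by apply/eqP; rewrite -sqrf_eq0 sqr_enorm big1// => i _; rewrite mxE expr0n.
Qed.

End Fixed.
End EuclideanNorm.

(** * The metric and the Levi-Civita connection of the half-space *)

Section HalfSpaceGeometry.
Variables (R : realType) (n : nat).
Notation pt := 'rV[R]_(n + 1).
Implicit Types (p v w : pt) (X : pt -> pt).

Definition vertical : 'I_(n + 1) := rshift n ord0.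

Lemma big_base_height (F : 'I_(n + 1) -> R) :
  \sum_i F i = \sum_(i < n) F (lshift 1 i) + F vertical.
Proof. by rewrite big_split_ord big_ord1. Qed.

Lemma is_derive_coord (V : normedModType R) (d : nat) (c : V -> 'rV[R]_d)
    (t v : V) (w : 'rV[R]_d) i :
  is_derive t v c w -> is_derive t v (fun t => c t 0 i) (w 0 i).
Proof.
move=> [cD <-]; split; first exact: (derivable_mxP c t v).1.
by rewrite derive_mx// mxE.
Qed.

Lemma is_derive_rV (V : normedModType R) (d : nat) (c : V -> 'rV[R]_d)
    (t v : V) (w : 'rV[R]_d) :
  (forall i, is_derive t v (fun t => c t 0 i) (w 0 i)) -> is_derive t v c w.
Proof.
move=> cD; have D : derivable c t v.
  by apply/derivable_mxP => i j; rewrite ord1; case: (cD j).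
split=> //; rewrite derive_mx//; apply/rowP => i; rewrite mxE.
by case: (cD i).
Qed.

Lemma is_derive_proj (d : nat) (p v : 'rV[R]_d) i :
  is_derive p v (fun q => q 0 i) (v 0 i).
Proof. exact: (is_derive_coord i (is_derive_id p v)). Qed.

Lemma differentiable_height p : differentiable (@height R n) p.
Proof. exact: differentiable_coord. Qed.

Lemma is_derive_comp_height (f : R -> R) df p v :
  is_derive (height p) 1 f df ->
  is_derive p v (fun q => f (height q)) (df * height v).
Proof.
move=> fD.
have := is_derive_comp_scalar v (differentiable_height p) fD.
by have [_ ->] := is_derive_proj p v vertical.
Qed.

Lemma hyp_innerE p v w : hyp_inner p v w = edot v w / height p ^+ 2.
Proof.
rewrite /hyp_inner /hyp_metric mul_mx_scalar -scalemxAl mxE mulrC; congr (_ * _).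
by rewrite mxE; apply: eq_bigr => i _; rewrite mxE.
Qed.

Lemma partial_hyp_metric p (i j l : 'I_(n + 1)) : 0 < height p ->
  partial l (fun q => hyp_metric q i j) p =
    - 2 / height p ^+ 3 * (l == vertical)%:R * (i == j)%:R.
Proof.
move=> p0; rewrite /partial.
have -> : (fun q : pt => hyp_metric q i j) = (fun q : pt => (height q ^+ 2)^-1 * (i == j)%:R).
  by apply/funext => q; rewrite /hyp_metric mxE mulr_natr.
have D : is_derive (height p) 1 (fun y : R => (y ^+ 2)^-1 * (i == j)%:R)
    (- 2 / height p ^+ 3 * (i == j)%:R).
  have h0 : height p ^+ 2 != 0 by rewrite expf_neq0// gt_eqF.
  apply: is_derive_eq; rewrite -![_ *: _]/(_ * _) /=.
  by field; rewrite gt_eqF.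
have [_ ->] := is_derive_comp_height (basis_vec R l) D.
have -> : height (basis_vec R l) = (l == vertical)%:R.
  by rewrite /height /basis_vec mxE eqxx eq_sym.
by rewrite mulrAC.
Qed.

Lemma christoffelE p (k i j : 'I_(n + 1)) : 0 < height p ->
  christoffel (@hyp_metric R n) p k i j =
    - (height p)^-1 * ((i == vertical)%:R * (j == k)%:R
        + (j == vertical)%:R * (i == k)%:R - (k == vertical)%:R * (i == j)%:R).
Proof.
move=> p0; rewrite /christoffel (bigD1 k)//= big1 ?addr0; last first.
  by move=> l lk; rewrite invmx_scalar mxE eq_sym (negbTE lk) mulr0n mul0r.
rewrite !partial_hyp_metric// invmx_scalar mxE eqxx mulr1n.
by field; rewrite gt_eqF.
Qed.

Lemma hyp_nablaE X p v : 0 < height p ->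
  hyp_nabla X p v = 'D_v X p - (height p)^-1 *:
    (height v *: X p + height (X p) *: v - edot v (X p) *: delta_mx 0 vertical).
Proof.
move=> p0; rewrite /hyp_nabla; congr (_ + _); apply/rowP => k; rewrite !mxE.
under eq_bigr => i _ do under eq_bigr => j _ do rewrite christoffelE//.
transitivity (- (height p)^-1 *
   (\sum_i \sum_j (i == vertical)%:R * (j == k)%:R * (v 0 i * X p 0 j)
  + \sum_i \sum_j (j == vertical)%:R * (i == k)%:R * (v 0 i * X p 0 j)
  - \sum_i \sum_j (k == vertical)%:R * (i == j)%:R * (v 0 i * X p 0 j))).
  rewrite -!big_split -sumrN -big_split mulr_sumr; apply: eq_bigr => i _ /=.
  rewrite -big_split -sumrN -big_split mulr_sumr; apply: eq_bigr => j _ /=; ring.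
have pick2 (a b : 'I_(n + 1)) (F : 'I_(n + 1) -> 'I_(n + 1) -> R) :
    \sum_i \sum_j (i == a)%:R * (j == b)%:R * F i j = F a b.
  rewrite (bigD1 a)//= [X in _ + X]big1 ?addr0.
    rewrite (bigD1 b)//= big1 ?addr0 ?eqxx ?mul1r// => j jb.
    by rewrite (negbTE jb) mulr0 mul0r.
  by move=> i ia; rewrite big1// => j _; rewrite (negbTE ia) !mul0r.
rewrite pick2 exchange_big pick2.
have -> : \sum_i \sum_j (k == vertical)%:R * (i == j)%:R * (v 0 i * X p 0 j) =
    (k == vertical)%:R * edot v (X p).
  rewrite /edot mulr_sumr; apply: eq_bigr => i _.
  rewrite (bigD1 i)//= big1 ?addr0 ?eqxx ?mulr1// => j ji.
  by rewrite [i == j]eq_sym (negbTE ji) mulr0 mul0r.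
by rewrite /height -/vertical eqxx/=; ring.
Qed.

End HalfSpaceGeometry.

(** * Embeddedness and tangent vectors of a hypersurface of revolution *)

Section Revolution.
Variables (R : realType) (n : nat).
Notation pt := 'rV[R]_(n + 1).
Implicit Types (p v w : pt) (x y t : R) (k : nat).

Lemma baseE p i : base p 0 i = p 0 (lshift 1 i).
Proof. by rewrite mxE. Qed.

Lemma heightE p : height p = p 0 (vertical n).
Proof. by []. Qed.

Lemma base_row_mx (x : 'rV[R]_n) (y : R) : base (row_mx x (\row_(j < 1) y)) = x.
Proof. exact: row_mxKl. Qed.

Lemma height_row_mx (x : 'rV[R]_n) (y : R) : height (row_mx x (\row_(j < 1) y)) = y.
Proof. by rewrite heightE row_mxEr mxE. Qed.

Lemma row_mx_base p : row_mx (base p) (rsubmx p) = p.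
Proof. exact: hsubmxK. Qed.

Variables (rm rp : R) (Rad T : R -> R).
Let I : set R := [set y | rm < y < rp].

Hypothesis rm_gt0 : 0 < rm.
Hypothesis Rad_gt0 : forall y, 0 < Rad y.
Hypothesis RadD : forall y, rm < y < rp -> is_derive y 1 Rad (T y).
Hypothesis Radsmooth : forall k, Ck1 k I Rad.

(** Giving the radius as a function of the height makes the neck an ordinary point of this level
    set. *)
Definition revolution : set pt :=
  [set p | rm < height p < rp /\ enorm (base p) = Rad (height p)].

Definition slab : set pt := [set p | rm < height p < rp].

Lemma open_slab : open slab.
Proof.
have -> : slab = (@height R n) @^-1` I by [].
apply: open_comp; first by move=> p _; exact: coord_continuous.
rewrite (_ : I = `]rm, rp[%classic); first exact: itv_open.
by apply/seteqP; split=> y /=; rewrite in_itv.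
Qed.

Let y_gt0 y : rm < y < rp -> 0 < y.
Proof. by move=> /andP[+ _]; exact: lt_trans. Qed.

Lemma revolution_sqr p : rm < height p < rp ->
  revolution p <-> \sum_i base p 0 i ^+ 2 = Rad (height p) ^+ 2.
Proof.
move=> pI; rewrite -sqr_enorm; split; first by move=> [_ ->].
move=> /eqP e; split => //; apply/eqP; move: e.
by rewrite eqrXn2// ?enorm_ge0// ltW.
Qed.

Lemma Ck_on_height k (f : R -> R) : Ck1 k I f -> Ck_on k slab (fun p => f (height p)).
Proof.
move=> fk; apply: (Ck_on_comp (I := I)) => //; first exact: open_slab.
exact: Ck_on_coord.
Qed.

Lemma revolution_embedded : embedded_hypersurface revolution.
Proof.
split; first by move=> p [/y_gt0].
move=> p Sp; have os := open_slab.
pose F p := \sum_(i < n) p 0 (lshift 1 i) * p 0 (lshift 1 i) + - Rad (height p) ^+ 2.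
have FE q : slab q -> revolution q <-> F q = 0.
  move=> qs; rewrite revolution_sqr//.
  under eq_bigr => i _ do rewrite baseE expr2.
  by rewrite /F; split=> [->|/eqP]; [rewrite subrr|rewrite subr_eq0 => /eqP].
exists slab, F; split => //.
- by case: Sp.
- move=> k; apply: Ck_onD => //.
    apply: Ck_on_sum => // i; apply: Ck_onM => //; exact: Ck_on_coord.
  by apply: (@Ck_on_height k (fun y => - Rad y ^+ 2)); apply/Ck1N/Ck1X.
(* In the horizontal radial direction the derivative of [F] is [2 * Rad^2], which is positive. *)
- move=> q qs Sq; pose v : pt := row_mx (base q) 0; exists v.
  have hv : height v = 0 by rewrite heightE row_mxEr mxE.
  have D : is_derive q v F (\sum_(i < n) (q 0 (lshift 1 i) * v 0 (lshift 1 i) +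
      q 0 (lshift 1 i) * v 0 (lshift 1 i)) + - (2 * Rad (height q) * T (height q)) * height v).
    apply: is_deriveD.
      rewrite -fct_sumE; apply: is_derive_sum => i.
      by apply: is_deriveM; exact: is_derive_proj.
    apply: (@is_derive_comp_height _ _ (fun y => - Rad y ^+ 2)).
    have RD := RadD qs.
    by apply: is_derive_eq; rewrite -![_ *: _]/(_ * _) /=; ring.
  have [_ ->] := D; rewrite hv mulr0 addr0.
  have -> : \sum_(i < n) (q 0 (lshift 1 i) * v 0 (lshift 1 i) +
      q 0 (lshift 1 i) * v 0 (lshift 1 i)) = 2 * \sum_(i < n) base q 0 i ^+ 2.
    rewrite mulr_sumr; apply: eq_bigr => i _; rewrite row_mxEl baseE; ring.
  rewrite (revolution_sqr qs).1// mulf_neq0// expf_neq0// gt_eqF//.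
Qed.

Definition radial_dot v w : R := \sum_(i < n) v 0 (lshift 1 i) * w 0 (lshift 1 i).

Lemma edot_base_height v w : edot v w = radial_dot v w + height v * height w.
Proof. exact: big_base_height. Qed.

Lemma radial_dot_self p : revolution p -> radial_dot p p = Rad (height p) ^+ 2.
Proof.
move=> Sp; rewrite -(revolution_sqr Sp.1).1//.
by apply: eq_bigr => i _; rewrite baseE expr2.
Qed.

Lemma revolution_tangent_inv p v : revolution p -> tangent revolution p v ->
  radial_dot p v = Rad (height p) * T (height p) * height v.
Proof.
move=> Sp [c [c0 cS cD]].
pose G t := radial_dot (c t) (c t) + - Rad (height (c t)) ^+ 2.
have cDi i := is_derive_coord i cD.
have D : is_derive (0 : R) 1 G (\sum_(i < n) (p 0 (lshift 1 i) * v 0 (lshift 1 i) +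
      p 0 (lshift 1 i) * v 0 (lshift 1 i)) + - (2 * Rad (height p) * T (height p)) * height v).
  apply: is_deriveD.
    rewrite /radial_dot -fct_sumE; apply: is_derive_sum => i.
    by rewrite -[in X in X * _]c0; apply: is_deriveM; exact: cDi.
  have RD : is_derive (height (c 0)) 1 (fun y => - Rad y ^+ 2)
      (- (2 * Rad (height p) * T (height p))).
    rewrite c0; have RD := RadD Sp.1.
    by apply: is_derive_eq; rewrite -![_ *: _]/(_ * _) /=; ring.
  exact: (is_derive1_comp RD (cDi (vertical n))).
have G0 : \forall t \near (0 : R), cst 0 t = G t.
  apply: filterS cS => t ct; rewrite /G radial_dot_self// subrr//.
have [_] := near_eq_is_derive G0 (is_derive_cst (0 : R) (0 : R) (1 : R)).
have [_ ->] := D.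
under eq_bigr => i _ do rewrite -mulr2n.
rewrite sumrMnl -mulr_natl -/(radial_dot p v); lra.
Qed.

(** The line [p + t * v] leaves the hypersurface; rescaling its base by [phi t] puts the point at
    distance [Rad (b t)] from the axis again. The tangency condition says exactly that [phi] has
    derivative 0 at 0, so the corrected curve still has velocity [v]. *)
Lemma revolution_tangent p v : revolution p ->
  radial_dot p v = Rad (height p) * T (height p) * height v ->
  tangent revolution p v.
Proof.
move=> Sp pv; set y := height p in pv; set a := height v in pv.
pose b t := y + a * t.
have bD t : is_derive t 1 b a.
  by apply: is_derive_eq; rewrite -![_ *: _]/(_ * _) /=; ring.
have b0 : b 0 = y by rewrite /b mulr0 addr0.
pose Q t := Rad y ^+ 2 + 2 * t * radial_dot p v + t ^+ 2 * radial_dot v v.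
have QD : is_derive (0 : R) 1 Q (2 * radial_dot p v).
  by apply: is_derive_eq; rewrite -![_ *: _]/(_ * _) /=; ring.
have Q0 : Q 0 = Rad y ^+ 2 by rewrite /Q; ring.
have Ry := Rad_gt0 y.
have QE t : \sum_(i < n) (p 0 (lshift 1 i) + t * v 0 (lshift 1 i)) ^+ 2 = Q t.
  rewrite /Q -(radial_dot_self Sp) /radial_dot !mulr_sumr -!big_split/=.
  apply: eq_bigr => i _; ring.
pose phi t := Rad (b t) / Num.sqrt (Q t).
have sQ0 : Num.sqrt (Q 0) = Rad y by rewrite Q0 sqrtr_sqr gtr0_norm.
have phi0 : phi 0 = 1 by rewrite /phi b0 sQ0 divff// gt_eqF.
have phiD : is_derive (0 : R) 1 phi 0.
  have RD : is_derive (b 0) 1 Rad (T y) by rewrite b0; exact: (RadD Sp.1).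
  have D1 := is_derive1_comp RD (bD 0).
  have sD : is_derive (Q 0) 1 Num.sqrt (2 * Num.sqrt (Q 0))^-1.
    by apply: is_derive1_sqrt; rewrite Q0 exprn_gt0.
  have D2 := is_derive1_comp sD QD.
  have s0 : (Num.sqrt \o Q) 0 != 0 by rewrite /= sQ0 gt_eqF.
  have D3 := is_deriveV s0 D2.
  apply: (is_derive_eq (is_deriveM D1 D3)).
  rewrite -![_ *: _]/(_ * _) /= sQ0 b0 pv; field.
  by rewrite gt_eqF.
pose c t : pt := row_mx (phi t *: base (p + t *: v)) (\row_(j < 1) b t).
have cl t i : c t 0 (lshift 1 i) = phi t * (p 0 (lshift 1 i) + t * v 0 (lshift 1 i)).
  by rewrite row_mxEl !mxE.
have ch t : c t 0 (vertical n) = b t by rewrite row_mxEr mxE.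
exists c; split.
- apply/rowP => i; case: (splitP i) => j ij.
    rewrite (_ : i = lshift 1 j); last exact: val_inj.
    by rewrite cl phi0 mul0r addr0 mul1r.
  rewrite (_ : i = vertical n); last by apply: val_inj; rewrite /= ij ord1.
  by rewrite ch b0.
- have bI : \forall t \near (0 : R), rm < b t < rp.
    have bc : {for (0 : R), continuous b} := is_derive_continuous (bD 0).
    have /andP[l u] := Sp.1.
    have bc' : b t @[t --> (0 : R)] --> y by rewrite -b0; exact: bc.
    near=> t; apply/andP; split; near: t.
      exact: (cvgr_gt _ bc').
    exact: (cvgr_lt _ bc').
  have QI : \forall t \near (0 : R), 0 < Q t.
    have Qc : Q t @[t --> (0 : R)] --> Rad y ^+ 2.
      by rewrite -Q0; exact: (is_derive_continuous QD).
    by apply: (cvgr_gt _ Qc); rewrite exprn_gt0.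
  near=> t.
  have bt : rm < b t < rp by near: t.
  have hc : height (c t) = b t by exact: ch.
  apply/revolution_sqr; rewrite ?hc//.
  under eq_bigr => i _ do rewrite baseE cl exprMn.
  rewrite -mulr_sumr QE /phi expr_div_n sqr_sqrtr; last by apply: ltW; near: t.
  by rewrite divfK// gt_eqF//; near: t.
- apply: is_derive_rV => i; case: (splitP i) => j ij.
    rewrite (_ : i = lshift 1 j); last exact: val_inj.
    rewrite (_ : (fun t => _) = (fun t => phi t * (p 0 (lshift 1 j) + t * v 0 (lshift 1 j)))).
      apply: is_derive_eq; rewrite -![_ *: _]/(_ * _) /= phi0; ring.
    by apply/funext => t; rewrite cl.
  rewrite (_ : i = vertical n); last by apply: val_inj; rewrite /= ij ord1.
  rewrite (_ : (fun t => _) = b); first exact: bD.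
  by apply/funext => t; rewrite ch.
Unshelve. all: by end_near. Qed.

End Revolution.

Lemma orthogonal_basis (F : fieldType) (n : nat) (x : 'rV[F]_n.+1) : x != 0 ->
  exists2 B : 'M[F]_(n, n.+1), row_free B & B *m x^T = 0.
Proof.
move=> x0; set A := kermx x^T.
have rA : \rank A = n.
  by rewrite mxrank_ker mxrank_tr rank_rV x0 subn1.
have [B [Bf BA]] : exists B : 'M[F]_(\rank A, n.+1), row_free B /\ B *m x^T = 0.
  exists (row_base A); split; first exact: row_base_free.
  by apply/sub_kermxP; rewrite eq_row_base.
by move: B Bf BA; rewrite rA => B Bf BA; exists B.
Qed.

Lemma row_free_col_mx1 (F : fieldType) (n k : nat) (x : 'rV[F]_n) (B : 'M[F]_(k, n)) :
  row_free B -> row_free (col_mx (row_mx x (const_mx 1)) (row_mx B 0) : 'M[F]_(1 + k, n + 1)).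
Proof.
move=> Bfree; apply: inj_row_free => u.
rewrite -[u](@hsubmxK _ 1 1 k) mul_row_col mul_mx_row mul_mx_row mulmx0 add_row_mx addr0.
move=> uE; have u1 : lsubmx u = 0 :> 'M[F]_1.
  have := congr1 rsubmx uE; rewrite row_mxKr => /rowP/(_ 0).
  rewrite !mxE big_ord1 !mxE mulr1 => e.
  by apply/rowP => j; rewrite ord1 !mxE.
have := congr1 lsubmx uE; rewrite row_mxKl u1 mul0mx add0r => uB.
have -> : rsubmx u = 0 by apply: (row_free_inj Bfree); rewrite mul0mx uB linear0.
exact: row_mx0.
Qed.

(** * Unit normal, shape operator and mean curvature *)

Section RevolutionTranslator.
Variables (R : realType) (n' : nat).
Let n := n'.+1.
Notation pt := 'rV[R]_(n + 1).
Implicit Types (p v w : pt) (x y t : R) (k : nat).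

Variables (rm rp : R) (Rad T : R -> R).
Let I : set R := [set y | rm < y < rp].
Let m : R := n%:R.

Hypothesis rm_gt0 : 0 < rm.
Hypothesis Rad_gt0 : forall y, 0 < Rad y.
Hypothesis RadD : forall y, rm < y < rp -> is_derive y 1 Rad (T y).
Hypothesis TD : forall y, rm < y < rp ->
  is_derive y 1 T ((1 + T y ^+ 2) * balance m (Rad y) y).
Hypothesis Tsmooth : forall k, Ck1 k I T.
Hypothesis Radsmooth : forall k, Ck1 k I Rad.

Let S : set pt := revolution rm rp Rad.

(** [al] is the factor of the base in the normal and [be] its vertical component. Subtracting
    [al * y] in [ga] lets the normal be written with the whole position vector [p], which keeps its
    derivative short. *)
Let W y := (Num.sqrt (1 + T y ^+ 2))^-1.
Let al y := y * W y / Rad y.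
Let be y := - (y * T y * W y).
Let ga y := be y - al y * y.

(* On the hypersurface [Rad (height p)] is the distance to the axis, so this is
   [height p] times the outward Euclidean unit normal [(x / |x|, - T) * W]. *)
Definition revolution_normal p : pt :=
  al (height p) *: p + ga (height p) *: delta_mx 0 (vertical n).

Let N := revolution_normal.

Let y_gt0 y : rm < y < rp -> 0 < y.
Proof. by move=> /andP[+ _]; exact: lt_trans. Qed.

Let WW y : W y ^+ 2 * (1 + T y ^+ 2) = 1.
Proof.
rewrite exprVn sqr_sqrtr; last exact/ltW/sqrD1_gt0.
by rewrite mulVf// gt_eqF// sqrD1_gt0.
Qed.

Let b y := balance m (Rad y) y.

Let W' y : rm < y < rp -> is_derive y 1 W (- (T y * b y * W y)).
Proof.
move=> yI; have D := TD yI.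
have QD : is_derive y 1 (fun y => 1 + T y ^+ 2) (2 * T y * ((1 + T y ^+ 2) * b y)).
  by apply: is_derive_eq; rewrite -![_ *: _]/(_ * _) /= /b; ring.
have q0 := sqrD1_gt0 (T y).
have sD := @is_derive1_comp R Num.sqrt (fun y => 1 + T y ^+ 2) y _ _
  (is_derive1_sqrt q0) QD.
have s0 : Num.sqrt (1 + T y ^+ 2) != 0 by rewrite gt_eqF// sqrtr_gt0.
apply: (is_derive_eq (is_deriveV (f := Num.sqrt \o (fun y => 1 + T y ^+ 2)) s0 sD)).
rewrite -![_ *: _]/(_ * _) /= /W.
have sq : Num.sqrt (1 + T y ^+ 2) ^+ 2 = 1 + T y ^+ 2 by rewrite sqr_sqrtr// ltW.
rewrite -[X in _ * (_ * (X * _))]sq; move: (Num.sqrt _) s0 => s s0.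
by field.
Qed.

Let be' y : rm < y < rp -> is_derive y 1 be (- (T y * W y + y * b y * W y)).
Proof.
move=> yI; have D1 := TD yI; have D2 := W' yI.
apply: is_derive_eq; rewrite -![_ *: _]/(_ * _) /= -/(b y); ring.
Qed.

Let al' y : rm < y < rp -> is_derive y 1 al
  (W y / Rad y * (1 - y * T y * b y - y * T y / Rad y)).
Proof.
move=> yI; have D1 := RadD yI; have D2 := W' yI.
have R0 : Rad y != 0 by rewrite gt_eqF.
apply: is_derive_eq; rewrite -![_ *: _]/(_ * _) /=; field.
exact: R0.
Qed.

Let ga' y : rm < y < rp -> is_derive y 1 ga
  (- (T y * W y + y * b y * W y) -
   (al y + y * (W y / Rad y * (1 - y * T y * b y - y * T y / Rad y)))).
Proof.
move=> yI; have D1 := be' yI; have D2 := al' yI.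
apply: is_derive_eq; rewrite -![_ *: _]/(_ * _) /=; ring.
Qed.

Let W_smooth k : Ck1 k I W.
Proof.
elim: k => [|k IH].
  by move=> y yI; exact: (is_derive_continuous (W' yI)).
exists (fun y => - (T y * b y * W y)); first exact: W'.
apply/Ck1N/Ck1M => //; apply: Ck1M => //.
apply: (@Ck1_balance _ k m I Rad (fun y => y)) => //; last exact: Ck1_id.
by move=> y /y_gt0.
Qed.

Let al_smooth k : Ck1 k I al.
Proof.
apply: Ck1M; first by apply: Ck1M => //; exact: Ck1_id.
by apply: Ck1V => // y _; rewrite gt_eqF.
Qed.

Let ga_smooth k : Ck1 k I ga.
Proof.
apply: Ck1D.
  by apply/Ck1N/Ck1M => //; apply: Ck1M => //; exact: Ck1_id.
by apply/Ck1N/Ck1M => //; exact: Ck1_id.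
Qed.

Let N_coord p i : N p 0 i = al (height p) * p 0 i + ga (height p) * (i == vertical n)%:R.
Proof. by rewrite /N /revolution_normal !mxE eqxx. Qed.

Let N_height p : height (N p) = be (height p).
Proof. rewrite heightE N_coord eqxx mulr1 -heightE /ga; ring. Qed.

Let N_base p (i : 'I_n) : N p 0 (lshift 1 i) = al (height p) * p 0 (lshift 1 i).
Proof. by rewrite N_coord eq_lrshift mulr0 addr0. Qed.

Let radial_dot_N p v : radial_dot v (N p) = al (height p) * radial_dot p v.
Proof.
rewrite /radial_dot mulr_sumr; apply: eq_bigr => i _; rewrite N_base; ring.
Qed.

Lemma revolution_unit_normal : unit_normal S N.
Proof.
split.
- exists (slab rm rp); split; [exact: open_slab|by move=> p []|].
  move=> k; have os := @open_slab R n rm rp.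
  apply: Ck_on_rV => // i.
  rewrite (_ : (fun p => _) = (fun p => al (height p) * p 0 i +
      ga (height p) * (i == vertical n)%:R)); last by apply/funext => p; exact: N_coord.
  apply: Ck_onD => //; apply: Ck_onM => //.
  + by apply: Ck_on_height; exact: al_smooth.
  + exact: Ck_on_coord.
  + by apply: Ck_on_height; exact: ga_smooth.
  + exact: Ck_on_cst.
- move=> p Sp; have y0 := y_gt0 Sp.1; have R0 := Rad_gt0 (height p).
  rewrite hyp_innerE edot_base_height radial_dot_N N_height.
  have -> : radial_dot p (N p) = al (height p) * radial_dot p p := radial_dot_N p p.
  rewrite (radial_dot_self Rad_gt0 Sp) /al /be.
  rewrite -[RHS](WW (height p)); field.
  by rewrite !gt_eqF.
- move=> p v Sp /(revolution_tangent_inv Rad_gt0 RadD Sp) pv.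
  rewrite hyp_innerE edot_base_height radial_dot_N N_height pv /al /be.
  have R0 := Rad_gt0 (height p); have y0 := y_gt0 Sp.1.
  by field; rewrite !gt_eqF.
Qed.

(** Stated before diagonalisation. For horizontal [v] only a multiple of [v] remains, which is the
    curvature of the parallels; for the meridian direction the multiple of [p] combines with it into
    the other eigenvalue. *)
Lemma revolution_shape p v : S p ->
  radial_dot p v = Rad (height p) * T (height p) * height v ->
  let y := height p in
  (forall i : 'I_n, shape_operator N p v 0 (lshift 1 i) =
    (be y / y - al y) * v 0 (lshift 1 i) -
    (W y / Rad y * (1 - y * T y * b y - y * T y / Rad y) - al y / y)
      * height v * p 0 (lshift 1 i)) /\
  height (shape_operator N p v) = (y * b y * W y - T y * W y) * height v.
Proof.
move=> Sp pv y; have yI := Sp.1; have y0 := y_gt0 yI; have R0 := Rad_gt0 y.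
pose da := W y / Rad y * (1 - y * T y * b y - y * T y / Rad y).
pose dg := - (T y * W y + y * b y * W y) - (al y + y * da).
pose dN i := al y * v 0 i + p 0 i * (da * height v) + dg * height v * (i == vertical n)%:R.
have ND i : is_derive p v (fun q => N q 0 i) (dN i).
  rewrite (_ : (fun q => _) = (fun q => al (height q) * q 0 i +
      ga (height q) * (i == vertical n)%:R)); last by apply/funext => q; exact: N_coord.
  have D1 := is_derive_comp_height v (al' yI).
  have D2 := is_derive_comp_height v (ga' yI).
  have D3 := is_derive_proj p v i.
  apply: is_derive_eq; rewrite -![_ *: _]/(_ * _) -/y /dN /dg /da; ring.
have Dv i : 'D_v N p 0 i = dN i.
  have ND' j : is_derive p v (fun q => N q 0 j) ((\row_k dN k) 0 j) by rewrite mxE.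
  by have [_ ->] := is_derive_rV ND'; rewrite mxE.
(* Tangency removes the third correction term of [hyp_nablaE]. *)
have dvN : edot v (N p) = 0.
  rewrite edot_base_height radial_dot_N N_height pv -/y /al /be; field.
  by rewrite gt_eqF.
have sE i : shape_operator N p v 0 i = - 'D_v N p 0 i + y^-1 * (height v * N p 0 i + be y * v 0 i).
  rewrite /shape_operator hyp_nablaE// dvN scale0r subr0 N_height -/y !mxE; ring.
split=> [i|].
  rewrite sE Dv /dN eq_lrshift mulr0 addr0 N_base -/y /da; field.
  by rewrite !gt_eqF.
rewrite heightE sE Dv /dN eqxx mulr1 -!heightE N_height -/y /dg /da /be; field.
by rewrite !gt_eqF.
Qed.

(** The eigenvectors are the meridian direction [vp] and [n - 1] horizontal vectors orthogonal to
    the base of [p]. Since [kp] contains [T'] through [balance], the translator equation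
    [kp + (n - 1) * kr = n * <p, N>] reduces to the equation satisfied by [T]. *)
Lemma revolution_mean_curvature p : S p ->
  has_mean_curvature S N p (hyp_inner p p (N p)).
Proof.
move=> Sp; set y := height p; have yI := Sp.1; have y0 := y_gt0 yI.
have R0 := Rad_gt0 y.
have x0 : base p != 0.
  apply/eqP => p0; have := radial_dot_self Rad_gt0 Sp.
  rewrite /radial_dot big1; first by move=> /esym/eqP; rewrite sqrf_eq0 gt_eqF.
  by move=> i _; rewrite -baseE p0 mxE mul0r.
have [B Bfree Bp] := orthogonal_basis x0.
pose kp := y * b y * W y - T y * W y.
pose kr := be y / y - al y.
pose vp : pt := row_mx ((T y / Rad y) *: base p) (const_mx 1).
pose Q : 'M[R]_(n', n + 1) := row_mx B 0.
exists (row_mx (kp%:M : 'M[R]_1) (const_mx kr : 'rV[R]_n')); last first.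
  have -> : \sum_(i < n) (row_mx (kp%:M : 'M[R]_1) (const_mx kr : 'rV[R]_n')) 0 i =
      kp + n'%:R * kr.
    transitivity (\sum_(i < 1 + n') (row_mx (kp%:M : 'M[R]_1) (const_mx kr : 'rV[R]_n')) 0 i).
      by [].
    rewrite big_split_ord big_ord1; congr (_ + _).
      by rewrite row_mxEl mxE eqxx mulr1n.
    under eq_bigr => i _ do rewrite row_mxEr mxE.
    by rewrite sumr_const card_ord mulr_natl.
  rewrite hyp_innerE edot_base_height.
  rewrite (radial_dot_N p p) N_height (radial_dot_self Rad_gt0 Sp) -/y.
  have mE : m = 1 + n'%:R by rewrite /m /n -natr1 addrC.
  have m0 : m != 0 by rewrite /m pnatr_eq0.
  have nE : n'%:R = m - 1 by rewrite mE; ring.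
  rewrite -/m nE /kp /kr /b /balance /al /be; field.
  by rewrite !gt_eqF// lt0r m0 ler0n.
exists (col_mx vp Q); split.
  exact: row_free_col_mx1.
move=> i.
case: (split_ordP (i : 'I_(1 + n'))) => j ->.
  rewrite ord1 [X in X *: _](_ : _ = kp); last first.
    have := row_mxEl (kp%:M : 'M[R]_1) (const_mx kr : 'rV[R]_n') 0 0.
    by rewrite [X in _ = X -> _]mxE eqxx mulr1n.
  have -> : row (lshift n' 0) (col_mx vp Q) = vp by rewrite rowKu row_id.
  have hvp : height vp = 1 by rewrite heightE row_mxEr mxE.
  have vpl (l : 'I_n) : vp 0 (lshift 1 l) = T y / Rad y * p 0 (lshift 1 l).
    by rewrite row_mxEl !mxE.
  have tv : radial_dot p vp = Rad y * T y * height vp.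
    rewrite hvp mulr1.
    have -> : radial_dot p vp = T y / Rad y * radial_dot p p.
      rewrite /radial_dot mulr_sumr; apply: eq_bigr => l _; rewrite vpl; ring.
    by rewrite (radial_dot_self Rad_gt0 Sp) -/y; field; rewrite gt_eqF.
  split; first exact: (revolution_tangent Rad_gt0 RadD Sp tv).
  have [sb sh] := revolution_shape Sp tv.
  apply/rowP => l; rewrite [RHS]mxE; case: (split_ordP l) => l' ->.
    rewrite sb hvp vpl -/y /kp /al /be; field.
    by rewrite !gt_eqF.
  by rewrite ord1 -!heightE sh -/y.
rewrite [X in X *: _](_ : _ = kr); last first.
  by have := row_mxEr (kp%:M : 'M[R]_1) (const_mx kr : 'rV[R]_n') 0 j; rewrite [X in _ = X -> _]mxE.
have -> : row (rshift 1 j) (col_mx vp Q) = row_mx (row j B) 0.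
  by rewrite rowKd row_row_mx row0.
set v := row_mx _ _ : pt.
have hv0 : height v = 0 by rewrite heightE row_mxEr mxE.
have tv : radial_dot p v = Rad y * T y * height v.
  rewrite hv0 mulr0; have := congr1 (fun M : 'cV_n' => M j 0) Bp.
  rewrite !mxE => <-; apply: eq_bigr => l _.
  by rewrite row_mxEl !mxE mulrC.
split; first exact: (revolution_tangent Rad_gt0 RadD Sp tv).
have [sb sh] := revolution_shape Sp tv.
apply/rowP => l; rewrite [RHS]mxE; case: (split_ordP l) => l' ->.
  by rewrite sb hv0 mulr0 mul0r subr0.
by rewrite ord1 -!heightE sh hv0 !mulr0.
Qed.

Lemma revolution_translator : translator S.
Proof.
split.
  exact: (@revolution_embedded R n rm rp Rad T rm_gt0 Rad_gt0 RadD Radsmooth).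
exists N; first exact: revolution_unit_normal.
exact: revolution_mean_curvature.
Qed.

End RevolutionTranslator.

(** * Isometries and noncongruence *)

Section ExpAcosh.
Variable R : realType.
Implicit Types w : R.

(* [e^d] as a function of [cosh d]. *)
Definition exp_acosh w : R := w + Num.sqrt (w ^+ 2 - 1).

Lemma exp_acosh_ge1 w : 1 <= w -> 1 <= exp_acosh w.
Proof. by move=> w1; rewrite /exp_acosh; have := sqrtr_ge0 (w ^+ 2 - 1); lra. Qed.

Lemma exp_acosh_inv w : 1 <= w -> exp_acosh w + (exp_acosh w)^-1 = 2 * w.
Proof.
move=> w1; have w2 : 0 <= w ^+ 2 - 1 by nra.
have e := sqr_sqrtr w2; have y1 := exp_acosh_ge1 w1.
have y0 : exp_acosh w != 0 by rewrite gt_eqF// (lt_le_trans ltr01).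
have -> : (exp_acosh w)^-1 = w - Num.sqrt (w ^+ 2 - 1).
  apply: (mulfI y0); rewrite divff// /exp_acosh mulrC -subr_sqr e; ring.
rewrite /exp_acosh; ring.
Qed.

Lemma exp_acosh_le w w' : 1 <= w -> 1 <= w' -> exp_acosh w <= exp_acosh w' -> w <= w'.
Proof.
move=> w1 w1' le; rewrite leNgt; apply/negP => lt.
have : Num.sqrt (w' ^+ 2 - 1) <= Num.sqrt (w ^+ 2 - 1).
  by rewrite ler_wsqrtr// lerD2r lerXn2r ?nnegrE//; lra.
by move: le; rewrite /exp_acosh; lra.
Qed.

End ExpAcosh.

Section Isometries.
Variables (R : realType) (n : nat).
Notation pt := 'rV[R]_(n + 1).
Notation H := (@upper_half_space R n).
Implicit Types (p q v w : pt) (s t : R).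

Lemma open_upper_half_space : open H.
Proof.
have -> : H = (@height R n) @^-1` [set y | 0 < y] by [].
by apply: open_comp; [move=> p _; exact: coord_continuous|exact: open_gt].
Qed.

(* [2 (cosh d - 1)] for the hyperbolic distance [d]. *)
Definition hdelta p q : R := enorm (p - q) ^+ 2 / (height p * height q).

Lemma hdeltaC p q : hdelta p q = hdelta q p.
Proof. by rewrite /hdelta -enormN opprB [height q * _]mulrC. Qed.

Lemma hyp_inner_self p v : hyp_inner p v v = enorm v ^+ 2 / height p ^+ 2.
Proof. by rewrite hyp_innerE enorm_sqr. Qed.

Lemma hdelta_ge0 p q : H p -> H q -> 0 <= hdelta p q.
Proof.
by move=> p0 q0; rewrite divr_ge0 ?sqr_ge0// mulr_ge0//; exact: ltW.
Qed.

(* [|d cosh d(P, .)| <= sinh d(P, .)], integrated along a curve whose speed at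
   time [s] is [1 / s]. *)
Lemma hdelta_curve (c dc : R -> pt) Y : 1 <= Y ->
  (forall s, 1 <= s <= Y -> [/\ H (c s), is_derive s 1 c (dc s) &
     hyp_inner (c s) (dc s) (dc s) = (s^-1) ^+ 2]) ->
  exp_acosh (1 + hdelta (c Y) (c 1) / 2) <= Y.
Proof.
move=> Y1 cP; set P := c 1.
have P0 : H P by case: (cP 1); rewrite ?lexx.
pose w s := 1 + enorm (c s - P) ^+ 2 / (2 * (height (c s) * height P)).
have w1 s : 1 <= s <= Y -> 1 <= w s.
  move=> sY; have [cs _ _] := cP s sY.
  by rewrite /w lerDl divr_ge0 ?sqr_ge0// mulr_ge0// mulr_ge0// ltW.
have wE s : w s = 1 + hdelta (c s) P / 2.
  by rewrite /w /hdelta invfM mulrCA mulrC -mulrA.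
pose dw s := edot (c s - P) (dc s) / (height (c s) * height P)
   - enorm (c s - P) ^+ 2 * height (dc s) / (2 * height (c s) ^+ 2 * height P).
have wD s : 1 <= s <= Y -> is_derive s 1 w (dw s).
  move=> sY; have [cs cD _] := cP s sY.
  have hD := is_derive_coord (vertical n) cD.
  have nD : is_derive s 1 (fun s => enorm (c s - P) ^+ 2) (2 * edot (c s - P) (dc s)).
    rewrite (_ : (fun s => _) = \sum_(i < n + 1) (fun s => (c s 0 i - P 0 i) ^+ 2)); last first.
      by apply/funext => u; rewrite fct_sumE sqr_enorm; apply: eq_bigr => i _; rewrite !mxE.
    rewrite /edot mulr_sumr; apply: is_derive_sum => i.
    have cDi := is_derive_coord i cD.
    by apply: is_derive_eq; rewrite -![_ *: _]/(_ * _) /= !mxE; ring.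
  have h0 : height (c s) != 0 by rewrite gt_eqF.
  have hP : height P != 0 by rewrite gt_eqF.
  pose g s := 2 * (height (c s) * height P).
  have h2 : g s != 0 by rewrite mulf_neq0 ?pnatr_eq0// mulf_neq0.
  have D : is_derive s 1 g (2 * (height (dc s) * height P)).
    by apply: is_derive_eq; rewrite -![_ *: _]/(_ * _) -?heightE /=; ring.
  have D2 := is_deriveM nD (is_deriveV h2 D).
  apply: (is_derive_eq (is_deriveD (is_derive_cst (1 : R) (s : R) (1 : R)) D2)).
  rewrite -![_ *: _]/(_ * _) /g /dw /=; field.
  by rewrite h0 hP.
(* Cauchy-Schwarz against the gradient of [w], regarded as a function of the point: the hyperbolic
   length of this gradient squared is [w^2 - 1]. *)
have dw_le s : 1 <= s <= Y -> dw s ^+ 2 <= (w s ^+ 2 - 1) * s^-1 ^+ 2.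
  move=> sY; have [cs _ <-] := cP s sY.
  set a := c s - P; set u := dc s; set k := height (c s); set z := height P.
  have k0 : 0 < k by []. have z0 : 0 < z by [].
  pose e : pt := delta_mx 0 (vertical n).
  have ue v : edot v e = height v.
    rewrite /edot (bigD1 (vertical n))//= big1 ?addr0 => [|i ii]; rewrite mxE eqxx/=.
      by rewrite eqxx mulr1.
    by rewrite (negbTE ii) mulr0.
  have ee : edot e e = 1 by rewrite ue heightE mxE !eqxx.
  have ah : height a = k - z by rewrite heightE !mxE.
  have -> : dw s = edot u ((k * z)^-1 *: a - (enorm a ^+ 2 / (2 * k ^+ 2 * z)) *: e).
    rewrite edotDr edotNr !edotZr ue /dw -/a -/u -/k -/z (edotC u); ring.
  apply: le_trans (edot_CS _ _) _.
  rewrite hyp_inner_self -/u -/k -enorm_sqr.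
  rewrite [leRHS]mulrC -[leRHS]mulrA; apply: ler_wpM2l; first exact: sqr_ge0.
  rewrite le_eqVlt; apply/orP; left; apply/eqP.
  rewrite /w -/a -/k -/z; clearbody a.
  rewrite !(edotDl, edotDr, edotNl, edotNr, edotZl, edotZr) ee (edotC e a) ue ah -!enorm_sqr; field.
  by rewrite !gt_eqF.
have key e : 0 < e -> exp_acosh (w Y) <= Y + e.
  (* The square root of [w^2 - 1] is not differentiable at the start, where [w = 1]; [eps]
     regularises it. It makes [y 1 = 1 + e / Y], so after multiplication by [Y] the total error is
     [e]. *)
  move=> e0; pose eps := (e / Y) ^+ 2.
  have Y0 : 0 < Y by lra.
  have ep : 0 < eps by rewrite exprn_gt0// divr_gt0.
  pose Q s := w s ^+ 2 - 1 + eps.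
  have Q0 s : 1 <= s <= Y -> 0 < Q s.
    by move=> /w1 ?; rewrite /Q ltr_wpDl// subr_ge0 -(expr1n _ 2) lerXn2r ?nnegrE//; lra.
  (* The regularised [e^d / s], which does not increase because [d] grows at most as fast as
     [ln s]. *)
  pose y s := (w s + Num.sqrt (Q s)) / s.
  pose dy s :=
    (dw s * (w s + Num.sqrt (Q s)) / Num.sqrt (Q s) * s - (w s + Num.sqrt (Q s))) / s ^+ 2.
  have yD s : 1 <= s <= Y -> is_derive s 1 y (dy s).
    move=> sY; have D := wD s sY.
    have QD : is_derive s 1 Q (2 * w s * dw s).
      by apply: is_derive_eq; rewrite -![_ *: _]/(_ * _) /=; ring.
    have sq0 : Num.sqrt (Q s) != 0 by rewrite gt_eqF// sqrtr_gt0 Q0.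
    have sD := @is_derive1_comp R Num.sqrt Q s _ _ (is_derive1_sqrt (Q0 s sY)) QD.
    have s0 : (s : R) != 0 by rewrite gt_eqF//; case/andP: sY; lra.
    have iD := is_deriveV (f := id) s0 (is_derive_id (s : R) (1 : R)).
    apply: (is_derive_eq (is_deriveM (is_deriveD D sD) iD)).
    rewrite -![_ *: _]/(_ * _) -[(w + _) s]/(w s + Num.sqrt (Q s)) /= /dy.
    move: (Num.sqrt (Q s)) sq0 => x x0.
    by field; rewrite x0 s0.
  have [c0 c0Y e1] := mean_value Y1 yD.
  have : y Y - y 1 <= 0.
    have [l u] := andP c0Y.
    rewrite e1; apply: mulr_le0_ge0; last by rewrite subr_ge0.
    have s0 : 0 < c0 by lra.
    rewrite /dy pmulr_lle0 ?invr_gt0 ?exprn_gt0// subr_le0.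
    have q0 : 0 < Num.sqrt (Q c0) by rewrite sqrtr_gt0 Q0.
    have wc := w1 c0 c0Y.
    rewrite mulrAC -mulrA mulrAC -[leRHS]mul1r ler_wpM2r; [by []|lra|].
    rewrite mulrA ler_pdivrMr// mul1r -ler_pdivlMr//.
    apply: le_trans (ler_norm _) _.
    have qc : 0 <= Num.sqrt (Q c0) / c0 by apply: divr_ge0; exact: ltW.
    rewrite -(@ler_pXn2r _ 2)// ?nnegrE//.
    rewrite -normrX ger0_norm ?sqr_ge0// expr_div_n sqr_sqrtr; last exact/ltW/Q0.
    apply: le_trans (dw_le c0 c0Y) _; rewrite exprVn ler_wpM2r ?invr_ge0 ?sqr_ge0//.
    by rewrite /Q lerDl ltW.
  have -> : y 1 = 1 + e / Y.
    rewrite /y divr1 /Q /w subrr enorm0 expr0n mul0r addr0 expr1n subrr add0r.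
    by rewrite sqrtr_sqr ger0_norm// divr_ge0// ltW.
  rewrite subr_le0 /y ler_pdivrMr// mulrDl mul1r divfK ?gt_eqF// => le.
  apply: le_trans le; rewrite /exp_acosh lerD2l ler_wsqrtr//.
  by rewrite /Q lerDl ltW.
by rewrite -wE; apply/ler_addgt0Pr.
Qed.

End Isometries.

Lemma is_derive1_inv (R : realType) (x : R) : x != 0 ->
  is_derive x 1 (fun y : R => y^-1) (- x ^- 2).
Proof.
move=> x0; have := is_deriveV (f := id) x0 (is_derive_id (x : R) (1 : R)).
by move=> /is_derive_eq; apply; rewrite -![_ *: _]/(_ * _) mulr1.
Qed.

Lemma derive_comp (R : numFieldType) (U V W : normedModType R) (f : U -> V)
    (g : V -> W) p v : differentiable f p -> differentiable g (f p) ->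
  'D_v (g \o f) p = 'D_('D_v f p) g (f p).
Proof.
move=> df dg; have dgf := differentiable_comp df dg.
by rewrite (deriveE _ dgf) (deriveE _ dg) (deriveE _ df) (diff_comp df dg).
Qed.

(** * Isometries preserve the hyperbolic distance *)

Section IsometryRigidity.
Variables (R : realType) (n : nat).
Notation pt := 'rV[R]_(n + 1).
Notation H := (@upper_half_space R n).
Implicit Types (p q v w : pt) (s t : R).

Lemma hdelta_eq0 p q : H p -> H q -> hdelta p q = 0 -> p = q.
Proof.
move=> p0 q0 /eqP; rewrite mulf_eq0 invr_eq0.
rewrite (gt_eqF (mulr_gt0 (p0 : 0 < height p) (q0 : 0 < height q))) orbF sqrf_eq0.
by move=> /eqP/enorm_eq0/eqP; rewrite subr_eq0 => /eqP.
Qed.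

(* The geodesic from [p] to [q] in the hyperboloid model is
   [sinh (L - t) / sinh L *: p + sinh t / sinh L *: q]; here [s = e^t] and
   [Y = e^L], and [1 / height] is one of the linear coordinates. *)
Lemma hyp_geodesic p q : H p -> H q -> p != q ->
  let Y := exp_acosh (1 + hdelta p q / 2) in
  1 <= Y /\ exists c dc : R -> pt, [/\ c 1 = p, c Y = q &
    forall s, 1 <= s <= Y -> [/\ H (c s), is_derive s 1 c (dc s) &
     hyp_inner (c s) (dc s) (dc s) = (s^-1) ^+ 2]].
Proof.
move=> p0 q0 pq Y; have d0 := hdelta_ge0 p0 q0.
have w1 : 1 <= 1 + hdelta p q / 2 by lra.
have Y1 := exp_acosh_ge1 w1.
have YE := exp_acosh_inv w1; rewrite -/Y in Y1 YE.
split=> //; move: Y Y1 YE => Y Y1 YE; have Yp : 0 < Y by lra.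
have Yn1 : 1 < Y.
  rewrite lt_neqAle Y1 andbT; apply/eqP => e.
  move: YE; rewrite -e invr1 => YE.
  by move/eqP: pq; apply; apply: hdelta_eq0 => //; lra.
set x := height p; set y := height q.
have x0 : 0 < x by []. have y0 : 0 < y by [].
have dE : enorm (p - q) ^+ 2 = x * y * (Y + Y^-1 - 2).
  by rewrite YE /hdelta -/x -/y; field; rewrite !gt_eqF.
pose D := Y - Y^-1.
have D0 : 0 < D by rewrite subr_gt0 (lt_trans _ Yn1)// invf_lt1.
(* [D] is [2 * sinh L], so [a] and [b] are the two hyperbolic coefficients, divided by the heights
   of [p] and [q]. The point then has height [l = 1 / (a + b)] and as base the average of the two
   bases with weights [a] and [b]. *)
pose a s := (Y / s - s / Y) / (D * x).
pose b s := (s - s^-1) / (D * y).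
pose a' s := (- Y / s ^+ 2 - Y^-1) / (D * x).
pose b' s := (1 + s ^- 2) / (D * y).
have nz s : 1 <= s <= Y -> s != 0 by move=> /andP[l _]; rewrite gt_eqF//; lra.
have sI s : 1 <= s <= Y -> 0 < a s + b s.
  move=> /andP[l u]; have s0 : 0 < s by lra.
  have sV : s^-1 <= s by rewrite (le_trans _ l)// invf_le1.
  have : 0 <= b s by rewrite divr_ge0 ?subr_ge0// mulr_ge0// ltW.
  have as0 : 0 <= a s.
    rewrite divr_ge0 ?mulr_ge0 ?(ltW D0) ?(ltW x0)// subr_ge0.
    apply: (@le_trans _ _ 1); first by rewrite ler_pdivrMr// mul1r.
    by rewrite ler_pdivlMr// mul1r.
  move=> bs0; rewrite lt_neqAle addr_ge0// andbT eq_sym paddr_eq0//.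
  apply/negP => /andP[a0].
  rewrite /b mulf_eq0 invr_eq0 mulf_eq0 (gt_eqF D0) (gt_eqF y0) !orbF.
  rewrite subr_eq0 => /eqP sE.
  have s1 : s = 1.
    by apply: le_anti; rewrite l andbT sE invf_le1.
  move: a0; rewrite /a s1 divr1 div1r mulf_eq0 invr_eq0 mulf_eq0.
  by rewrite !(gt_eqF D0) (gt_eqF x0).
have Dx : D * x != 0 by rewrite mulf_neq0// gt_eqF.
have Dy : D * y != 0 by rewrite mulf_neq0// gt_eqF.
have DE : D != 0 by rewrite gt_eqF.
have Y0 : Y != 0 by rewrite gt_eqF.
have aD s : s != 0 -> is_derive s 1 a (a' s).
  move=> s0; have iD := is_derive1_inv s0.
  by apply: is_derive_eq; rewrite -![_ *: _]/(_ * _) /= /a'; field; rewrite s0 ?Y0 ?DE !gt_eqF.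
have bD s : s != 0 -> is_derive s 1 b (b' s).
  move=> s0; have iD := is_derive1_inv s0.
  by apply: is_derive_eq; rewrite -![_ *: _]/(_ * _) /= /b'; field; rewrite s0 ?Y0 ?DE !gt_eqF.
pose l s := (a s + b s)^-1.
pose l' s := - (a' s + b' s) * l s ^+ 2.
have lD s : 1 <= s <= Y -> is_derive s 1 l (l' s).
  move=> sY; have A := aD _ (nz s sY); have B := bD _ (nz s sY).
  have ab0 : a s + b s != 0 by rewrite gt_eqF// sI.
  apply: (is_derive_eq (is_deriveV (f := fun s => a s + b s) ab0 (is_deriveD A B))).
  rewrite -![_ *: _]/(_ * _) /l' /l; field; exact: ab0.
pose e : pt := row_mx (base (q - p)) 0.
pose c s : pt := row_mx ((l s * b s) *: base (q - p) + base p) (\row_(j < 1) l s).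
(* The derivative of [l * b = b / (a + b)]. *)
pose k s := (a s * b' s - a' s * b s) * l s ^+ 2.
pose dc s : pt := row_mx (k s *: base (q - p)) (\row_(j < 1) l' s).
have hc s : height (c s) = l s by rewrite heightE row_mxEr mxE.
have hdc s : height (dc s) = l' s by rewrite heightE row_mxEr mxE.
have a1 : a 1 = x^-1.
  by rewrite /a divr1 div1r invfM mulrA divff ?mul1r.
have b1 : b 1 = 0 by rewrite /b invr1 subrr mul0r.
have aY : a Y = 0 by rewrite /a divff// subrr mul0r.
have bY : b Y = y^-1 by rewrite /b invfM mulrA divff ?mul1r.
exists c, dc; split.
- rewrite /c b1 mulr0 scale0r add0r /l a1 b1 addr0 invrK -[RHS]row_mx_base.
  congr (row_mx _ _); apply/rowP => j; rewrite !mxE ord1.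
  by rewrite /x heightE.
- rewrite /c /l aY bY add0r invrK divff ?gt_eqF// scale1r.
  rewrite -[RHS]row_mx_base; congr (row_mx _ _).
    by apply/rowP => j; rewrite !mxE subrK.
  by apply/rowP => j; rewrite !mxE ord1 /y heightE.
move=> s sY; have s0 := nz s sY; have ab := sI s sY.
have l0 : 0 < l s by rewrite invr_gt0.
have ab0 : a s + b s != 0 by rewrite gt_eqF.
split.
- by rewrite /upper_half_space/= hc.
- apply: is_derive_rV => i; case: (split_ordP i) => j ->.
    rewrite (_ : (fun t => _) = (fun t => l t * b t * base (q - p) 0 j + base p 0 j)); last first.
      by apply/funext => t; rewrite row_mxEl !mxE.
    have L := lD s sY; have B := bD s s0.
    apply: is_derive_eq; rewrite -![_ *: _]/(_ * _) /= row_mxEl [in RHS]mxE.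
    rewrite /k /l' /l; field; exact: ab0.
  rewrite (_ : (fun t => _) = l); last by apply/funext => t; rewrite row_mxEr mxE.
  by rewrite row_mxEr mxE; exact: lD.
- rewrite hyp_inner_self hc sqr_enorm big_base_height -heightE hdc.
  have -> : \sum_(i < n) dc s 0 (lshift 1 i) ^+ 2 =
      k s ^+ 2 * (x * y * (Y + Y^-1 - 2) - (x - y) ^+ 2).
    have -> : x * y * (Y + Y^-1 - 2) - (x - y) ^+ 2 = \sum_(i < n) (base (q - p) 0 i) ^+ 2.
      rewrite -dE sqr_enorm big_base_height -heightE.
      have -> : height (p - q) = x - y by rewrite heightE !mxE.
      by rewrite addrK; apply: eq_bigr => i _; rewrite !mxE; ring.
    by rewrite mulr_sumr; apply: eq_bigr => i _; rewrite row_mxEl mxE exprMn.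
  have -> : (k s ^+ 2 * (x * y * (Y + Y^-1 - 2) - (x - y) ^+ 2) + l' s ^+ 2) / l s ^+ 2 =
    l s ^+ 2 * ((a s * b' s - a' s * b s) ^+ 2 * (x * y * (Y + Y^-1 - 2) - (x - y) ^+ 2)
      + (a' s + b' s) ^+ 2).
    by rewrite /k /l'; move: (Y + Y^-1 - 2) => ?; field; rewrite gt_eqF.
  have -> : (a s * b' s - a' s * b s) ^+ 2 * (x * y * (Y + Y^-1 - 2) - (x - y) ^+ 2)
      + (a' s + b' s) ^+ 2 = ((a s + b s) / s) ^+ 2.
    rewrite /a /b /a' /b' /D; field.
    have YD : Y * Y - 1 != 0.
      rewrite (_ : Y * Y - 1 = Y * D); first by rewrite mulf_neq0.
      by rewrite /D; field.
    by rewrite ?s0 ?Y0 ?YD !gt_eqF.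
  by rewrite -exprMn mulrA /l mulVf// mul1r.
Qed.

Lemma isometry_derive_inner (Phi : pt -> pt) : hyp_isometry Phi ->
  forall p v, H p -> differentiable Phi p /\
   hyp_inner (Phi p) ('D_v Phi p) ('D_v Phi p) = hyp_inner p v v.
Proof.
move=> [Psi [Phis _ _ iso]] p v Hp; split; last exact: iso.
by have [] := Phis 1%N; move=> + _; apply.
Qed.

Lemma isometry_inverse (Phi : pt -> pt) : hyp_isometry Phi ->
  exists2 Psi, hyp_isometry Psi &
    forall p, H p -> [/\ H (Phi p), Psi (Phi p) = p, H (Psi p) & Phi (Psi p) = p].
Proof.
move=> [Psi [Phis Psis inv iso]]; exists Psi => //.
exists Phi; split; [exact: Psis|exact: Phis|by move=> p /inv[]|].
have dPhi p : H p -> differentiable Phi p by case: (Phis 1%N) => + _; apply.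
have dPsi p : H p -> differentiable Psi p by case: (Psis 1%N) => + _; apply.
move=> p v w Hp; have [_ _ HPsi PhiPsi] := inv p Hp.
(* This differentiates [Phi (Psi q) = q], which holds near [p] because the half-space is open. *)
have chain u : 'D_('D_u Psi p) Phi (Psi p) = u.
  have D : 'D_u (Phi \o Psi) p = u.
    rewrite -[RHS](@derive_id _ _ p u); apply: near_eq_derive.
    have : \near p, H p by apply: open_nbhs_nbhs; split=> //; exact: open_upper_half_space.
    by apply: filterS => q /inv[_ _ _ /= ->].
  by rewrite -[RHS]D (derive_comp u (dPsi p Hp) (dPhi _ HPsi)).
by rewrite -(iso (Psi p))// !chain PhiPsi.
Qed.

(** The image of the geodesic from [p] to [q] has the same speed, and [hdelta_curve] bounds the
    distance between the ends of any such curve. *)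
Lemma isometry_hdelta_le (Phi : pt -> pt) : hyp_isometry Phi ->
  (forall p, H p -> H (Phi p)) ->
  forall p q, H p -> H q -> hdelta (Phi p) (Phi q) <= hdelta p q.
Proof.
move=> iso PhiH p q Hp Hq.
have [->|pq] := eqVneq p q.
  by rewrite /hdelta !subrr !enorm0 expr0n !mul0r.
have [Y1 [c [dc [c1 cY cP]]]] := hyp_geodesic Hp Hq pq.
set Y := exp_acosh _ in Y1 cY cP.
have := @hdelta_curve R n (Phi \o c) (fun s => 'D_(dc s) Phi (c s)) Y Y1.
rewrite /= c1 cY hdeltaC => le.
have d1 := hdelta_ge0 Hp Hq; have d2 := hdelta_ge0 (PhiH p Hp) (PhiH q Hq).
have := @exp_acosh_le R (1 + hdelta (Phi p) (Phi q) / 2) (1 + hdelta p q / 2).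
suff /[swap]/[apply] : exp_acosh (1 + hdelta (Phi p) (Phi q) / 2) <= Y by lra.
apply: le => s sY; have [Hc cD cs] := cP s sY.
have [dPhi iPhi] := isometry_derive_inner iso (dc s) Hc.
split; [exact: PhiH| |by rewrite iPhi].
have dc' : differentiable c s by apply/derivable1_diffP; case: cD.
split; first exact: (diff_derivable (differentiable_comp dc' dPhi)).
by have [_ <-] := cD; rewrite (derive_comp (1 : R) dc' dPhi).
Qed.

Lemma isometry_hdelta (Phi : pt -> pt) : hyp_isometry Phi ->
  forall p q, H p -> H q -> hdelta (Phi p) (Phi q) = hdelta p q.
Proof.
move=> iso p q Hp Hq; have [Psi isoPsi inv] := isometry_inverse iso.
apply/eqP; rewrite eq_le; apply/andP; split.
  by apply: isometry_hdelta_le => // x /inv[].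
have [Pp e1 _ _] := inv p Hp; have [Pq e2 _ _] := inv q Hq.
rewrite -[in leLHS]e1 -[in leLHS]e2; apply: isometry_hdelta_le => // x /inv[] //.
Qed.

End IsometryRigidity.

Lemma le_of_sqr_scaling (R : realType) (A B : R) : 0 < A -> 0 < B ->
  (forall e, 0 < e -> e < 1 -> A * (1 - e) ^+ 2 <= B * (1 + e) ^+ 2) -> A <= B.
Proof.
move=> A0 B0 key; rewrite leNgt; apply/negP => BA.
have AB : 0 < 4 * (A + B) by lra.
have [e e0 eE] : exists2 e, 0 < e & e * (4 * (A + B)) = A - B.
  by exists ((A - B) / (4 * (A + B))); [rewrite divr_gt0// subr_gt0|rewrite divfK// gt_eqF].
have eA := mulr_gt0 e0 A0; have eB := mulr_gt0 e0 B0.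
have e1 : e < 1 by rewrite -(ltr_pM2r AB) eE mul1r; lra.
have eAe := mulr_gt0 eA e0.
have eBe : e * B * e <= e * B * 1 by apply: ler_wpM2l; exact: ltW.
by have := key e e0 e1; lra.
Qed.

(** * Isometries and heights *)

Section Noncongruence.
Variables (R : realType) (n : nat).
Notation pt := 'rV[R]_(n + 1).
Notation H := (@upper_half_space R n).
Implicit Types (p q : pt) (y : R) (S : set pt).

(* Far away points [q] of bounded height see [p] and [p0] at a ratio of [hdelta]
   which tends to the inverse ratio of their heights. *)
Lemma isometry_height_ratio_le (Phi : pt -> pt) S lo hi : hyp_isometry Phi ->
  S `<=` H -> 0 < lo -> (forall B, exists2 q, S q & B <= enorm q) ->
  (forall q, S q -> height q <= hi) -> (forall q, S q -> lo <= height (Phi q)) ->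
  forall p p0, H p -> H p0 ->
    height p0 / height p <= height (Phi p0) / height (Phi p).
Proof.
move=> iso SH lo0 Sfar Shi Slo p p0 Hp Hp0.
have PhiH x : H x -> H (Phi x).
  by have [Psi _ inv] := isometry_inverse iso; move=> /inv[].
set A := _ / _; set B := _ / _.
have zp : 0 < height p by []. have zp0 : 0 < height p0 by [].
have Zp : 0 < height (Phi p) by exact: PhiH.
have Zp0 : 0 < height (Phi p0) by exact: PhiH.
have A0 : 0 < A by rewrite divr_gt0.
have B0 : 0 < B by rewrite divr_gt0.
have [q1 Sq1 _] := Sfar 0.
have hi0 : 0 < hi by apply: lt_le_trans (Shi _ Sq1); exact: SH.
(* Preservation of [hdelta] and the height bounds give [k * |p0 - q| <= |Phi p0 - Phi q|], so the
   images also run off to infinity. *)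
pose k := Num.sqrt (height (Phi p0) * lo / (height p0 * hi)).
have k2 : 0 < height (Phi p0) * lo / (height p0 * hi) by rewrite divr_gt0// mulr_gt0.
have k0 : 0 < k by rewrite sqrtr_gt0.
have key e : 0 < e -> e < 1 -> A * (1 - e) ^+ 2 <= B * (1 + e) ^+ 2.
  move=> e0 e1; set C := enorm (p - p0); set C' := enorm (Phi p - Phi p0).
  have C0 : 0 <= C by exact: enorm_ge0.
  have C'0 : 0 <= C' by exact: enorm_ge0.
  (* Far enough that the fixed distances [C] and [C'] are at most the fraction [e] of the distances
     from [p0] to [q] and from [Phi p0] to [Phi q]. *)
  have [q Sq qB] := Sfar (enorm p0 + (C + C' / k + 1) / e).
  have Hq := SH q Sq; have zq : 0 < height q by [].
  have Zq : 0 < height (Phi q) by exact: PhiH.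
  set d := enorm (p0 - q); set D := enorm (Phi p0 - Phi q).
  have dB : (C + C' / k + 1) / e <= d.
    have := enormD (q - p0) p0; rewrite subrK /d -(enormN (p0 - q)) opprB; lra.
  have edB : C + C' / k + 1 <= e * d by rewrite [e * d]mulrC -ler_pdivrMr.
  have Ck0 : 0 <= C' / k by rewrite divr_ge0// ltW.
  have d0 : 0 < d by rewrite -(pmulr_rgt0 _ e0); lra.
  have kd : k * d <= D.
    rewrite -(@ler_pXn2r _ 2)// ?nnegrE ?enorm_ge0//; last by rewrite mulr_ge0// ltW.
    rewrite exprMn sqr_sqrtr; last exact: ltW.
    have -> : D ^+ 2 = hdelta p0 q * height (Phi p0) * height (Phi q).
      by rewrite -(isometry_hdelta iso Hp0 Hq) /hdelta -/D; field; rewrite !gt_eqF.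
    rewrite /hdelta -/d mulrC (_ : _ / _ * _ * _ =
      d ^+ 2 * (height (Phi p0) * height (Phi q) / (height p0 * height q))); last first.
      by field; rewrite !gt_eqF.
    rewrite ler_wpM2l ?sqr_ge0//.
    apply: ler_pM; first by rewrite mulr_ge0// ltW.
    - by rewrite invr_ge0 mulr_ge0// ltW.
    - by rewrite ler_wpM2l ?Slo// ltW.
    - by rewrite lef_pV2 ?posrE ?mulr_gt0// ler_wpM2l ?Shi// ltW.
  have D0 : 0 < D by apply: lt_le_trans kd; rewrite mulr_gt0.
  have Cd : C <= e * d by lra.
  have CD : C' <= e * D.
    apply: (@le_trans _ _ (e * (k * d))); last by rewrite ler_wpM2l// ltW.
    by rewrite mulrCA [k * _]mulrC -ler_pdivrMr//; lra.
  have l1 : (1 - e) * d <= enorm (p - q).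
    have := enormD (p - q) (p0 - p); rewrite addrC subrKA -/d.
    rewrite -(enormN (p0 - p)) opprB -/C; lra.
  have l2 : enorm (Phi p - Phi q) <= (1 + e) * D.
    have := enormD (Phi p - Phi p0) (Phi p0 - Phi q); rewrite subrKA -/C' -/D; lra.
  have s1 : ((1 - e) * d) ^+ 2 <= enorm (p - q) ^+ 2.
    by rewrite lerXn2r ?nnegrE ?enorm_ge0// mulr_ge0 ?(ltW d0)//; lra.
  have s2 : enorm (Phi p - Phi q) ^+ 2 <= ((1 + e) * D) ^+ 2.
    by rewrite lerXn2r ?nnegrE ?enorm_ge0// mulr_ge0 ?(ltW D0)//; lra.
  have dd := isometry_hdelta iso Hp Hq; have dd0 := isometry_hdelta iso Hp0 Hq.
  have dp0 : 0 < hdelta p0 q by rewrite divr_gt0 ?exprn_gt0// mulr_gt0.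
  rewrite -(ler_pM2l dp0).
  apply: (@le_trans _ _ (hdelta p q)).
    rewrite /hdelta -/d ler_pdivlMr ?mulr_gt0//; apply: le_trans s1.
    by rewrite /A le_eqVlt; apply/orP; left; apply/eqP; field; rewrite !gt_eqF.
  rewrite -dd -dd0 /hdelta -/D ler_pdivrMr ?mulr_gt0//; apply: le_trans s2 _.
  by rewrite /B le_eqVlt; apply/orP; left; apply/eqP; field; rewrite !gt_eqF.
exact: le_of_sqr_scaling.
Qed.

(** What the comparison of necks uses: the radius is unbounded and has a unique minimum [r], at
    height [h]. *)
Definition neck (rm rp : R) (Rad : R -> R) (h r : R) : Prop :=
  [/\ 0 < rm, rm < h < rp, (forall y, 0 < Rad y), Rad h = r &
      (forall y, rm < y < rp -> r <= Rad y /\ (Rad y = r -> y = h)) /\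
      (forall B, exists2 y, rm < y < rp & B <= Rad y)].

Lemma enorm_base_le p : enorm (base p) <= enorm p.
Proof.
rewrite -(@ler_pXn2r _ 2)// ?nnegrE ?enorm_ge0// !sqr_enorm big_base_height.
under eq_bigr => i _ do rewrite baseE.
by rewrite lerDl sqr_ge0.
Qed.

Lemma enorm_same_height p q : height p = height q ->
  enorm (p - q) = enorm (base p - base q).
Proof.
move=> pq; apply/eqP; rewrite -(@eqrXn2 _ 2)// ?enorm_ge0// !sqr_enorm.
rewrite big_base_height !mxE -!heightE pq subrr expr0n addr0.
by apply/eqP; apply: eq_bigr => i _; rewrite !mxE.
Qed.

End Noncongruence.

Section RevolutionNoncongruence.
Variables (R : realType) (n' : nat).
Let n := n'.+1.
Notation pt := 'rV[R]_(n + 1).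
Notation H := (@upper_half_space R n).
Implicit Types (p q : pt) (y : R).

Definition axis_point (x y : R) : pt := row_mx (x *: delta_mx 0 ord0) (\row_(j < 1) y).

Lemma axis_point_base x y : base (axis_point x y) = x *: delta_mx 0 ord0.
Proof. exact: row_mxKl. Qed.

Lemma axis_point_height x y : height (axis_point x y) = y.
Proof. by rewrite heightE row_mxEr mxE. Qed.

Lemma enorm_axis_base (x : R) : enorm (x *: delta_mx 0 ord0 : 'rV[R]_n) = `|x|.
Proof.
rewrite enormZ (_ : enorm _ = 1) ?mulr1//.
apply/eqP; rewrite -(@eqrXn2 _ 2)// ?enorm_ge0// expr1n sqr_enorm (bigD1 ord0)//=.
rewrite big1 => [|i i0]; first by rewrite mxE !eqxx expr1n addr0.
by rewrite mxE (negbTE i0) andbF expr0n.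
Qed.

Lemma axis_point_revolution rm rp Rad (y x : R) : rm < y < rp -> `|x| = Rad y ->
  revolution rm rp Rad (axis_point x y).
Proof.
by move=> yI xy; split; rewrite axis_point_height// axis_point_base enorm_axis_base.
Qed.

(** With heights multiplied by [l], Euclidean distances between points of equal height are
    multiplied by [l] too. Two antipodal points of the parallel at height [y] thus land at distance
    [2 * l * Rad y] on a sphere of radius [Sad (l * y)]. *)
Lemma congruent_scaling (Phi : pt -> pt) rm rp Rad sm sp Sad h r s :
  hyp_isometry Phi -> neck rm rp Rad h r -> neck sm sp Sad h s ->
  (forall p, revolution rm rp Rad p -> revolution sm sp Sad (Phi p)) ->
  exists2 l, forall p, H p -> height (Phi p) = l * height p &
   forall y, rm < y < rp -> sm < l * y < sp /\ l * Rad y <= Sad (l * y).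
Proof.
move=> iso [rm0 hI Rad0 Radh [Radmin Radfar]] [sm0 hI' Sad0 Sadh _] PhiS.
have SH : revolution rm rp Rad `<=` H.
  by move=> p [/andP[+ _] _]; exact: lt_trans.
have Sfar B : exists2 q : pt, revolution rm rp Rad q & B <= enorm q.
  have [y yI By] := Radfar B; exists (axis_point (Rad y) y).
    by apply: axis_point_revolution => //; rewrite gtr0_norm.
  apply: le_trans By _; apply: le_trans (enorm_base_le _).
  by rewrite axis_point_base enorm_axis_base ler_norm.
have ratio := isometry_height_ratio_le iso SH sm0 Sfar
   (fun q Sq => ltW (andP (Sq.1)).2) (fun q Sq => ltW (andP (PhiS q Sq).1).1).
have PhiH p : H p -> H (Phi p).
  by have [Psi _ inv] := isometry_inverse iso; move=> /inv[].
pose p1 : pt := axis_point 0 1.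
have Hp1 : H p1 by rewrite /upper_half_space/= axis_point_height.
pose l := height (Phi p1).
have hPhi p : H p -> height (Phi p) = l * height p.
  move=> Hp; have := ratio p p1 Hp Hp1; have := ratio p1 p Hp1 Hp.
  have zp : 0 < height p by []. have Zp : 0 < height (Phi p) by exact: PhiH.
  have l0 : 0 < l by exact: PhiH.
  rewrite axis_point_height -/l divr1 ler_pdivlMr// => le1.
  rewrite div1r ler_pdivlMr// mulrC ler_pdivrMr// => le2.
  by apply/eqP; rewrite eq_le le2 mulrC le1.
exists l => // y yI.
have Sp : revolution rm rp Rad (axis_point (Rad y) y).
  by apply: axis_point_revolution; rewrite ?gtr0_norm.
have Sq : revolution rm rp Rad (axis_point (- Rad y) y).
  by apply: axis_point_revolution; rewrite // normrN gtr0_norm.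
have Hp := SH _ Sp; have Hq := SH _ Sq.
have [pI pE] := PhiS _ Sp; have [qI qE] := PhiS _ Sq.
have e1 := hPhi _ Hp; have e2 := hPhi _ Hq.
rewrite axis_point_height in e1; rewrite axis_point_height in e2.
rewrite e1 in pI pE; rewrite e2 in qI qE; split=> //.
have y0 : 0 < y by case/andP: yI => + _; exact: lt_trans.
have l0 : 0 < l by exact: PhiH.
have D := isometry_hdelta iso Hp Hq.
have dE : enorm (Phi (axis_point (Rad y) y) - Phi (axis_point (- Rad y) y)) = l * (2 * Rad y).
  apply/eqP; rewrite -(@eqrXn2 _ 2)// ?enorm_ge0//; last first.
    by rewrite !mulr_ge0// ltW.
  move: D; rewrite /hdelta e1 e2 !axis_point_height.
  rewrite (enorm_same_height (p := axis_point (Rad y) y)) ?axis_point_height//.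
  rewrite !axis_point_base -scalerBl opprK enorm_axis_base ger0_norm; last first.
    by rewrite addr_ge0// ltW.
  move=> D; apply/eqP.
  have ly : l * y * (l * y) != 0 by rewrite !mulf_neq0// gt_eqF.
  apply: (mulIf (invr_neq0 ly)); rewrite D; field.
  by rewrite !gt_eqF.
have := enormD (base (Phi (axis_point (Rad y) y))) (- base (Phi (axis_point (- Rad y) y))).
rewrite enormN pE qE -enorm_same_height ?e1 ?e2// dE; lra.
Qed.

(** Applied to the isometry and to its inverse, the scaling inequality becomes an equality, so the
    minimum of [Rad] is carried to that of [Sad]. Both are attained only at height [h], which forces
    [l = 1]. *)
Lemma revolution_not_congruent rm rp Rad sm sp Sad h r s : 0 < h -> 0 < r ->
  neck rm rp Rad h r -> neck sm sp Sad h s ->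
  congruent (revolution rm rp Rad : set pt) (revolution sm sp Sad) -> r = s.
Proof.
move=> h0 r0 nr ns [Phi iso PhiS].
have [Psi isoPsi inv] := isometry_inverse iso.
have SH a b F y x : neck a b F y x -> revolution a b F `<=` H.
  by move=> [rm0 _ _ _ _] p [/andP[+ _] _]; exact: lt_trans.
have PhiSs p : revolution rm rp Rad p -> revolution sm sp Sad (Phi p).
  by move=> Sp; rewrite -PhiS; exists p.
have PsiSs p : revolution sm sp Sad p -> revolution rm rp Rad (Psi p).
  rewrite -PhiS => -[q Sq <-].
  by have [_ -> _ _] := inv q (SH _ _ _ _ _ nr _ Sq).
have [l lh lRad] := congruent_scaling iso nr ns PhiSs.
have [k kh kSad] := congruent_scaling isoPsi ns nr PsiSs.
case: nr => rm0 hr Rad0 Radh [Radmin _]; case: ns => sm0 hs Sad0 Sadh [Sadmin _].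
have kl : k * l = 1.
  pose p : pt := axis_point 0 h.
  have Hp : H p by rewrite /upper_half_space/= axis_point_height.
  have [HPhip e _ _] := inv p Hp; have := kh _ HPhip; rewrite e lh// mulrA.
  rewrite axis_point_height => /eqP; rewrite -subr_eq0 -{1}[h]mul1r -mulrBl.
  by rewrite mulf_eq0 (gt_eqF h0) orbF subr_eq0 => /eqP.
have [lI lR] := lRad h hr; have [kI kS] := kSad h hs.
have [_ kS'] := kSad _ lI; have [_ lR'] := lRad _ kI.
rewrite mulrA kl mul1r Radh in kS'.
have lk : l * k = 1 by rewrite mulrC.
rewrite mulrA lk mul1r Sadh in lR'.
rewrite Radh in lR; rewrite Sadh in kS.
have [s1 s2] := Sadmin _ lI; have [r1 _] := Radmin _ kI.
have l0 : 0 < l.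
  have : 0 < l * h by case/andP: lI => + _; exact: lt_trans.
  by rewrite pmulr_lgt0.
have k0 : 0 < k by rewrite -(pmulr_lgt0 _ l0) kl.
have sl : s <= l * r.
  have := ler_wpM2l (ltW l0) kS'; rewrite mulrA lk mul1r; lra.
have ls : l * r <= s.
  have := ler_wpM2l (ltW l0) r1; lra.
have Sl : Sad (l * h) = s.
  apply/eqP; rewrite eq_le s1 andbT.
  have := ler_wpM2l (ltW l0) kS'; rewrite mulrA lk mul1r; lra.
have /eqP := s2 Sl; rewrite -subr_eq0 -{2}[h]mul1r -mulrBl mulf_eq0 (gt_eqF h0) orbF.
rewrite subr_eq0 => /eqP l1.
by apply/eqP; rewrite eq_le; move: sl ls; rewrite l1 mul1r => -> ->.
Qed.

End RevolutionNoncongruence.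

(** * Topology *)

Section Topology.
Variable R : realType.

Lemma continuous_rV (T : topologicalType) d (F : T -> 'rV[R]_d) x :
  (forall i, {for x, continuous (fun y => F y 0 i)}) -> {for x, continuous F}.
Proof.
move=> Fc.
have H (k : nat) (G : 'I_k -> T -> 'rV[R]_d) : (forall i, {for x, continuous (G i)}) ->
    {for x, continuous (fun y => \sum_i G i y)}.
  elim: k G => [|k IH] G Gc.
    rewrite (_ : (fun y => _) = fun=> 0); first exact: cst_continuous.
    by apply/funext => y; rewrite big_ord0.
  rewrite (_ : (fun y => _) = G ord0 \+ (fun y => \sum_(i < k) G (lift ord0 i) y)).
    by apply: continuousD; [exact: Gc|exact: IH].
  by apply/funext => y; rewrite big_ord_recl.
rewrite (_ : F = (fun y => \sum_i F y 0 i *: 'e_i)).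
  by apply: H => i; apply: continuousZr_tmp; exact: Fc.
by apply/funext => y; exact: row_sum_delta.
Qed.

Section Fixed.
Variable n : nat.
Notation pt := 'rV[R]_(n + 1).
Implicit Types (p q : pt) (x y : 'rV[R]_n) (r : R).

Lemma enorm_continuous d : continuous (@enorm R d).
Proof.
move=> x.
rewrite (_ : @enorm R d = Num.sqrt \o (fun x : 'rV[R]_d => \sum_i x 0 i * x 0 i)); last first.
  by apply/funext => y; rewrite /enorm/=; under eq_bigr => i _ do rewrite expr2.
apply: continuous_comp; last exact: sqrt_continuous.
have H : Ck_on 0 [set: 'rV[R]_d] (fun x : 'rV[R]_d => \sum_i x 0 i * x 0 i).
  apply: Ck_on_sum; first exact: openT.
  by move=> i; apply: Ck_onM; [exact: openT|exact: Ck_on_coord|exact: Ck_on_coord].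
exact: (H x I).
Qed.

Lemma enorm_smooth k d (U : set 'rV[R]_d) : open U ->
  (forall x : 'rV[R]_d, U x -> 0 < enorm x) ->
  Ck_on k U (@enorm R d).
Proof.
move=> oU U0.
apply: (Ck_on_comp (I := [set y : R | 0 < y]) (f := Num.sqrt)
  (u := fun x : 'rV[R]_d => \sum_i x 0 i ^+ 2)) => //.
- by move=> x /U0; rewrite -sqr_enorm /=; exact: exprn_gt0.
- exact: Ck1_sqrt.
- apply: Ck_on_sum => // i.
  rewrite (_ : (fun x : 'rV[R]_d => _) = (fun x : 'rV[R]_d => x 0 i * x 0 i)).
    by apply: Ck_onM => //; exact: Ck_on_coord.
  by apply/funext => x; rewrite expr2.
Qed.

Lemma base_continuous : continuous (@base R n).
Proof. by move=> p; apply: differentiable_continuous; exact: differentiable_lsubmx. Qed.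

Lemma height_continuous : continuous (@height R n).
Proof. by move=> p; exact: coord_continuous. Qed.

Lemma compact_enorm_bounded d (K : set 'rV[R]_d) : compact K ->
  exists2 M, 0 < M & forall x : 'rV[R]_d, K x -> enorm x <= M.
Proof.
move=> cK; have : compact (@enorm R d @` K).
  by apply: continuous_compact => //; apply: continuous_subspaceT; exact: enorm_continuous.
move=> /compact_bounded[M [_ HM]]; exists (`|M| + 1).
  by rewrite ltr_wpDl.
move=> x Kx; have := HM (`|M| + 1) _ (enorm x).
rewrite /= (ger0_norm (enorm_ge0 x)); apply; last by exists x.
by rewrite (le_lt_trans (ler_norm _))// ltrDl.
Qed.

Lemma open_eball r : open (@eball R n r).
Proof.
rewrite (_ : eball r = @enorm R n @^-1` [set y | y < r])//.
by apply: open_comp; [move=> x _; exact: enorm_continuous|exact: open_lt].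
Qed.

Lemma exteriorE r x : (~` @eball R n r) x <-> r <= enorm x.
Proof. by rewrite /eball /= leNgt; split => [/negP|/negP]. Qed.

Lemma interior_exterior r : 0 < r ->
  interior (~` @eball R n r) = [set x | r < enorm x].
Proof.
move=> r0; apply/seteqP; split => x.
- move=> /= H; have xr : r <= enorm x by apply/exteriorE; exact: interior_subset H.
  rewrite lt_neqAle xr andbT; apply/negP => /eqP e.
  (* A point of the sphere is not interior: shrinking it slightly leaves the exterior. *)
  have sc : (fun t : R => t *: x) t @[t --> (1 : R)] --> x.
    rewrite -[X in _ --> X]scale1r; apply: cvgZr_tmp; exact: cvg_id.
  have : \forall t \near (1 : R), (~` @eball R n r) (t *: x) by exact: sc.
  move=> /nbhs_ballP[d /= d0 dH].
  have /dH/exteriorE : ball (1 : R) d (1 - Num.min (d / 2) (1 / 2)).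
    rewrite /ball/= opprB addrCA subrr addr0 ger0_norm ?le_min ?divr_ge0 ?(ltW d0)//.
    by rewrite gt_min; apply/orP; left; rewrite ltr_pdivrMr//; lra.
  have m0 : 0 < Num.min (d / 2) (1 / 2) by rewrite lt_min !divr_gt0.
  have m1 : Num.min (d / 2) (1 / 2) <= 1 / 2 by rewrite ge_min lexx orbT.
  rewrite enormZ -e ger0_norm; last by lra.
  by have := mulr_gt0 m0 r0; lra.
- move=> /= rx; rewrite /interior.
  have : nbhs x [set y | r < enorm y].
    apply: open_nbhs_nbhs; split => //.
    rewrite (_ : [set y | _] = @enorm R n @^-1` [set y | r < y])//.
    by apply: open_comp; [move=> y _; exact: enorm_continuous|exact: open_gt].
  by apply: filterS => y /= ry; apply/exteriorE/ltW.
Qed.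

Lemma exterior_boundary r x : 0 < r ->
  ((~` @eball R n r) `\` interior (~` @eball R n r)) x <-> enorm x = r.
Proof.
move=> r0; rewrite interior_exterior//; split.
  by move=> [/exteriorE rx /negP]; rewrite -leNgt => xr; apply: le_anti; rewrite rx xr.
by move=> xr; split; [apply/exteriorE|rewrite /=]; rewrite xr ?ltxx.
Qed.

Lemma closed_vgraph (phi : 'rV[R]_n -> R) (D : set 'rV[R]_n) :
  continuous phi -> closed D -> closed (vgraph phi D).
Proof.
move=> phic cD.
rewrite (_ : vgraph phi D = (@base R n @^-1` D) `&`
    ((fun p => height p - phi (base p)) @^-1` [set 0])); last first.
  apply/seteqP; split => p /= [Dp]; [move=> ->|move/eqP]; first by rewrite subrr.
  by rewrite subr_eq0 => /eqP.
apply: closedI; apply: preimage_closed => //.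
- by move=> p _; exact: base_continuous.
- move=> p _.
  have pc : {for p, continuous (phi \o @base R n)}.
    by apply: continuous_comp; [exact: base_continuous|exact: phic].
  exact: (continuousB (height_continuous (x := p)) pc).
Qed.

Lemma slab_component (A : set pt) (a b : R) p :
  (forall q, a < height q < b -> A q) -> a < height p < b ->
  [set q | a < height q < b] `<=` connected_component A p.
Proof.
move=> abA pab q /= qab.
pose c t := p + t *: (q - p).
have hc t : height (c t) = height p + t * (height q - height p).
  by rewrite !heightE !mxE.
apply: (@connected_component_max _ A (c @` `[0, 1])).
- by exists 0; [rewrite /= in_itv/= lexx ler01|rewrite /c scale0r addr0].
- move=> _ [t tI <-]; apply: abA.
  move: tI; rewrite /= in_itv/= => /andP[t0 t1].
  rewrite hc; case/andP: pab => pa pb; case/andP: qab => qa qb.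
  have e : height p + t * (height q - height p) = (1 - t) * height p + t * height q by ring.
  rewrite e; apply/andP; split.
    have [t00|t00] := eqVneq t 0; first by rewrite t00; lra.
    have tp : 0 < t by rewrite lt_neqAle eq_sym t00.
    have : t * a < t * height q by rewrite ltr_pM2l.
    have : (1 - t) * a <= (1 - t) * height p by apply: ler_wpM2l; lra.
    lra.
  have [t00|t00] := eqVneq t 0; first by rewrite t00; lra.
  have tp : 0 < t by rewrite lt_neqAle eq_sym t00.
  have : t * height q < t * b by rewrite ltr_pM2l.
  have : (1 - t) * height p <= (1 - t) * b by apply: ler_wpM2l; lra.
  lra.
- apply: connected_continuous_connected; first exact: segment_connected.
  apply: continuous_subspaceT => t; apply: cvgD; first exact: cvg_cst.
  by apply: cvgZr_tmp; exact: cvg_id.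
- by exists 1; [rewrite /= in_itv/= lexx ler01|rewrite /c scale1r subrKC].
Qed.

(** The heights of a connected set form an interval; one component meeting both sides would contain
    a point of height [h]. *)
Lemma graphs_in_distinct_components (S T : set pt) (h hi : R) : 0 < h ->
  (forall p, S p -> 0 < height p < h) -> (forall p, T p -> h < height p < hi) ->
  in_distinct_components (upper_half_space `\` horosphere h) S T.
Proof.
move=> h0 Sh Th.
pose pn (y : R) : pt := row_mx 0 (\row_(j < 1) y).
have hpn (y : R) : height (pn y) = y by rewrite heightE row_mxEr mxE.
pose k := Num.max hi h + 1.
have hm : h <= Num.max hi h by rewrite le_max lexx orbT.
have him : hi <= Num.max hi h by rewrite le_max lexx.
have hk : h < k by rewrite /k; lra.
have hik : hi <= k by rewrite /k; lra.
set A := _ `\` _.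
have Al q : 0 < height q < h -> A q.
  by move=> /andP[q0 qh]; split => //= e; move: qh; rewrite e ltxx.
have Au q : h < height q < k + 1 -> A q.
  move=> /andP[q0 qh]; split; first exact: lt_trans q0.
  by move=> e; move: q0; rewrite e ltxx.
have lI : 0 < height (pn (h / 2)) < h by rewrite hpn; apply/andP; split; lra.
have uI : h < height (pn k) < k + 1 by rewrite hpn hk ltrDl ltr01.
exists (pn (h / 2)), (pn k); split.
- exact: Al.
- exact: Au.
- move=> e; have : connected_component A (pn (h / 2)) (pn k).
    by rewrite e; exact: (slab_component Au uI uI).
  move=> uk.
  have /connected_intervalP cI : connected (@height R n @` connected_component A (pn (h / 2))).
    apply: connected_continuous_connected; first exact: component_connected.
    by apply: continuous_subspaceT; exact: height_continuous.
  have lk : connected_component A (pn (h / 2)) (pn (h / 2)).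
    exact: (slab_component Al lI lI).
  have := cI (h / 2) k; rewrite /is_interval.
  have i1 : (@height R n @` connected_component A (pn (h / 2))) (h / 2) by exists (pn (h / 2)).
  have i2 : (@height R n @` connected_component A (pn (h / 2))) k by exists (pn k).
  move=> /(_ i1 i2 h); case; first by apply/andP; split; lra.
  move=> q qc qh.
  have [_] := connected_component_sub qc; apply; exact: qh.
- by move=> p /Sh pI; exact: (slab_component Al lI pI).
- move=> p /Th /andP[hp ph].
  have pI : h < height p < k + 1 by rewrite hp/=; lra.
  exact: (slab_component Au uI pI).
Qed.

(** A finite ideal point has a neighbourhood below height [lo]. Every neighbourhood of infinity
    contains the complement of a compact set, and [S] is unbounded. *)
Lemma asymptotic_boundary_infinity (S : set pt) (lo : R) : 0 < lo ->
  (forall p, S p -> lo < height p) -> (forall B, exists2 q, S q & B <= enorm q) ->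
  asymptotic_boundary S = [set None].
Proof.
move=> lo0 Slo Sfar; apply/seteqP; split.
- move=> x [cx [//|[p /= p0 px]]]; subst x; exfalso.
  have N : nbhs (Some p : one_point_compactification pt)
      (Some @` [set q : pt | height q < lo]).
    apply: one_point_compactification_some_nbhs; apply: open_nbhs_nbhs; split.
      rewrite (_ : [set q | _] = @height R n @^-1` [set y | y < lo])//.
      by apply: open_comp; [move=> y _; exact: height_continuous|exact: open_lt].
    by rewrite /= p0.
  have [_ [[q Sq <-] [q' /= q'lo [e]]]] := cx _ N.
  by move: q'lo; rewrite e; have := Slo q Sq; lra.
- move=> _ ->; split; last by left.
  move=> B /= [U [cU _] UB].
  have [M M0 HM] := compact_enorm_bounded cU.
  have [q Sq qM] := Sfar (M + 1).
  exists (Some q); split; first by exists q.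
  by apply: UB; left; exists q => // /HM; lra.
Qed.

End Fixed.
End Topology.

(** * Convergence to the horosphere *)

Section BoundedC1.
Variable R : realType.
Variables a b : R.
Implicit Types (F G f p : R -> R) (M x e : R).

(** One constant for the value and the derivative gives a calculus of products and reciprocals; the
    derivative part provides the Lipschitz, hence Holder, estimate of second derivatives. *)
Definition C1_bound M F : Prop := forall x, a <= x <= b ->
  `|F x| <= M /\ exists2 d, is_derive x 1 F d & `|d| <= M.

Lemma C1_bound_cst c : C1_bound `|c| (fun=> c).
Proof. move=> x _; split=> //; exists 0; first exact: is_derive_cst.
by rewrite normr0. Qed.

Lemma C1_boundD M N F G : C1_bound M F -> C1_bound N G ->
  C1_bound (M + N) (fun x => F x + G x).
Proof.
move=> FM GN x xI; have [Fx [dF FD dFM]] := FM x xI; have [Gx [dG GD dGN]] := GN x xI.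
split; first by rewrite (le_trans (ler_normD _ _))// lerD.
exists (dF + dG); first exact: is_deriveD.
by rewrite (le_trans (ler_normD _ _))// lerD.
Qed.

Lemma C1_boundM M N F G : C1_bound M F -> C1_bound N G ->
  C1_bound (2 * M * N) (fun x => F x * G x).
Proof.
move=> FM GN x xI; have [Fx [dF FD dFM]] := FM x xI; have [Gx [dG GD dGN]] := GN x xI.
have M0 : 0 <= M by exact: le_trans Fx.
have N0 : 0 <= N by exact: le_trans Gx.
split.
  rewrite normrM; apply: (@le_trans _ _ (M * N)); first by rewrite ler_pM.
  by have := mulr_ge0 M0 N0; lra.
exists (F x * dG + G x * dF); first exact: is_deriveM.
apply: le_trans (ler_normD _ _) _; rewrite !normrM.
have := ler_pM (normr_ge0 _) (normr_ge0 _) Fx dGN.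
have := ler_pM (normr_ge0 _) (normr_ge0 _) Gx dFM; lra.
Qed.

Lemma C1_boundN M F : C1_bound M F -> C1_bound M (fun x => - F x).
Proof.
move=> FM x xI; have [Fx [dF FD dFM]] := FM x xI; rewrite normrN; split=> //.
by exists (- dF); rewrite ?normrN//; exact: is_deriveN.
Qed.

Lemma C1_boundV M N F : 0 < M -> (forall x, a <= x <= b -> M <= F x) ->
  (forall x, a <= x <= b -> exists2 d, is_derive x 1 F d & `|d| <= N) ->
  C1_bound (M^-1 + N * M^-1 ^+ 2) (fun x => (F x)^-1).
Proof.
move=> M0 MF FD x xI; have Mx := MF x xI; have [d dF dN] := FD x xI.
have F0 : 0 < F x by apply: lt_le_trans Mx.
have N0 : 0 <= N by apply: le_trans dN.
have VM : (F x)^-1 <= M^-1 by rewrite lef_pV2 ?posrE.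
have MV : 0 < M^-1 by rewrite invr_gt0.
have FV : 0 <= (F x)^-1 by rewrite invr_ge0 ltW.
split.
  rewrite ger0_norm//; apply: le_trans VM _.
  by rewrite lerDl mulr_ge0// sqr_ge0.
exists (- (F x)^-1 ^+ 2 * d).
  have := is_deriveV (lt0r_neq0 F0) dF.
  by move=> /is_derive_eq; apply; rewrite exprVn.
rewrite normrM normrN (ger0_norm (sqr_ge0 _)) mulrC.
apply: (@le_trans _ _ (N * M^-1 ^+ 2)); last by rewrite lerDr ltW.
by rewrite ler_pM ?sqr_ge0// lerXn2r ?nnegrE ?(ltW MV).
Qed.

Lemma C1_bound_lipschitz M F x y : C1_bound M F -> a <= x <= b -> a <= y <= b ->
  `|F x - F y| <= M * `|x - y|.
Proof.
move=> FM; wlog yx : x y / y <= x.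
  move=> H xI yI; have [yx|/ltW xy] := leP y x; first exact: H.
  by rewrite distrC (distrC x); exact: H.
move=> /andP[ax xb] /andP[ay yb].
have /choice[dF dFP] z : exists d, a <= z <= b -> is_derive z 1 F d /\ `|d| <= M.
  have [zI|zI] := boolP (a <= z <= b); last by exists 0.
  by have [_ [d dF dM]] := FM z zI; exists d.
have I z : y <= z <= x -> a <= z <= b by move=> /andP[? ?]; apply/andP; split; lra.
have [c cI ->] := mean_value yx (fun z zI => (dFP z (I z zI)).1).
rewrite normrM; apply: ler_wpM2r => //.
exact: (dFP c (I c cI)).2.
Qed.

Lemma C1_bound_le M N F : M <= N -> C1_bound M F -> C1_bound N F.
Proof.
move=> MN FM x /FM[Fx [d dF dM]]; split; first exact: le_trans MN.
by exists d => //; exact: le_trans MN.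
Qed.

Hypothesis a0 : 0 < a.

(* The derivatives up to order 2 of [x |-> f |x|] are
   [radial_grad |x| * x_j] and
   [radial_hess |x| * x_i * x_j + radial_grad |x| * (i == j)], where [p = f']. *)
Definition radial_grad p x : R := p x * x^-1.

Definition radial_hess (m : R) f p x : R :=
  p x * (- ((1 + p x * p x) * balance m x (f x) * x^-1 + x^-1 * x^-1) * x^-1).

Definition small_slope (m c e : R) f p : Prop := forall x, a <= x <= b ->
  [/\ c <= f x, `|p x| <= e, is_derive x 1 f (p x) &
      is_derive x 1 p (- (p x * (1 + p x * p x) * balance m x (f x)))].

Lemma radial_grad_derive m c e f p x : 0 < c -> small_slope m c e f p -> a <= x <= b ->
  is_derive x 1 (radial_grad p) (radial_hess m f p x * x).
Proof.
move=> c0 fp xI; have [cf pe fD pD] := fp x xI.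
have x0 : x != 0 by rewrite gt_eqF//; case/andP: xI => + _; exact: lt_le_trans.
apply: (is_derive_eq (is_deriveM pD (is_derive1_inv x0))).
by rewrite -![_ *: _]/(_ * _) /radial_hess; field.
Qed.

(** Both functions carry the slope [p] as a factor, and so does [p'] by the equation; hence bounds
    linear in [e]. The cofactors are bounded by constants that depend on [m], [a], [b] and [c] but
    not on [f]. *)
Lemma radial_C1_bound (m c : R) : 0 < c -> a <= b -> exists2 C, 0 <= C &
  forall e f p, 0 <= e <= 1 -> small_slope m c e f p ->
    C1_bound (C * e) (radial_grad p) /\ C1_bound (C * e) (radial_hess m f p).
Proof.
move=> c0 ab.
pose MV := a^-1 + 1 * a^-1 ^+ 2; pose MF := c^-1 + 1 * c^-1 ^+ 2.
pose MX := b + 1.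
pose MB := 2 * `|m - 1| * MV + 2 * (2 * `|m| * MX) * (2 * MF * MF).
pose Mp := 1 + 2 * MB.
pose Mh := 2 * (2 * (2 * (`|1| + 2 * Mp * Mp) * MB) * MV + 2 * MV * MV) * MV.
have V0 : 0 <= MV by rewrite addr_ge0 ?mul1r ?sqr_ge0// invr_ge0 ltW.
have F0 : 0 <= MF by rewrite addr_ge0 ?mul1r ?sqr_ge0// invr_ge0 ltW.
have X0 : 0 <= MX by rewrite addr_ge0// (le_trans (ltW a0)).
have B0 : 0 <= MB by rewrite addr_ge0// !mulr_ge0.
have p0 : 0 <= Mp by rewrite addr_ge0// mulr_ge0.
have h0 : 0 <= Mh.
  rewrite mulr_ge0// mulr_ge0// addr_ge0// mulr_ge0//.
    by rewrite mulr_ge0// mulr_ge0// mulr_ge0// addr_ge0// mulr_ge0// mulr_ge0.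
  by rewrite mulr_ge0.
exists (2 * Mp * MV + 2 * Mp * Mh); first by rewrite addr_ge0// mulr_ge0// mulr_ge0.
move=> e f p /andP[e0 e1] fp.
have xV : C1_bound MV (fun x => x^-1).
  apply: (C1_boundV a0); first by move=> x /andP[].
  by move=> x _; exists 1; rewrite ?normr1//; exact: is_derive_id.
have fV : C1_bound MF (fun x => (f x)^-1).
  apply: (C1_boundV c0); first by move=> x /fp[].
  by move=> x /fp[_ pe fD _]; exists (p x) => //; exact: le_trans e1.
have xX : C1_bound MX (fun x => x).
  move=> x /andP[ax xb]; have x0 := lt_le_trans a0 ax; split.
    by rewrite gtr0_norm// /MX; lra.
  exists 1; first exact: is_derive_id.
  by rewrite normr1 /MX; lra.
have BB : C1_bound MB (fun x => balance m x (f x)).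
  rewrite (_ : (fun x => _) = (fun x => (m - 1) * x^-1 + m * x * ((f x)^-1 * (f x)^-1))).
    apply: C1_boundD; first by apply: C1_boundM => //; exact: C1_bound_cst.
    by apply: C1_boundM; apply: C1_boundM => //; exact: C1_bound_cst.
  by apply/funext => x; rewrite /balance expr2 invfM.
have pM : C1_bound (Mp * e) p.
  move=> x xI; have [_ pe _ pD] := fp x xI; have [Bx _] := BB x xI.
  have pe1 : `|p x| <= 1 by exact: le_trans e1.
  split; first by apply: le_trans pe _; rewrite ler_peMl// /Mp lerDl mulr_ge0.
  exists (- (p x * (1 + p x * p x) * balance m x (f x))) => //.
  rewrite normrN !normrM.
  have p2 : `|1 + p x * p x| <= 2.
    rewrite (le_trans (ler_normD _ _))// normr1 normrM.
    have := ler_pM (normr_ge0 _) (normr_ge0 _) pe1 pe1; lra.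
  have := ler_pM (mulr_ge0 (normr_ge0 _) (normr_ge0 _)) (normr_ge0 _)
    (ler_pM (normr_ge0 _) (normr_ge0 _) pe p2) Bx.
  rewrite /Mp; lra.
have pM1 : C1_bound Mp p by apply: C1_bound_le pM; rewrite ler_piMr.
split.
  apply: (@C1_bound_le (2 * (Mp * e) * MV)); last exact: C1_boundM.
  have -> : 2 * (Mp * e) * MV = 2 * Mp * MV * e by ring.
  by rewrite ler_wpM2r// lerDl mulr_ge0// mulr_ge0.
apply: (@C1_bound_le (2 * (Mp * e) * Mh)).
  have -> : 2 * (Mp * e) * Mh = 2 * Mp * Mh * e by ring.
  by rewrite ler_wpM2r// lerDr mulr_ge0// mulr_ge0.
apply: C1_boundM => //; apply: C1_boundM => //; apply: C1_boundN.
apply: C1_boundD; last exact: C1_boundM.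
apply: C1_boundM => //; apply: C1_boundM => //.
by apply: C1_boundD; [exact: C1_bound_cst|exact: C1_boundM].
Qed.

End BoundedC1.

(** * The generating curve and its two sheets *)

Section Catenoid.
Variable R : realType.
Implicit Types (m h r s x y t e u : R).

(** [z] is kept beside its inverse [T] because the slope serves as the coordinate along the line
    factor of the annulus. *)
Definition catenoid_curve m h r rm rp (Rad T z : R -> R) : Prop :=
  [/\ neck rm rp Rad h r,
      (forall y, rm < y < rp -> is_derive y 1 Rad (T y)),
      (forall y, rm < y < rp ->
         is_derive y 1 T ((1 + T y ^+ 2) * balance m (Rad y) y)),
      (forall k, Ck1 k [set y | rm < y < rp] T /\
                 Ck1 k [set y | rm < y < rp] Rad) &
      [/\ continuous z, (forall t, rm < z t < rp), cancel z T &
          (forall y, rm < y < rp -> z (T y) = y)]].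

(* One of the two sheets, as a graph over the radial variable: [s = 1] for the
   upper and [s = -1] for the lower one; [p = f'] is the slope, [l] the limit. *)
Definition catenoid_sheet m h r rm rp (Rad T : R -> R) s l (f p : R -> R) : Prop :=
  [/\ continuous f /\ (forall k, Ck1 k [set x | r < x] f),
      (forall x, x <= r -> f x = h) /\ (forall x, r < x -> 0 < s * (f x - h)),
      (forall x, r <= x -> rm < f x < rp /\ Rad (f x) = x) /\
      (forall y, rm < y < rp -> 0 <= s * T y -> f (Rad y) = y),
      (forall e, 0 < e -> exists X, forall x, X <= x -> `|f x - l| < e) &
      (forall x, r < x -> [/\ is_derive x 1 f (p x),
         is_derive x 1 p (- (p x * (1 + p x * p x) * balance m x (f x))) &
         forall e, 0 < e -> e <= 1 -> 2 * r <= x * e -> `|p x| <= e])].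

(* Bounds for [|log (z / h)|]: unconditional, sharp for large [r], sharp for small [r]. *)
Definition neck_gap h r (rm rp : R) : Prop :=
  forall u, u \in [:: 1; h * expR 1 / r; 4 * Num.sqrt (expR 1 / h * r)] ->
    h * expR (- u) <= rm /\ rp <= h * expR u.

Lemma catenoid_exists m h r : 2 <= m -> 0 < h -> 0 < r ->
  exists rm rp (Rad T z fm fp pm pp : R -> R),
  [/\ catenoid_curve m h r rm rp Rad T z,
      catenoid_sheet m h r rm rp Rad T (-1) rm fm pm,
      catenoid_sheet m h r rm rp Rad T 1 rp fp pp &
      neck_gap h r rm rp].
Proof.
move=> m2 h0 r0; have [rho [z pf]] := profile_exists m2 h0 r0.
have [rm [rp [T [[rm0 zI zK] zT D sm [ends bnd]]]]] := height_inverse m2 h0 pf.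
have [rho0 z0 pos rhoD zD] := pf.
have zlt := z_lt m2 pf.
have Tz y : rm < y < rp -> z (T y) = y := zT y.
have Th : T h = 0 by rewrite -z0 zK.
have hI : rm < h < rp by rewrite -z0.
have rho_gt t : t != 0 -> r < rho t.
  rewrite neq_lt => /orP[t0|t0].
    have := @branch_rho_lt _ _ _ _ _ _ m2 pf (-1) 0 (- t).
    by rewrite mulrNN mul1r mulr0 rho0 sqrrN expr1n oppr_gt0; apply.
  have := @branch_rho_lt _ _ _ _ _ _ m2 pf 1 0 t.
  by rewrite !mul1r rho0 expr1n; apply.
have rho_far B : exists2 t, 0 < t & B < rho t.
  have [t t0 Bt] := branch_rho_unbounded m2 h0 r0 pf B (expr1n R 2).
  by exists t => //; rewrite -[t]mul1r.
have curve : catenoid_curve m h r rm rp (rho \o T) T z.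
  split.
  - split => //=.
    + by move=> y; have [] := pos (T y).
    + by rewrite Th.
    + split.
        move=> y yI; split; first exact: (rho_ge m2 pf).
        have [T0|T0] := eqVneq (T y) 0; first by rewrite -(Tz y yI) T0 z0.
        by have := rho_gt _ T0; lra.
      move=> B; have [t t0 Bt] := rho_far B; exists (z t) => //.
      by rewrite /= zK ltW.
  - by move=> y /D[].
  - by move=> y /D[].
  - exact: sm.
  - by split=> // t; exact: (is_derive_continuous (zD t)).
have sheet s l : s ^+ 2 = 1 ->
    (forall e, 0 < e -> exists t, forall t', 0 <= t' -> t <= t' -> `|z (s * t') - l| < e) ->
    (forall t, 0 < t -> 0 < s * (z (s * t) - h)) ->
    exists f p, catenoid_sheet m h r rm rp (rho \o T) T s l f p.
  move=> s1 zl zs.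
  have [tau [f [[tau0 taur fE fc] taurho rhotau fD fsm]]] := radial_graph m2 h0 r0 pf s1.
  exists f, (fun x => s / tau x); split.
  - by split=> // k; have [] := fsm k.
  - split; first by move=> x xr; rewrite fE taur// mulr0 z0.
    by move=> x /fD[tx _ _]; rewrite fE zs.
  - split.
      by move=> x rx; rewrite fE /= zK rhotau.
    move=> y yI sT; rewrite fE /=.
    have -> : T y = s * (s * T y) by rewrite mulrA -expr2 s1 mul1r.
    by rewrite taurho// mulrA -expr2 s1 mul1r Tz.
  - move=> e e0; have [t tP] := zl e e0.
    exists (Num.max r (rho (s * Num.max t 0))) => x; rewrite ge_max => /andP[rx xt].
    rewrite fE; apply: tP => //; rewrite leNgt; apply/negP => tt.
    have ttm : tau x < Num.max t 0 by rewrite lt_max tt.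
    by have := branch_rho_lt m2 pf s1 (tau0 x) ttm; rewrite rhotau//; lra.
  - move=> x rx; have [tx fx taux] := fD x rx; split=> //.
    + apply: (is_derive_eq (is_deriveM (is_derive_cst s (x : R) (1 : R))
        (is_deriveV (lt0r_neq0 tx) taux))).
      rewrite -![_ *: _]/(_ * _) mulr0 addr0.
      rewrite (_ : s / tau x * (s / tau x) = (tau x ^+ 2)^-1); last first.
        by rewrite mulrACA -expr2 s1 mul1r expr2 invfM.
      by rewrite /cst; field; rewrite gt_eqF.
    (* From [x^2 <= r^2 * (1 + tau^2)] and [2 * r <= x * e] follows [4 <= e^2 * (1 + tau^2)]; as
       [e <= 1], this gives [1 <= e * tau]. The factor 2 absorbs the summand 1. *)
    + move=> e e0 e1 rxe.
      have x0 : 0 < x by exact: lt_trans rx.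
      rewrite normrM normfV (gtr0_norm tx).
      have -> : `|s| = 1 by apply/eqP; rewrite -(@eqrXn2 _ 2)// expr1n -normrX s1 normr1.
      rewrite mul1r -[e]invrK lef_pV2 ?posrE ?invr_gt0//.
      have := branch_rho_upper m2 pf s1 (tau0 x); rewrite rhotau ?(ltW rx)// => xu.
      have eV : 0 <= e^-1 by rewrite invr_ge0 ltW.
      rewrite -(@ler_pXn2r _ 2)// ?nnegrE// exprVn.
      rewrite -(ler_pM2r (exprn_gt0 2 e0)) mulVf ?expf_neq0 ?gt_eqF//.
      have r2 : 0 < r ^+ 2 by rewrite exprn_gt0.
      rewrite -(ler_pM2l r2) mulr1.
      have e2 : 0 < e ^+ 2 by rewrite exprn_gt0.
      have e21 : e ^+ 2 <= 1 by rewrite expr_le1// ltW.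
      have h1 : (2 * r) ^+ 2 <= (x * e) ^+ 2.
        by rewrite lerXn2r ?nnegrE// mulr_ge0// ltW.
      have h2 : x ^+ 2 * e ^+ 2 <= r ^+ 2 * (1 + tau x ^+ 2) * e ^+ 2.
        by rewrite ler_wpM2r// ltW.
      have h3 : r ^+ 2 * e ^+ 2 <= r ^+ 2 * 1 by rewrite ler_wpM2l// ltW.
      by move: h1; rewrite !exprMn; lra.
have zle t u : t <= u -> z t <= z u by rewrite le_eqVlt => /predU1P[->//|/zlt/ltW].
have [fm [pm Sm]] : exists f p, catenoid_sheet m h r rm rp (rho \o T) T (-1) rm f p.
  apply: sheet; first by rewrite sqrrN expr1n.
    move=> e e0; have [[t te] _] := ends e e0; exists (- t) => t' t0 tt'.
    have /andP[zl _] := zI (-1 * t').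
    have := zle (-1 * t') t; rewrite mulN1r => /(_ ltac:(lra)) zz.
    by rewrite mulN1r in zl; rewrite ltr_norml; lra.
  by move=> t t0; have := zlt (-1 * t) 0; rewrite z0; move=> /(_ ltac:(lra)); lra.
have [fp [pp Sp]] : exists f p, catenoid_sheet m h r rm rp (rho \o T) T 1 rp f p.
  apply: sheet; first by rewrite expr1n.
    move=> e e0; have [_ [t te]] := ends e e0; exists t => t' t0 tt'.
    have /andP[_ zu] := zI (1 * t').
    have := zle t (1 * t'); rewrite mul1r => /(_ tt') zz.
    by rewrite mul1r in zu; rewrite ltr_norml; lra.
  by move=> t t0; have := zlt 0 (1 * t); rewrite z0; move=> /(_ ltac:(lra)); lra.
exists rm, rp, (rho \o T), T, z, fm, fp, pm, pp; split=> // u uI.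
have half : forall s t, s ^+ 2 = 1 -> 0 <= t -> h * expR (- u) <= z (s * t) <= h * expR u.
  move=> s t s1 t0; move: uI; rewrite !inE => /or3P[] /eqP ->.
  - exact: (branch_z_bound1 m2 h0 pf).
  - exact: (branch_z_bound_wide m2 h0 r0 pf).
  - exact: (branch_z_bound_narrow m2 h0 r0 pf).
apply: bnd => t; have [t0|t0] := leP 0 t.
  by have := half 1 t; rewrite mul1r expr1n; apply.
have := half (-1) (- t); rewrite mulrNN mul1r sqrrN expr1n; apply => //.
by rewrite oppr_ge0 ltW.
Qed.

End Catenoid.

Lemma normM_le (R : numDomainType) (u v U V : R) : `|u| <= U -> `|v| <= V -> `|u * v| <= U * V.
Proof. by move=> uU vV; rewrite normrM ler_pM. Qed.

(** * The [C^(2,alpha)] norm of a radial function *)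

Section RadialC2alpha.
Variables (R : realType) (n : nat).
Implicit Types (x y v : 'rV[R]_n) (K : set 'rV[R]_n) (M : R).

Lemma abs_coord_le x i : `|x 0 i| <= enorm x.
Proof.
rewrite -(@ler_pXn2r _ 2)// ?nnegrE ?enorm_ge0// real_normK ?num_real// sqr_enorm.
by rewrite (bigD1 i)//= lerDl sumr_ge0// => j _; exact: sqr_ge0.
Qed.

Lemma enorm_derive x v : x != 0 ->
  differentiable (@enorm R n) x /\ 'D_v (@enorm R n) x = edot x v / enorm x.
Proof.
move=> x0; have ex := enorm_gt0 x0.
pose u (y : 'rV[R]_n) := \sum_i y 0 i * y 0 i.
have us : Ck_on 1 [set: 'rV[R]_n] u.
  apply: Ck_on_sum => [|i]; first exact: openT.
  by apply: Ck_onM; [exact: openT|exact: Ck_on_coord|exact: Ck_on_coord].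
have ud : differentiable u x := us.1 x I.
have ux : u x = enorm x ^+ 2 by rewrite enorm_sqr.
have uD : 'D_v u x = 2 * edot x v.
  have : is_derive x v u (\sum_i (x 0 i * v 0 i + x 0 i * v 0 i)).
    rewrite /u -fct_sumE; apply: is_derive_sum => i.
    by apply: is_deriveM; exact: is_derive_proj.
  case=> _ ->; rewrite /edot mulr_sumr; apply: eq_bigr => i _; ring.
have enE : @enorm R n = (fun y => Num.sqrt (u y)).
  by apply/funext => y; congr Num.sqrt; apply: eq_bigr => i _; rewrite expr2.
have u0 : 0 < u x by rewrite ux exprn_gt0.
have sD := is_derive1_sqrt u0.
split.
  rewrite enE; apply: (differentiable_comp ud).
  by apply/derivable1_diffP; case: sD.
have [_] := is_derive_comp_scalar v ud sD.
rewrite -enE uD => ->; rewrite ux sqrtr_sqr gtr0_norm//; field.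
by rewrite gt_eqF.
Qed.

Lemma radial_derive (f : R -> R) x v l : x != 0 -> is_derive (enorm x) 1 f l ->
  is_derive x v (fun y => f (enorm y)) (l * (edot x v / enorm x)).
Proof.
move=> x0 fD; have [ed <-] := enorm_derive v x0.
exact: is_derive_comp_scalar.
Qed.

Lemma edot_basis x i : edot x (basis_vec R i) = x 0 i.
Proof.
rewrite /edot (bigD1 i)//= big1 ?addr0 => [|j ji]; rewrite /basis_vec mxE.
  by rewrite !eqxx mulr1.
by rewrite (negbTE ji) andbF mulr0.
Qed.

Variables (a b m c e : R) (f p : R -> R).
Hypotheses (a0 : 0 < a) (c0 : 0 < c).
Hypothesis fp : small_slope a b m c e f p.

Let annulus : set 'rV[R]_n := [set x | a < enorm x < b].

Lemma open_annulus : open annulus.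
Proof.
rewrite (_ : annulus = @enorm R n @^-1` `]a, b[%classic).
  by apply: open_comp; [move=> x _; exact: enorm_continuous|exact: itv_open].
by apply/seteqP; split=> x; rewrite /annulus /= in_itv.
Qed.

Let annulus_neq0 x : annulus x -> x != 0.
Proof.
move=> /andP[ax _]; apply/eqP => x0; move: ax.
by rewrite x0 enorm0 ltNge ltW.
Qed.

Let annulusW x : annulus x -> a <= enorm x <= b.
Proof. by move=> /andP[/ltW -> /ltW ->]. Qed.

Lemma radial_partial (h : R) j x : annulus x ->
  partial j (fun y => f (enorm y) - h) x = radial_grad p (enorm x) * x 0 j.
Proof.
move=> ax; have x0 := annulus_neq0 ax; have [_ _ fD _] := fp (annulusW ax).
have D := radial_derive (basis_vec R j) x0 fD.
have [_] := is_deriveB D (is_derive_cst h x (basis_vec R j)).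
rewrite /partial subr0 => ->; rewrite edot_basis /radial_grad mulrCA mulrC; ring.
Qed.

Lemma radial_partial2 (h : R) i j x : annulus x ->
  partial i (partial j (fun y => f (enorm y) - h)) x =
    radial_hess m f p (enorm x) * x 0 i * x 0 j + radial_grad p (enorm x) * (i == j)%:R.
Proof.
move=> ax; have x0 := annulus_neq0 ax.
have -> : partial i (partial j (fun y => f (enorm y) - h)) x =
    partial i (fun y => radial_grad p (enorm y) * y 0 j) x.
  apply: near_eq_derive.
  have : \near x, annulus x by apply: open_nbhs_nbhs; split=> //; exact: open_annulus.
  by apply: filterS => y /(radial_partial h j).
have gD := radial_grad_derive a0 c0 fp (annulusW ax).
have D := radial_derive (basis_vec R i) x0 gD.
have [_] := is_deriveM D (is_derive_proj x (basis_vec R i) j).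
rewrite /partial => ->; rewrite -![_ *: _]/(_ * _) edot_basis /basis_vec mxE eqxx/= [j == i]eq_sym.
have e0 : enorm x != 0 by rewrite gt_eqF// enorm_gt0.
by field.
Qed.

Lemma sup_norm_le K (F : 'rV[R]_n -> R) M : 0 <= M ->
  (forall x, K x -> `|F x| <= M) -> (sup_norm K F <= M%:E)%E.
Proof.
move=> M0 FM; apply: ge_ereal_sup => _ [->|[x Kx <-]]; first by rewrite lee_fin.
by rewrite lee_fin FM.
Qed.

(** A Lipschitz function on a set of diameter at most [2 * d]: the distance is split as its power
    [1 - alpha], bounded by the diameter, times its power [alpha]. *)
Lemma holder_seminorm_le (alpha : R) K (F : 'rV[R]_n -> R) M d : 0 < alpha < 1 ->
  0 <= M -> 0 < d -> (forall x, K x -> enorm x <= d) ->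
  (forall x y, K x -> K y -> `|F x - F y| <= M * enorm (x - y)) ->
  (holder_seminorm alpha K F <= (M * (2 * d) `^ (1 - alpha))%:E)%E.
Proof.
move=> /andP[al0 al1] M0 d0 Kd FM; apply: ge_ereal_sup => z [->|].
  by rewrite lee_fin mulr_ge0// powR_ge0.
move=> [x [y [Kx Ky xy ->]]]; rewrite lee_fin.
have t0 : 0 < enorm (x - y) by apply: enorm_gt0; rewrite subr_eq0.
rewrite ler_pdivrMr ?powR_gt0//; apply: le_trans (FM x y Kx Ky) _.
set t := enorm (x - y) in t0 *.
have tE : t = t `^ (1 - alpha) * t `^ alpha.
  by rewrite -powRD ?subrK ?powRr1// ?(ltW t0)//; apply/implyP => _; rewrite gt_eqF.
rewrite -mulrA ler_wpM2l// {1}tE ler_wpM2r ?powR_ge0//.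
apply: ge0_ler_powR; rewrite ?nnegrE; first by rewrite subr_ge0 ltW.
- exact: ltW.
- by rewrite mulr_ge0// ltW.
- have := enormD x (- y); rewrite enormN -/t.
  have := Kd x Kx; have := Kd y Ky; lra.
Qed.

Lemma radial_C2alpha_le (alpha : R) K (h M : R) : 0 < alpha < 1 -> 0 < b -> 0 <= M ->
  K `<=` annulus -> (forall t : R, a <= t <= b -> `|f t - h| <= M) ->
  C1_bound a b M (radial_grad p) -> C1_bound a b M (radial_hess m f p) ->
  (C2alpha_norm alpha K (fun x => f (enorm x) - h)%R <=
   (M * (1 + b + b ^+ 2 + (b ^+ 2 + 2 * b + 1) * (2 * b) `^ (1 - alpha))
      * (1 + n%:R + 2 * n%:R ^+ 2))%:E)%E.
Proof.
move=> al b0 M0 Ka fM gM hM.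
set P := (2 * b) `^ (1 - alpha); have P0 : 0 <= P by exact: powR_ge0.
(* Large enough that [M * Q] bounds each summand of the norm separately; there are [1 + n + 2 * n^2]
   of them. *)
set Q := 1 + b + b ^+ 2 + (b ^+ 2 + 2 * b + 1) * P.
have b2 := sqr_ge0 b.
have X0 : 0 <= (b ^+ 2 + 2 * b + 1) * P by rewrite mulr_ge0//; lra.
have le_MQ (t : R) : t <= Q -> M * t <= M * Q by move=> tQ; apply: ler_wpM2l.
have Q1 : M <= M * Q by rewrite -[leLHS]mulr1; apply: le_MQ; rewrite /Q; lra.
have MQ0 : 0 <= M * Q by exact: le_trans Q1.
have coord x i : K x -> `|x 0 i| <= b.
  by move=> /Ka/andP[_ xb]; apply: le_trans (abs_coord_le x i) _; exact: ltW.
have kron (i j : 'I_n) : `|(i == j)%:R : R| <= 1.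
  by case: (i == j); rewrite ?normr1 ?normr0.
have hF x i j : K x -> partial i (partial j (fun y => f (enorm y) - h)) x =
    radial_hess m f p (enorm x) * x 0 i * x 0 j + radial_grad p (enorm x) * (i == j)%:R.
  by move=> /Ka; exact: radial_partial2.
have s0 : (sup_norm K (fun x => f (enorm x) - h)%R <= (M * Q)%:E)%E.
  apply: sup_norm_le => // x Kx; apply: le_trans Q1; apply: fM.
  exact: annulusW (Ka _ Kx).
have s1 j : (sup_norm K (partial j (fun x => f (enorm x) - h)%R) <= (M * Q)%:E)%E.
  apply: sup_norm_le => // x Kx; rewrite radial_partial; last exact: Ka.
  apply: (@le_trans _ _ (M * b)); last by apply: le_MQ; rewrite /Q; lra.
  by rewrite normrM ler_pM// ?coord//; case: (gM _ (annulusW (Ka _ Kx))).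
have s2 i j : (sup_norm K (partial i (partial j (fun x => f (enorm x) - h)%R)) <= (M * Q)%:E)%E.
  apply: sup_norm_le => // x Kx; rewrite hF//.
  apply: (@le_trans _ _ (M * (b ^+ 2 + 1))); last by apply: le_MQ; rewrite /Q; lra.
  have -> : M * (b ^+ 2 + 1) = M * b * b + M * 1 by ring.
  have [gx _] := gM _ (annulusW (Ka _ Kx)); have [hx _] := hM _ (annulusW (Ka _ Kx)).
  apply: le_trans (ler_normD _ _) _; apply: lerD; last exact: normM_le.
  by apply: normM_le; [apply: normM_le => //; exact: coord|exact: coord].
have s3 i j : (holder_seminorm alpha K (partial i (partial j (fun x => f (enorm x) - h)%R))
    <= (M * Q)%:E)%E.
  apply: (@le_trans _ _ (M * (b ^+ 2 + 2 * b + 1) * P)%:E); last first.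
    by rewrite lee_fin -mulrA; apply: le_MQ; rewrite /Q; lra.
  apply: holder_seminorm_le => //.
  - by rewrite mulr_ge0//; lra.
  - by move=> x /Ka/andP[_ /ltW].
  move=> x y Kx Ky; rewrite !hF//.
  have xI := annulusW (Ka _ Kx); have yI := annulusW (Ka _ Ky).
  have lip := enorm_dist x y; set d := enorm (x - y) in lip *.
  have d0 : 0 <= d by exact: enorm_ge0.
  have cd k : `|x 0 k - y 0 k| <= d.
    by have := abs_coord_le (x - y) k; rewrite !mxE.
  have gd : `|radial_grad p (enorm x) - radial_grad p (enorm y)| <= M * d.
    by apply: le_trans (C1_bound_lipschitz gM xI yI) _; rewrite ler_wpM2l.
  have hd : `|radial_hess m f p (enorm x) - radial_hess m f p (enorm y)| <= M * d.
    by apply: le_trans (C1_bound_lipschitz hM xI yI) _; rewrite ler_wpM2l.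
  have [hy _] := hM _ yI.
  set A := radial_hess m f p (enorm x) in hd *; set B := radial_hess m f p (enorm y) in hd hy *.
  set A' := radial_grad p (enorm x) in gd *; set B' := radial_grad p (enorm y) in gd *.
  (* The difference of products is telescoped so that each term contains a single increment. *)
  have -> : A * x 0 i * x 0 j + A' * (i == j)%:R - (B * y 0 i * y 0 j + B' * (i == j)%:R) =
     (A - B) * (x 0 i * x 0 j) + B * (x 0 i - y 0 i) * x 0 j
      + B * y 0 i * (x 0 j - y 0 j) + (A' - B') * (i == j)%:R by ring.
  have -> : M * (b ^+ 2 + 2 * b + 1) * d = M * d * (b * b) + M * d * b + M * b * d + M * d * 1.
    by ring.
  apply: le_trans (ler_normD _ _) _; apply: lerD; last exact: normM_le.
  apply: le_trans (ler_normD _ _) _; apply: lerD; last first.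
    by apply: normM_le => //; apply: normM_le => //; exact: coord.
  apply: le_trans (ler_normD _ _) _; apply: lerD.
    by apply: normM_le => //; apply: normM_le; exact: coord.
  by apply: normM_le; [exact: normM_le|exact: coord].
rewrite /C2alpha_norm.
have -> : M * Q * (1 + n%:R + 2 * n%:R ^+ 2) =
    M * Q + \sum_(i < n) (M * Q) + \sum_(i < n) \sum_(j < n) (M * Q + M * Q).
  move: (M * Q) => W; rewrite !sumr_const card_ord.
  by rewrite -(mulr_natr W) -(mulr_natr (_ *+ n)) -(mulr_natr (W + W)); ring.
rewrite 2!EFinD -!sumEFin; apply: leeD; first apply: leeD => //.
  by apply: lee_sum => i _; exact: s1.
by apply: lee_sum => i _; apply: lee_sum => j _; rewrite EFinD leeD.
Qed.

Lemma C2alpha_norm_ge0 (alpha : R) K (F : 'rV[R]_n -> R) : (0 <= C2alpha_norm alpha K F)%E.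
Proof.
have sup0 G : (0 <= sup_norm K G)%E by apply: ereal_sup_ubound; left.
have hol0 G : (0 <= holder_seminorm alpha K G)%E by apply: ereal_sup_ubound; left.
rewrite /C2alpha_norm; apply: adde_ge0; first apply: adde_ge0 => //.
  by apply: sume_ge0.
by apply: sume_ge0 => i _; apply: sume_ge0 => j _; exact: adde_ge0.
Qed.

End RadialC2alpha.

(** * The catenoids *)

Section CatenoidHypersurface.
Variables (R : realType) (n' : nat).
Let n := n'.+1.
Notation pt := 'rV[R]_(n + 1).
Variables (h r rm rp : R) (Rad T z : R -> R).
Hypotheses (h0 : 0 < h) (r0 : 0 < r).
Hypothesis curve : catenoid_curve n%:R h r rm rp Rad T z.

Let S : set pt := revolution rm rp Rad.
Let D : set 'rV[R]_n := ~` eball r.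
Let phi (f : R -> R) : 'rV[R]_n -> R := fun x => f (enorm x).

Lemma catenoid_translator : translator S.
Proof.
have [[rm0 _ Rad0 _ _] RadD TD sm _] := curve.
by apply: revolution_translator TD _ _ => // k; case: (sm k).
Qed.

Lemma enorm_orthogonal (x : 'rV[R]_n) (Q : 'M[R]_n) : Q *m Q^T = 1%:M ->
  enorm (x *m Q) = enorm x.
Proof.
have sq (y : 'rV[R]_n) : \sum_i y 0 i ^+ 2 = (y *m y^T) 0 0.
  by rewrite mxE; apply: eq_bigr => i _; rewrite mxE expr2.
move=> QQ; rewrite /enorm !sq trmx_mul mulmxA -(mulmxA x) QQ mulmx1.
by [].
Qed.

Lemma revolution_rotational : rotational S.
Proof.
move=> Q QQ _ p [pI pR].
have hE : height (row_mx (base p *m Q) (rsubmx p)) = height p.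
  by rewrite heightE row_mxEr [in RHS]/height mxE.
by split; rewrite hE// /base row_mxKl enorm_orthogonal.
Qed.

(** A point corresponds to its direction [x / |x|] and the slope of the meridian there; the slope
    runs over the whole line exactly once. *)
Lemma catenoid_annular : annular S.
Proof.
have [[rm0 _ Rad0 _ [Radr _]] RadD TD sm [zc zI zK Tz]] := curve.
pose F (p : pt) : 'rV[R]_n * R := ((enorm (base p))^-1 *: base p, T (height p)).
pose G (q : 'rV[R]_n * R) : pt := row_mx (Rad (z q.2) *: q.1) (\row_(j < 1) z q.2).
have Radzc t : {for t, continuous (Rad \o z)}.
  apply: continuous_comp; first exact: zc.
  exact: (is_derive_continuous (RadD _ (zI t))).
exists F, G; split.
- apply: continuous_in_subspaceT => p; rewrite inE => Sp.
  have Rp : enorm (base p) != 0 by case: Sp => _ ->; rewrite gt_eqF.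
  have ec : {for p, continuous (fun q : pt => enorm (base q))}.
    by apply: continuous_comp; [exact: base_continuous|exact: enorm_continuous].
  have c1 : {for p, continuous (fun q : pt => (enorm (base q))^-1 *: base q)}.
    apply: continuous_rV => i.
    rewrite (_ : (fun q => _) = (fun q : pt => (enorm (base q))^-1 * q 0 (lshift 1 i))).
      by apply: continuousM; [exact: continuousV|exact: coord_continuous].
    by apply/funext => q; rewrite !mxE.
  have c2 : (fun q : pt => T (height q)) x @[x --> p] --> T (height p).
    apply: (@continuous_comp _ _ _ (@height R n) T); first exact: height_continuous.
    exact: (is_derive_continuous (TD _ Sp.1)).
  exact: cvg_pair c1 c2.
- apply: continuous_subspaceT => -[x t]; apply: continuous_rV => i.
  rewrite -(splitK i); case: (fintype.split i) => j /=.
    rewrite (_ : (fun q => _) = (fun q : 'rV[R]_n * R => (Rad \o z) q.2 * q.1 0 j)).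
      apply: continuousM.
        by apply: continuous_comp; [exact: cvg_snd|exact: Radzc].
      apply: (@continuous_comp _ _ _ fst (fun y : 'rV[R]_n => y 0 j)); first exact: cvg_fst.
      exact: coord_continuous.
    by apply/funext => q; rewrite row_mxEl mxE.
  rewrite (_ : (fun q => _) = (fun q : 'rV[R]_n * R => z q.2)).
    by apply: continuous_comp; [exact: cvg_snd|exact: zc].
  by apply/funext => q; rewrite row_mxEr mxE.
- move=> p Sp; have [pI pR] := Sp; split.
    split=> //=; rewrite /unit_sphere /= enormZ normfV ger0_norm ?enorm_ge0//.
    by rewrite mulVf// pR gt_eqF.
  rewrite /G /F /= Tz// -pR scalerA divff ?scale1r ?pR ?gt_eqF//.
  rewrite -[RHS]row_mx_base; congr row_mx; apply/rowP => j.
  by rewrite ord1 !mxE.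
- move=> [x t] [/= x1 _]; rewrite /F /G; split.
    by split; rewrite height_row_mx// base_row_mx enormZ x1 mulr1 gtr0_norm.
  rewrite height_row_mx base_row_mx zK enormZ x1 mulr1 gtr0_norm// scalerA.
  by rewrite mulVf ?scale1r// gt_eqF.
Qed.

Lemma sheet_continuous s l f p :
  catenoid_sheet n%:R h r rm rp Rad T s l f p -> continuous (phi f).
Proof.
move=> [[fc _] _ _ _ _] x.
by apply: continuous_comp; [exact: enorm_continuous|exact: fc].
Qed.

Lemma sheet_smooth s l f p :
  catenoid_sheet n%:R h r rm rp Rad T s l f p -> smooth_on (interior D) (phi f).
Proof.
move=> [[_ fk] _ _ _ _] k; rewrite /D interior_exterior//.
have oD : open [set x : 'rV[R]_n | r < enorm x].
  by rewrite -interior_exterior//; exact: open_interior.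
apply: (Ck_on_comp (I := [set x | r < x])) => //.
by apply: enorm_smooth => // x; exact: lt_trans.
Qed.

Lemma sheet_boundary s l f p : catenoid_sheet n%:R h r rm rp Rad T s l f p ->
  vgraph_boundary (phi f) D = [set p | enorm (base p) = r /\ height p = h].
Proof.
move=> [_ [fh _] _ _ _]; apply/seteqP; split=> q.
  by move=> [/(exterior_boundary _ r0) qr qf]; split=> //; rewrite qf /phi qr fh.
move=> [qr qh]; split; first exact/(exterior_boundary _ r0).
by rewrite /phi qr fh.
Qed.

Lemma sheet_asymptotic s l f p : catenoid_sheet n%:R h r rm rp Rad T s l f p ->
  asymptotic_to (phi f) l.
Proof.
move=> [_ _ _ fl _] e e0; have [X XP] := fl e e0.
near=> M => x Mx; apply: XP; apply: le_trans Mx; near: M.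
exact: nbhs_pinfty_ge (num_real X).
Unshelve. all: by end_near. Qed.

Lemma sheet_off_boundary s l f p q : catenoid_sheet n%:R h r rm rp Rad T s l f p ->
  (vgraph (phi f) D `\` vgraph_boundary (phi f) D) q ->
  rm < height q < rp /\ 0 < s * (height q - h).
Proof.
move=> sf [[Dq qf] nb]; have [_ [_ fs] [fI _] _ _] := sf.
have /exteriorE rq := Dq; rewrite qf; split; first by case: (fI _ rq).
apply: fs; rewrite lt_neqAle rq andbT; apply/eqP => rE; apply: nb.
by split=> //; exact/(exterior_boundary _ r0).
Qed.

Lemma sheet_sub s l f p : catenoid_sheet n%:R h r rm rp Rad T s l f p ->
  vgraph (phi f) D `<=` S.
Proof.
move=> [_ _ [fI _] _ _] q [/exteriorE rq qf].
by have [qI qR] := fI _ rq; split; rewrite qf.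
Qed.

Lemma sheet_sup s l f p : catenoid_sheet n%:R h r rm rp Rad T s l f p ->
  forall q, S q -> 0 <= s * T (height q) -> vgraph (phi f) D q.
Proof.
move=> [_ _ [_ fR] _ _] q [qI qR] sT.
have [[_ _ _ _ [Radr _]] _ _ _ _] := curve.
split; first by apply/exteriorE; rewrite qR; case: (Radr _ qI).
by rewrite /phi qR fR.
Qed.

Lemma catenoid_asymptotic_boundary : asymptotic_boundary S = [set None].
Proof.
have [[rm0 _ Rad0 _ [_ Radfar]] _ _ _ _] := curve.
apply: (asymptotic_boundary_infinity rm0); first by move=> q [/andP[]].
move=> B; have [y yI By] := Radfar B; exists (axis_point n' (Rad y) y).
  by apply: axis_point_revolution => //; rewrite gtr0_norm.
apply: le_trans By _; apply: le_trans (enorm_base_le _).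
by rewrite axis_point_base enorm_axis_base ler_norm.
Qed.

Variables (fm fp pm pp : R -> R).
Hypothesis lower : catenoid_sheet n%:R h r rm rp Rad T (-1) rm fm pm.
Hypothesis upper : catenoid_sheet n%:R h r rm rp Rad T 1 rp fp pp.
Let Sm : set pt := vgraph (phi fm) D.
Let Sp : set pt := vgraph (phi fp) D.

Lemma catenoid_sheets : S = Sm `|` Sp.
Proof.
apply/seteqP; split=> q; last first.
  by case; [exact: (sheet_sub lower)|exact: (sheet_sub upper)].
move=> Sq; have [T0|T0] := leP (T (height q)) 0.
  by left; apply: (sheet_sup lower) => //; rewrite mulN1r oppr_ge0.
by right; apply: (sheet_sup upper) => //; rewrite mul1r ltW.
Qed.

(** The open height interval hides that [S] is closed in the whole of Euclidean space; the
    decomposition into two graphs of continuous functions over a closed set shows it. *)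
Lemma catenoid_properly_embedded : properly_embedded S.
Proof.
have [eS _] := catenoid_translator; split=> // K cK _.
rewrite setIC; apply: compact_closedI => //; rewrite catenoid_sheets.
have cD : closed D by apply: open_closedC; exact: open_eball.
apply: closedU; apply: closed_vgraph cD.
  exact: (sheet_continuous lower).
exact: (sheet_continuous upper).
Qed.

Lemma catenoid_components : in_distinct_components (upper_half_space `\` horosphere h)
  (Sm `\` vgraph_boundary (phi fm) D) (Sp `\` vgraph_boundary (phi fp) D).
Proof.
have [[rm0 _ _ _ _] _ _ _ _] := curve.
apply: (graphs_in_distinct_components h0 (hi := rp)) => q.
  move=> /(sheet_off_boundary lower)[/andP[q0 _]]; rewrite mulN1r opprB subr_gt0 => ->.
  by rewrite (lt_trans rm0).
by move=> /(sheet_off_boundary upper)[/andP[_ ->]]; rewrite mul1r subr_gt0 => ->.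
Qed.

End CatenoidHypersurface.

(** * Limits for small and large neck size *)

Section CatenoidLimits.
Variable R : realType.
Implicit Types (h u r y : R).

(** Since [expR u + expR (- u) >= 2], the gap above [h] dominates the gap below. *)
Lemma dist_height_le h u y : 0 < h -> h * expR (- u) <= y -> y <= h * expR u ->
  `|y - h| <= h * expR u - h.
Proof.
move=> h0 yl yu; have := expR_ge1Dx u; have := expR_ge1Dx (- u) => e1 e2.
have : 0 <= h * (expR u + expR (- u) - 2) by apply: mulr_ge0; lra.
by rewrite ler_norml => e3; apply/andP; split; lra.
Qed.

Lemma height_gap_cvg (F : set_system R) (FF : Filter F) h (u : R -> R) :
  u r @[r --> F] --> 0 -> h * expR (u r) - h @[r --> F] --> 0.
Proof.
move=> u0; have -> : 0 = h * expR 0 - h by rewrite expR0; ring.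
apply: cvgB; last exact: cvg_cst.
apply: cvgMl_tmp; exact: (continuous_cvg _ (@continuous_expR R 0) u0).
Qed.

Lemma height_cvg (F : set_system R) (FF : Filter F) h (u y : R -> R) : 0 < h ->
  (\forall r \near F, h * expR (- u r) <= y r /\ y r <= h * expR (u r)) ->
  u r @[r --> F] --> 0 -> y r @[r --> F] --> h.
Proof.
move=> h0 yu u0; apply/cvgrPdist_le => e e0.
have /cvgr0Pnorm_le/(_ e e0) := height_gap_cvg FF h u0.
apply: filterS2 yu => r [yl yr] re; rewrite distrC.
by apply: le_trans (dist_height_le h0 yl yr) _; exact: le_trans (ler_norm _) re.
Qed.

Lemma small_neck_gap h : 4 * Num.sqrt (expR 1 / h * r) @[r --> 0^'+] --> 0.
Proof.
have c1 : {for 0, continuous (fun r => expR 1 / h * r)} by exact: mulrl_continuous.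
have c2 := continuous_comp c1 (@sqrt_continuous R _).
have c3 := continuous_comp c2 (@mulrl_continuous R 4 _).
by have := cvg_at_right_filter c3; rewrite /= mulr0 sqrtr0 mulr0.
Qed.

Lemma large_neck_gap h : h * expR 1 / r @[r --> +oo] --> 0.
Proof.
rewrite -[X in _ --> X](mulr0 (h * expR 1)); apply: cvgMl_tmp.
apply/gtr0_cvgV0; last exact: cvg_id.
exact: nbhs_pinfty_gt.
Qed.

(** The reciprocal of the distance to the axis is continuous on [K], hence bounded. *)
Lemma compact_off_axis n (K : set 'rV[R]_(n + 1)) : compact K ->
  (forall p, K p -> base p != 0) ->
  exists a b : R, [/\ 0 < a, a < b & @base R n @` K `<=` [set x | a < enorm x < b]].
Proof.
move=> cK K0; have [b b0 Kb] := compact_enorm_bounded cK.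
pose g (p : 'rV[R]_(n + 1)) : R := (enorm (base p))^-1.
have : compact (g @` K).
  apply: continuous_compact => //; apply: continuous_in_subspaceT => p.
  rewrite inE => /K0 p0; have e0 : enorm (base p) != 0 by rewrite gt_eqF// enorm_gt0.
  have ec : {for p, continuous (fun q : 'rV[R]_(n + 1) => enorm (base q))}.
    by apply: continuous_comp; [exact: base_continuous|exact: enorm_continuous].
  have gc := @continuousV _ _ (fun q : 'rV[R]_(n + 1) => enorm (base q)) p e0 ec.
  exact: gc.
move=> /compact_bounded[M [_ HM]]; pose N : R := `|M| + 1.
have MN : M < N by have := ler_norm M; rewrite /N; lra.
have N0 : 0 < N by have := normr_ge0 M; rewrite /N; lra.
exists (N + 1)^-1, (b + N + 1); split.
- by rewrite invr_gt0; lra.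
- apply: (@lt_trans _ _ 1); last by lra.
  by rewrite invf_lt1; lra.
- move=> _ [p Kp <-] /=; have x0 := enorm_gt0 (K0 p Kp).
  have /= := HM N MN _ (ex_intro2 _ _ p Kp erefl).
  rewrite normfV gtr0_norm// => xN; apply/andP; split.
    by rewrite invf_plt ?posrE//; [lra|lra].
  by have := le_trans (enorm_base_le p) (Kb p Kp); lra.
Qed.

Lemma sheet_C2alpha_cvg n m h (f p : R -> R -> R) (alpha : R) : 0 < h -> 0 < alpha < 1 ->
  (forall r, 0 < r -> exists rm rp Rad T s l,
     catenoid_sheet m h r rm rp Rad T s l (f r) (p r) /\ neck_gap h r rm rp) ->
  @C2alpha_cvg_to_horosphere R n alpha (fun r x => f r (enorm x)) h.
Proof.
move=> h0 al fam K cK _ Koff.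
have [a [b [a0 ab Kab]]] := compact_off_axis cK Koff.
have c0 : 0 < h * expR (-1) by rewrite mulr_gt0// expR_gt0.
have [C C0 HC] := radial_C1_bound a0 m c0 (ltW ab).
pose u r := 4 * Num.sqrt (expR 1 / h * r).
(* The first term bounds the derivatives: on the annulus the slope is at most [2 * r / a] once
   [r < a / 2]. The second bounds the distance of the graph to the horosphere. *)
pose M r := C * (2 / a * r) + (h * expR (u r) - h).
pose Q := (1 + b + b ^+ 2 + (b ^+ 2 + 2 * b + 1) * (2 * b) `^ (1 - alpha))
  * (1 + n%:R + 2 * n%:R ^+ 2).
have M0 : M r @[r --> 0^'+] --> 0.
  rewrite -[X in _ --> X]addr0; apply: cvgD; last first.
    exact: (height_gap_cvg _ _ (@small_neck_gap h)).
  have c1 : {for 0, continuous (fun r => 2 / a * r)} by exact: mulrl_continuous.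
  have c2 := continuous_comp c1 (@mulrl_continuous R C _).
  by have := cvg_at_right_filter c2; rewrite /= !mulr0.
have MQ0 : (M r * Q)%:E @[r --> 0^'+] --> (0 : R)%:E.
  apply: cvg_EFin; first exact: nearW.
  rewrite -[X in _ --> X](mul0r Q); exact: cvgMr_tmp.
apply: (@squeeze_cvge _ _ _ _ (fun=> 0%E) _ _ _ _ _ MQ0); last exact: cvg_cst.
near=> r; rewrite C2alpha_norm_ge0/=.
have r0 : 0 < r by near: r; exact: nbhs_right_gt.
have ra : r < a / 2 by near: r; apply: nbhs_right_lt; rewrite divr_gt0.
have [rm [rp [Rad [T [s [l [[_ _ [fI _] _ fD] gap]]]]]]] := fam r r0.
have e0 : 0 < 2 / a * r by rewrite mulr_gt0// divr_gt0.
have e1 : 2 / a * r <= 1.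
  rewrite mulrAC ler_pdivrMr//; lra.
have [rml rpl] : h * expR (-1) <= rm /\ rp <= h * expR 1 by apply: gap; rewrite inE eqxx.
have slope : small_slope a b m (h * expR (-1)) (2 / a * r) (f r) (p r).
  move=> x /andP[ax _]; have rx : r < x by lra.
  have [/andP[fx _] _] := fI x (ltW rx); have [fDx pDx small] := fD x rx.
  split=> //; first by rewrite (le_trans rml)// ltW.
  apply: small => //; have -> : 2 * r = a * (2 / a * r) by field; rewrite gt_eqF.
  by rewrite ler_wpM2r// ltW.
have [gC hC] := HC _ _ _ (introT andP (conj (ltW e0) e1)) slope.
have [rml' rpl'] : h * expR (- u r) <= rm /\ rp <= h * expR (u r).
  by apply: gap; rewrite !inE eqxx !orbT.
have g0 : 0 <= h * expR (u r) - h.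
  by rewrite subr_ge0 ler_peMr ?(ltW h0)// -expR0 ler_expR mulr_ge0// sqrtr_ge0.
have Ce0 : 0 <= C * (2 / a * r) by rewrite mulr_ge0// ltW.
rewrite /Q mulrA; apply: (radial_C2alpha_le a0 c0 slope al).
- exact: lt_trans ab.
- exact: addr_ge0.
- exact: Kab.
- move=> t /andP[at0 _]; have rt : r <= t by lra.
  have [/andP[fl fu] _] := fI t rt.
  apply: le_trans (dist_height_le h0 (le_trans rml' (ltW fl)) (le_trans (ltW fu) rpl')) _.
  by rewrite lerDr.
- by apply: C1_bound_le gC; rewrite lerDl.
- by apply: C1_bound_le hC; rewrite lerDl.
Unshelve. all: by end_near. Qed.

End CatenoidLimits.

(** Bundles what is constructed for one neck size, so that a single choice turns all of it into
    functions of [r]. *)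
Record catenoid_data (R : realType) := CatenoidData {
  lower_end : R; upper_end : R;
  radius : R -> R; slope : R -> R; level : R -> R;
  lower_graph : R -> R; upper_graph : R -> R;
  lower_slope : R -> R; upper_slope : R -> R }.

Theorem theorem3p3 (R : realType) (n : nat) (n_ge2 : (2 <= n)%N)
    (h : R) (h_gt0 : 0 < h) :
  exists (Sigma : R -> set 'rV[R]_(n + 1)) (rm rp : R -> R)
         (phim phip : R -> 'rV[R]_n -> R),
    [/\ (forall r s : R, 0 < r -> 0 < s -> r <> s ->
           ~ congruent (Sigma r) (Sigma s)),
        (forall r : R, 0 < r ->
           let D : set 'rV[R]_n := ~` eball r in
           let Sm := vgraph (phim r) D in
           let Sp := vgraph (phip r) D in
           let bm := vgraph_boundary (phim r) D in
           let bp := vgraph_boundary (phip r) D in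
           [/\ [/\ properly_embedded (Sigma r), translator (Sigma r),
                   rotational (Sigma r) & annular (Sigma r)],
               [/\ 0 < rm r, 0 < rp r,
                   (forall p, Sigma r p -> rm r < height p < rp r) &
                   asymptotic_boundary (Sigma r) = [set None]],
               [/\ Sigma r = Sm `|` Sp,
                   {within D, continuous (phim r)},
                   {within D, continuous (phip r)},
                   smooth_on (interior D) (phim r) &
                   smooth_on (interior D) (phip r)] &
               [/\ in_distinct_components
                     (upper_half_space `\` horosphere h)
                     (Sm `\` bm) (Sp `\` bp),
                   bm = [set p | enorm (base p) = r /\ height p = h],
                   bp = [set p | enorm (base p) = r /\ height p = h],
                   asymptotic_to (phim r) (rm r) &
                   asymptotic_to (phip r) (rp r)]]),
        [/\ rm r @[r --> 0^'+] --> h, rp r @[r --> 0^'+] --> h,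
            rm r @[r --> +oo] --> h & rp r @[r --> +oo] --> h],
        (forall alpha : R, 0 < alpha < 1 ->
           C2alpha_cvg_to_horosphere alpha phim h /\
           C2alpha_cvg_to_horosphere alpha phip h) &
        (forall K : set 'rV[R]_(n + 1), compact K -> K `<=` upper_half_space ->
           \forall r \near +oo, Sigma r `&` K = set0)].
Proof.
case: n n_ge2 => // n' n_ge2; set m : R := n'.+1%:R.
have m2 : 2 <= m by rewrite /m ler_nat.
have /choice[d dP] : forall r : R, exists d : catenoid_data R, 0 < r ->
  [/\ catenoid_curve m h r (lower_end d) (upper_end d) (radius d) (slope d) (level d),
      catenoid_sheet m h r (lower_end d) (upper_end d) (radius d) (slope d) (-1)
        (lower_end d) (lower_graph d) (lower_slope d),
      catenoid_sheet m h r (lower_end d) (upper_end d) (radius d) (slope d) 1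
        (upper_end d) (upper_graph d) (upper_slope d) &
      neck_gap h r (lower_end d) (upper_end d)].
  move=> r; have [r0|r0] := ltP 0 r; last first.
    (* Nothing is claimed for [r <= 0], so arbitrary data serve. *)
    exists (CatenoidData 0 0 id id id id id id id); lra.
  have [rm [rp [Rad [T [z [fm [fp [pm [pp P]]]]]]]]] := catenoid_exists m2 h_gt0 r0.
  by exists (CatenoidData rm rp Rad T z fm fp pm pp).
exists (fun r => revolution (lower_end (d r)) (upper_end (d r)) (radius (d r))).
exists (fun r => lower_end (d r)), (fun r => upper_end (d r)).
exists (fun r x => lower_graph (d r) (enorm x)), (fun r x => upper_graph (d r) (enorm x)).
have gap r : 0 < r -> lower_end (d r) < h < upper_end (d r) /\
    neck_gap h r (lower_end (d r)) (upper_end (d r)).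
  by move=> /dP[[[_ hI _ _ _] _ _ _ _] _ _ P].
(* Both limits at once: [u] is whichever bound of [neck_gap] tends to 0 along the filter. *)
have lim (F : set_system R) (FF : Filter F) (u : R -> R) :
    (forall r, 0 < r -> u r \in [:: 1; h * expR 1 / r; 4 * Num.sqrt (expR 1 / h * r)]) ->
    (\forall r \near F, 0 < r) -> u r @[r --> F] --> 0 ->
    lower_end (d r) @[r --> F] --> h /\ upper_end (d r) @[r --> F] --> h.
  move=> uI r0 u0.
  by split; apply: (height_cvg FF h_gt0 _ u0); apply: filterS r0 => r r0;
    have [/andP[lh hu] /(_ _ (uI r r0))[]] := gap r r0; lra.
split.
- move=> r s r0 s0 rs cong; apply: rs.
  have [[nr _ _ _ _] _ _ _] := dP r r0; have [[ns _ _ _ _] _ _ _] := dP s s0.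
  exact: revolution_not_congruent h_gt0 r0 nr ns cong.
- move=> r r0; have [curve lower upper _] := dP r r0; cbv zeta.
  split.
  + split.
    * by have := catenoid_properly_embedded curve lower upper.
    * exact: catenoid_translator curve.
    * exact: revolution_rotational.
    * exact: catenoid_annular curve.
  + have [[rm0 /andP[rmh hrp] _ _ _] _ _ _ _] := curve; split => //.
    * by rewrite (lt_trans h_gt0).
    * by move=> p [].
    * exact: catenoid_asymptotic_boundary curve.
  + split.
    * by have := catenoid_sheets curve lower upper.
    * by apply: continuous_subspaceT; exact: sheet_continuous lower.
    * by apply: continuous_subspaceT; exact: sheet_continuous upper.
    * by have := sheet_smooth r0 lower.
    * by have := sheet_smooth r0 upper.
  + split.
    * by have := catenoid_components h_gt0 r0 curve lower upper.
    * by have := sheet_boundary r0 lower.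
    * by have := sheet_boundary r0 upper.
    * by have := sheet_asymptotic lower.
    * by have := sheet_asymptotic upper.
- have [l0 u0] := lim _ _ (fun r => 4 * Num.sqrt (expR 1 / h * r))
    (fun r _ => mem_last _ [:: _; _]) (nbhs_right_gt 0) (@small_neck_gap R h).
  have large r (_ : 0 < r) : h * expR 1 / r \in
      [:: 1; h * expR 1 / r; 4 * Num.sqrt (expR 1 / h * r)] by rewrite !inE eqxx orbT.
  have [loo uoo] := lim _ _ (fun r => h * expR 1 / r) large
    (nbhs_pinfty_gt (num_real 0)) (@large_neck_gap R h).
  by [].
- move=> al al01; have cvg f p := @sheet_C2alpha_cvg R n'.+1 m h f p al h_gt0 al01.
  split.
  + apply: (cvg (fun r => lower_graph (d r)) (fun r => lower_slope (d r))) => r r0.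
    have [_ lower _ P] := dP r r0.
    by exists (lower_end (d r)), (upper_end (d r)), (radius (d r)), (slope (d r)), (-1),
      (lower_end (d r)).
  + apply: (cvg (fun r => upper_graph (d r)) (fun r => upper_slope (d r))) => r r0.
    have [_ _ upper P] := dP r r0.
    by exists (lower_end (d r)), (upper_end (d r)), (radius (d r)), (slope (d r)), 1,
      (upper_end (d r)).
(* Every point of the hypersurface lies at distance at least [r] from the axis, which exceeds the
   bound on [K] for large [r]. *)
- move=> K cK _; have [M M0 KM] := compact_enorm_bounded cK.
  near=> r; apply/seteqP; split=> // p [[pI pR] /KM pM].
  have r0 : 0 < r by near: r; exact: nbhs_pinfty_gt (num_real 0).
  have rM : M < r by near: r; exact: nbhs_pinfty_gt (num_real M).
  have [[[_ _ _ _ [Radr _]] _ _ _ _] _ _ _] := dP r r0.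
  by have [rR _] := Radr _ pI; have := enorm_base_le p; rewrite pR; lra.
Unshelve. all: by end_near. Qed.
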